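(* Let $K$ be a field of characteristic $0$. There is a $coCoalg_K$-enriched functor $cALG_K\to c\widetilde{ALG}_K$ which is the identity on objects and whose mapping on Hom objects is given by $$\tau(A,A'):\mathcal M_c(A,A')\to\mathcal M_c((HC'_\bullet(A),\ast),(HC'_\bullet(A'),\ast))$$ for commutative $K$-algebras $A,A'$.
   Context: $coCoalg_K$ is the symmetric monoidal category of cocommutative $K$-coalgebras. Write $\Delta_C(x)=x_{(1)}\otimes x_{(2)}$ (Sweedler, sums suppressed; likewise iterated). For unital $K$-algebras $R,R'$, a cocommutative measuring is a $K$-linear map $\Phi:C\to\mathrm{Hom}_K(R,R')$, $C$ a cocommutative coalgebra, with $\Phi(x)(ab)=\Phi(x_{(1)})(a)\Phi(x_{(2)})(b)$ and $\Phi(x)(1)=\epsilon_C(x)1$; for non-unital algebras only the first condition is required. There is a universal cocommutative measuring $\Psi^c(R,R'):\mathcal M_c(R,R')\to\mathrm{Hom}_K(R,R')$: every cocommutative measuring $\Phi:C\to\mathrm{Hom}_K(R,R')$ equals $\Psi^c(R,R')\circ\zeta$ for a unique coalgebra map $\zeta:C\to\mathcal M_c(R,R')$. Composition $\mathcal M_c(R,R')\otimes\mathcal M_c(R',R'')\to\mathcal M_c(R,R'')$ is the unique coalgebra map corresponding to the measuring $x\otimes y\mapsto\Psi^c(R',R'')(y)\circ\Psi^c(R,R')(x)$, and the unit $K\to\mathcal M_c(R,R)$ corresponds to the measuring $K\to\mathrm{Hom}_K(R,R)$ given by scalar multiplication. This applies equally to non-unital algebras. $cALG_K$ is the $coCoalg_K$-enriched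 category of commutative unital $K$-algebras with Hom objects $\mathcal M_c(A,A')$. $c\widetilde{ALG}_K$ has the same objects and Hom objects $\mathcal M_c((HC'_\bullet(A),\ast),(HC'_\bullet(A'),\ast))$. Here $HC'_\bullet(A)=HC_{\bullet-1}(A)$. With $\bar A=A/K$, $\bar C_n(A)=A\otimes\bar A^{\otimes n}$, Hochschild differential $b$ and Connes operator $B$, $HC_\bullet(A)$ is the homology of the total complex of the normalized mixed complex $(\bar C_\bullet(A),b,B)$, whose degree $p$ term is $\bar C_p(A)\oplus\bar C_{p-2}(A)\oplus\cdots$. The product $\ast:HC_p(A)\otimes HC_q(A)\to HC_{p+q+1}(A)$ is induced by $(\tilde a_p,\tilde a_{p-2},\dots)\otimes(\tilde b_q,\tilde b_{q-2},\dots)\mapsto(B\tilde a_p\times\tilde b_q,B\tilde a_p\times\tilde b_{q-2},\dots)$, where $\times$ is the shuffle product $(a_0,\dots,a_p)\times(b_0,\dots,b_q)=\sum_\sigma\mathrm{sgn}(\sigma)\,\sigma\cdot(a_0b_0,a_1,\dots,a_p,b_1,\dots,b_q)$ over $(p,q)$-shuffles $\sigma$ ($\sigma(1)<\cdots<\sigma(p)$, $\sigma(p+1)<\cdots<\sigma(p+q)$), with $\sigma\cdot(c_0,\dots,c_n)=(c_0,c_{\sigma^{-1}(1)},\dots,c_{\sigma^{-1}(n)})$. This makes $(HC'_\bullet(A),\ast)$ an associative non-unital algebra. Any cocommutative measuring $\Phi:C\to\mathrm{Hom}_K(A,A')$ between commutative algebras induces a measuring $\Phi^\ast:C\to\mathrm{Hom}_K(HC'_\bullet(A),HC'_\bullet(A'))$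 of non-unital algebras, where $\Phi^\ast(x)$ is induced by $(a_0,\dots,a_n)\mapsto(\Phi(x_{(1)})(a_0),\dots,\Phi(x_{(n+1)})(a_n))$. $\tau(A,A')$ is the unique coalgebra map with $\Psi^c(HC'_\bullet(A),HC'_\bullet(A'))\circ\tau(A,A')=(\Psi^c(A,A'))^\ast$. *)

(* Defs.v *)
From HB Require Import structures.
From mathcomp Require Import all_boot all_algebra.
From mathcomp Require Import perm.
From mathcomp Require Import boolp.

Set Implicit Arguments.
Unset Strict Implicit.
Unset Printing Implicit Defensive.
Import GRing.Theory.
Local Open Scope ring_scope.
Local Open Scope quotient_scope.

Section LinearMaps.
Variable K : fieldType.
Implicit Types U V W : lmodType K.

Lemma lin_ext U V (f g : {linear U -> V}) : f =1 g -> f = g.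
Proof.
move/funext; case: f => f [[f1] [f2]]; case: g => g [[g1] [g2]] /= efg.
rewrite efg in f1 f2 *.
by rewrite (Prop_irrelevance f1 g1) (Prop_irrelevance f2 g2).
Qed.

Definition mklin U V (f : U -> V) (fl : linear f) : {linear U -> V} :=
  HB.pack_for {linear U -> V} f (GRing.isLinear.Build K U V _ f fl).

End LinearMaps.

Section HomModule.
Variables (K : fieldType) (U V : lmodType K).
Local Notation H := {linear U -> V}.

HB.instance Definition _ := gen_eqMixin H.
HB.instance Definition _ := gen_choiceMixin H.

Definition lin0 : H := \0 : U -> V.
Definition linD (f g : H) : H := f \+ g : U -> V.
Definition linN (f : H) : H := \- f : U -> V.
Definition linZ (k : K) (f : H) : H := k \*: f : U -> V.

Fact linDA : associative linD.
Proof. by move=> f g h; apply: lin_ext => x /=; rewrite addrA. Qed.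
Fact linDC : commutative linD.
Proof. by move=> f g; apply: lin_ext => x /=; rewrite addrC. Qed.
Fact lin0D : left_id lin0 linD.
Proof. by move=> f; apply: lin_ext => x /=; rewrite add0r. Qed.
Fact linND : left_inverse lin0 linN linD.
Proof. by move=> f; apply: lin_ext => x /=; rewrite addNr. Qed.
HB.instance Definition _ := GRing.isZmodule.Build H linDA linDC lin0D linND.

Fact linZA a b f : linZ a (linZ b f) = linZ (a * b) f.
Proof. by apply: lin_ext => x /=; rewrite scalerA. Qed.
Fact lin1Z : left_id 1 linZ.
Proof. by move=> f; apply: lin_ext => x /=; rewrite scale1r. Qed.
Fact linZDr : right_distributive linZ +%R.
Proof. by move=> k f g; apply: lin_ext => x /=; rewrite scalerDr. Qed.
Fact linZDl f : {morph linZ^~ f : a b / a + b}.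
Proof. by move=> a b; apply: lin_ext => x /=; rewrite scalerDl. Qed.
HB.instance Definition _ :=
  GRing.Zmodule_isLmodule.Build K H linZA lin1Z linZDr linZDl.
End HomModule.

(* The linear map X -> Y induced by the prescription gen i |-> f i on a spanning
   family gen.  When the prescription is not compatible with the linear
   relations between the gen i, the value is conventionally the zero map; for a
   unital measuring Phi between commutative algebras, every prescription used
   below is compatible. *)
Section Induced.
Variables (K : fieldType) (X Y : lmodType K) (I : Type).

Definition induced (gen : I -> X) (f : I -> Y) : {linear X -> Y} :=
  if pselect (exists g : {linear X -> Y}, forall i, g (gen i) = f i) is left ex
  then projT1 (cid ex) else 0.

Lemma inducedE (gen : I -> X) (f : I -> Y) :
  (exists g : {linear X -> Y}, forall i, g (gen i) = f i) ->
  forall i, induced gen f (gen i) = f i.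
Proof. by rewrite /induced; case: pselect => // ex _; case: cid. Qed.
End Induced.

Section Subspaces.
Variables (K : fieldType) (V : lmodType K).

Record subspace := Subspace {
  in_subspace :> V -> Prop;
  subspace0 : in_subspace 0;
  subspaceP : forall k x y,
    in_subspace x -> in_subspace y -> in_subspace (k *: x + y) }.

Definition spanp (E : V -> Prop) (v : V) : Prop :=
  forall S : subspace, (forall e, E e -> S e) -> S v.

Fact spanp0 E : spanp E 0.
Proof. by move=> S _; apply: subspace0. Qed.
Fact spanpP E k x y : spanp E x -> spanp E y -> spanp E (k *: x + y).
Proof. by move=> Ex Ey S ES; apply: subspaceP; [apply: Ex | apply: Ey]. Qed.
Definition span (E : V -> Prop) : subspace := Subspace (@spanp0 E) (@spanpP E).

Lemma mem_span (E : V -> Prop) v : E v -> span E v.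
Proof. by move=> Ev S; apply. Qed.

Definition subpred (S : subspace) : {pred V} := fun v => `[< S v >].

Fact subpred_closed (S : subspace) : submod_closed (subpred S).
Proof.
split; first by apply/asboolP; apply: subspace0.
by move=> k x y /asboolP Sx /asboolP Sy; apply/asboolP; apply: subspaceP.
Qed.
HB.instance Definition _ (S : subspace) :=
  GRing.isSubmodClosed.Build K V (subpred S) (subpred_closed S).

End Subspaces.

Section SubspaceModule.
Variables (K : fieldType) (V : lmodType K) (S : subspace V).

Record submod := Submod { submod_val :> V; submodP : submod_val \in subpred S }.
HB.instance Definition _ := [isSub for submod_val].
HB.instance Definition _ := [Choice of submod by <:].
HB.instance Definition _ := [SubChoice_isSubLmodule of submod by <:].

Definition quomod := Quotient.quot (subpred S).
HB.instance Definition _ := Choice.on quomod.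
HB.instance Definition _ := GRing.Zmodule.on quomod.

Definition qclass (v : V) : quomod := \pi_quomod v.
Definition qscale (k : K) (q : quomod) : quomod := qclass (k *: repr q).

Lemma qclass_eq x y : qclass x = qclass y <-> S (x - y).
Proof.
split=> [e|Sxy].
  by apply/asboolP; rewrite [`[< _ >]](Quotient.idealrBE (subpred S)); apply/eqP.
by apply/eqP; rewrite -(Quotient.idealrBE (subpred S)); apply/asboolP.
Qed.

Lemma qclass_repr q : qclass (repr q) = q.
Proof. exact: reprK. Qed.

Lemma qclassD x y : qclass (x + y) = qclass x + qclass y.
Proof. by rewrite /qclass !piE. Qed.

Lemma qclassZ k x : qclass (k *: x) = qscale k (qclass x).
Proof.
apply/qclass_eq; rewrite -scalerBr -[k *: _]addr0; apply: subspaceP.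
  by apply/qclass_eq; rewrite qclass_repr.
exact: subspace0.
Qed.

Fact qscaleA a b q : qscale a (qscale b q) = qscale (a * b) q.
Proof. by rewrite -[q]qclass_repr -!qclassZ scalerA. Qed.
Fact qscale1 : left_id 1 qscale.
Proof. by move=> q; rewrite -[q]qclass_repr -!qclassZ scale1r. Qed.
Fact qscaleDr : right_distributive qscale +%R.
Proof.
move=> k q r; rewrite -[q]qclass_repr -[r]qclass_repr.
by rewrite -qclassD -!qclassZ scalerDr qclassD.
Qed.
Fact qscaleDl q : {morph qscale^~ q : a b / a + b}.
Proof.
by move=> a b; rewrite -[q]qclass_repr -!qclassZ scalerDl qclassD.
Qed.
HB.instance Definition _ :=
  GRing.Zmodule_isLmodule.Build K quomod qscaleA qscale1 qscaleDr qscaleDl.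

Fact qclass_linear : linear qclass.
Proof. by move=> k x y; rewrite qclassD qclassZ. Qed.
HB.instance Definition _ :=
  GRing.isLinear.Build K V quomod _ qclass qclass_linear.

Lemma quo_lift (W : lmodType K) (f : {linear V -> W}) :
  (forall v, S v -> f v = 0) ->
  exists g : {linear quomod -> W}, forall v, g (qclass v) = f v.
Proof.
move=> fS0; pose g (q : quomod) := f (repr q).
have gE v : g (qclass v) = f v.
  apply/eqP; rewrite -subr_eq0 -raddfB; apply/eqP/fS0/qclass_eq.
  exact: qclass_repr.
have gl : linear g.
  move=> k x y; rewrite -[x]qclass_repr -[y]qclass_repr -linearP.
  by rewrite !gE linearP.
by exists (mklin gl).
Qed.
End SubspaceModule.

(* Direct sums, as finitely supported families. *)
Section DirectSum.
Variables (K : fieldType) (I : eqType) (V : I -> lmodType K).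

Record dsum := Dsum {
  dsum_fun :> forall i, V i;
  dsum_fin : exists s : seq I, forall i, i \notin s -> dsum_fun i = 0 }.

Lemma dsum_ext (x y : dsum) : (forall i, x i = y i) -> x = y.
Proof.
case: x => x fx; case: y => y fy /= exy.
have {}exy : x = y by apply: functional_extensionality_dep.
by rewrite exy in fx *; rewrite (Prop_irrelevance fx fy).
Qed.

HB.instance Definition _ := gen_eqMixin dsum.
HB.instance Definition _ := gen_choiceMixin dsum.

Fact dsum0_fin : exists s : seq I, forall i, i \notin s -> 0 = 0 :> V i.
Proof. by exists [::]. Qed.
Definition dsum0 := Dsum dsum0_fin.

Fact dsumD_fin (x y : dsum) :
  exists s : seq I, forall i, i \notin s -> x i + y i = 0.
Proof.
case: (dsum_fin x) (dsum_fin y) => s xs [t yt]; exists (s ++ t) => i.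
by rewrite mem_cat negb_or => /andP[/xs-> /yt->]; rewrite addr0.
Qed.
Definition dsumD x y := Dsum (dsumD_fin x y).

Fact dsumZ_fin k (x : dsum) :
  exists s : seq I, forall i, i \notin s -> k *: x i = 0.
Proof.
by case: (dsum_fin x) => s xs; exists s => i /xs->; rewrite scaler0.
Qed.
Definition dsumZ k x := Dsum (dsumZ_fin k x).

Fact dsumA : associative dsumD.
Proof. by move=> x y z; apply: dsum_ext => i /=; rewrite addrA. Qed.
Fact dsumC : commutative dsumD.
Proof. by move=> x y; apply: dsum_ext => i /=; rewrite addrC. Qed.
Fact dsum0D : left_id dsum0 dsumD.
Proof. by move=> x; apply: dsum_ext => i /=; rewrite add0r. Qed.
Fact dsumND : left_inverse dsum0 (dsumZ (-1)) dsumD.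
Proof. by move=> x; apply: dsum_ext => i /=; rewrite scaleN1r addNr. Qed.
HB.instance Definition _ := GRing.isZmodule.Build dsum dsumA dsumC dsum0D dsumND.

Fact dsumZA a b x : dsumZ a (dsumZ b x) = dsumZ (a * b) x.
Proof. by apply: dsum_ext => i /=; rewrite scalerA. Qed.
Fact dsum1Z : left_id 1 dsumZ.
Proof. by move=> x; apply: dsum_ext => i /=; rewrite scale1r. Qed.
Fact dsumZDr : right_distributive dsumZ +%R.
Proof. by move=> k x y; apply: dsum_ext => i /=; rewrite scalerDr. Qed.
Fact dsumZDl x : {morph dsumZ^~ x : a b / a + b}.
Proof. by move=> a b; apply: dsum_ext => i /=; rewrite scalerDl. Qed.
HB.instance Definition _ :=
  GRing.Zmodule_isLmodule.Build K dsum dsumZA dsum1Z dsumZDr dsumZDl.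

Definition dcast i (v : V i) j : V j :=
  if i =P j is ReflectT e then ecast j (V j) e v else 0.

Lemma dcast_id i (v : V i) : dcast v i = v.
Proof. by rewrite /dcast; case: eqP => // e; rewrite eq_axiomK. Qed.
Lemma dcast_neq i (v : V i) j : i != j -> dcast v j = 0.
Proof. by rewrite /dcast; case: eqP. Qed.

Fact dinj_fin i (v : V i) : exists s : seq I, forall j, j \notin s -> dcast v j = 0.
Proof.
by exists [:: i] => j; rewrite inE eq_sym => /dcast_neq->.
Qed.
Definition dinj i (v : V i) : dsum := Dsum (dinj_fin v).

Fact dinj_linear i : linear (@dinj i).
Proof.
move=> k x y; apply: dsum_ext => j /=.
have [<-|ne] := eqVneq i j; first by rewrite !dcast_id.
by rewrite !dcast_neq // scaler0 addr0.
Qed.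
HB.instance Definition _ i :=
  GRing.isLinear.Build K (V i) dsum _ (@dinj i) (@dinj_linear i).

Definition dproj i (x : dsum) : V i := x i.
Fact dproj_linear i : linear (@dproj i).
Proof. by []. Qed.
HB.instance Definition _ i :=
  GRing.isLinear.Build K dsum (V i) _ (@dproj i) (@dproj_linear i).

Lemma dsum_sumE (s : seq I) (F : I -> dsum) j :
  (\sum_(i <- s) F i) j = \sum_(i <- s) F i j.
Proof. exact: (raddf_sum (@dproj j)). Qed.

Lemma dsum_decomp (x : dsum) s :
  uniq s -> (forall i, i \notin s -> x i = 0) -> x = \sum_(i <- s) dinj (x i).
Proof.
move=> us xs; apply: dsum_ext => j; rewrite dsum_sumE.
have [js|js] := boolP (j \in s); last first.
  rewrite xs // big_seq big1 // => i si /=; rewrite dcast_neq //.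
  by apply: contraNneq js => <-.
rewrite (bigD1_seq j) //= dcast_id big1 ?addr0 // => i ne.
by rewrite dcast_neq.
Qed.

Lemma dsum_lift (W : lmodType K) (f : forall i, {linear V i -> W}) :
  exists g : {linear dsum -> W}, forall i v, g (dinj v) = f i v.
Proof.
pose sup (x : dsum) := undup (projT1 (cid (dsum_fin x))).
have supP x i : i \notin sup x -> x i = 0.
  by rewrite mem_undup; case: cid => /= s h; apply: h.
pose g (x : dsum) := \sum_(i <- sup x) f i (x i).
have gE (x : dsum) s : uniq s -> (forall i, i \notin s -> x i = 0) ->
  g x = \sum_(i <- s) f i (x i).
  move=> us xs; rewrite /g.
  rewrite [LHS](bigID (mem s)) /= [X in _ + X]big1 ?addr0; last first.
    by move=> i /xs->; rewrite linear0.
  rewrite [RHS](bigID (mem (sup x))) /= [X in _ = _ + X]big1 ?addr0; last first.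
    by move=> i /supP->; rewrite linear0.
  rewrite -[LHS]big_filter -[RHS]big_filter; apply: perm_big; apply: uniq_perm.
  - exact/filter_uniq/undup_uniq.
  - exact: filter_uniq.
  by move=> i; rewrite !mem_filter andbC.
have gl : linear g.
  move=> k x y; pose s := undup (sup x ++ sup y).
  have sx i : i \notin s -> x i = 0.
    by rewrite mem_undup mem_cat negb_or => /andP[/supP].
  have sy i : i \notin s -> y i = 0.
    by rewrite mem_undup mem_cat negb_or => /andP[_ /supP].
  rewrite !(gE _ s) ?undup_uniq // => [|i si]; last first.
    by rewrite /= sx ?sy ?scaler0 ?addr0.
  rewrite scaler_sumr -big_split; apply: eq_bigr => i _ /=.
  by rewrite linearP.
exists (mklin gl) => i v /=.
rewrite (gE _ [:: i]) ?big_seq1 /= ?dcast_id // => j.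
by rewrite inE eq_sym => /dcast_neq->.
Qed.

Lemma dsum_ind (P : dsum -> Prop) :
  P 0 -> (forall x y, P x -> P y -> P (x + y)) -> (forall i v, P (@dinj i v)) ->
  forall x, P x.
Proof.
move=> P0 PD Pi x; have [s xs] := dsum_fin x.
rewrite (@dsum_decomp x (undup s)) ?undup_uniq // => [|i]; last first.
  by rewrite mem_undup; apply: xs.
by elim: (undup s) => [|i u IH]; rewrite ?big_nil ?big_cons //; apply: PD.
Qed.
End DirectSum.

Section Tensor.
Variables (K : fieldType) (U V : lmodType K).

Definition freemod : lmodType K :=
  dsum (fun _ : (U * V)%type => (K^o : lmodType K)).
Definition fgen (u : U) (v : V) : freemod :=
  @dinj K _ (fun _ : (U * V)%type => (K^o : lmodType K)) (u, v) 1.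

Definition tens_rel (z : freemod) : Prop :=
  (exists k u u' v, z = fgen (k *: u + u') v - (k *: fgen u v + fgen u' v)) \/
  (exists k u v v', z = fgen u (k *: v + v') - (k *: fgen u v + fgen u v')).

Definition tens : lmodType K := quomod (span tens_rel).

Definition tpure (u : U) (v : V) : tens := qclass (span tens_rel) (fgen u v).

Lemma tpurePl k u u' v :
  tpure (k *: u + u') v = k *: tpure u v + tpure u' v.
Proof.
rewrite /tpure -linearP; apply/qclass_eq/mem_span.
by left; exists k, u, u', v.
Qed.
Lemma tpurePr k u v v' :
  tpure u (k *: v + v') = k *: tpure u v + tpure u v'.
Proof.
rewrite /tpure -linearP; apply/qclass_eq/mem_span.
by right; exists k, u, v, v'.
Qed.

Definition tpl v : {linear U -> tens} :=
  mklin (fun k u u' => tpurePl k u u' v).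
Definition tpr u : {linear V -> tens} :=
  mklin (fun k v v' => tpurePr k u v v').

Lemma tpureZl k u v : tpure (k *: u) v = k *: tpure u v.
Proof. exact: (linearZ_LR (tpl v)). Qed.

Lemma tens_ind (P : tens -> Prop) :
  P 0 -> (forall x y, P x -> P y -> P (x + y)) -> (forall u v, P (tpure u v)) ->
  forall t, P t.
Proof.
move=> P0 PD Pp t; rewrite -[t]qclass_repr; move: (repr t) => z.
elim/dsum_ind: z => [|x y Px Py|[u v] k].
- by rewrite linear0.
- by rewrite linearD; apply: PD.
suff -> : @dinj K _ (fun _ : (U * V)%type => (K^o : lmodType K)) (u, v) k
          = k *: fgen u v.
  suff -> : qclass (span tens_rel) (k *: fgen u v) = tpure (k *: u) v by [].
  by rewrite tpureZl /tpure linearZ.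
by rewrite -linearZ /= [k%R *: _]mulr1.
Qed.

Lemma tens_linP (W : lmodType K) (f g : {linear tens -> W}) :
  (forall u v, f (tpure u v) = g (tpure u v)) -> f =1 g.
Proof.
move=> fg; elim/tens_ind => [|x y fx fy|//]; first by rewrite !linear0.
by rewrite !linearD fx fy.
Qed.

Variable W : lmodType K.

Definition bilin (f : U -> V -> W) : Prop :=
  (forall v, linear (f^~ v)) /\ (forall u, linear (f u)).

Definition tlift (f : U -> V -> W) : {linear tens -> W} :=
  induced (fun p => tpure p.1 p.2) (fun p => f p.1 p.2).

Lemma tliftE (f : U -> V -> W) :
  bilin f -> forall u v, tlift f (tpure u v) = f u v.
Proof.
case=> fl fr u v.
apply: (@inducedE _ _ _ _ (fun p : U * V => tpure p.1 p.2)
          (fun p => f p.1 p.2) _ (u, v)).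
pose F (p : U * V) : {linear K^o -> W} :=
  mklin (fun k (a b : K^o) => etrans (scalerDl (f p.1 p.2) (k * a) b)
    (congr1 (+%R^~ _) (esym (scalerA k a (f p.1 p.2))))).
have [g gE] := dsum_lift F.
have gfgen u' v' : g (fgen u' v') = f u' v'.
  by rewrite /fgen gE /= scale1r.
have [|h hE] := @quo_lift K freemod (span tens_rel) W g.
  pose S0 z := g z = 0.
  have S00 : S0 0 by rewrite /S0 linear0.
  have S0P k x y : S0 x -> S0 y -> S0 (k *: x + y).
    by rewrite /S0 linearP => -> ->; rewrite scaler0 addr0.
  move=> z /(_ (Subspace S00 S0P)); apply=> e /= [].
  - move=> [k] [u1] [u2] [v1] ->; rewrite /S0 linearB linearP !gfgen.
    by rewrite (fl v1) subrr.
  - move=> [k] [u1] [v1] [v2] ->; rewrite /S0 linearB linearP !gfgen.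
    by rewrite (fr u1) subrr.
by exists h => -[u' v'] /=; rewrite /tpure hE gfgen.
Qed.

End Tensor.

Notation "U ⊗ V" := (tens U V) (at level 40, left associativity).
Notation "u *t v" := (tpure u v) (at level 40, left associativity).

Section TensorMaps.
Variable K : fieldType.
Implicit Types U V W X : lmodType K.

Definition tmap U U' V V' (f : {linear U -> U'}) (g : {linear V -> V'}) :
  {linear U ⊗ V -> U' ⊗ V'} := tlift (fun u v => f u *t g v).

Definition tswap U V : {linear U ⊗ V -> V ⊗ U} := tlift (fun u v => v *t u).

Definition tassoc U V W : {linear U ⊗ V ⊗ W -> U ⊗ (V ⊗ W)} :=
  tlift (fun t w => tlift (fun u v => u *t (v *t w)) t).

Definition tlunit V : {linear K^o ⊗ V -> V} := tlift (fun (k : K^o) v => k *: v).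
Definition trunit V : {linear V ⊗ K^o -> V} := tlift (fun v (k : K^o) => k *: v).

Definition tmiddle U V W X :
  {linear (U ⊗ V) ⊗ (W ⊗ X) -> (U ⊗ W) ⊗ (V ⊗ X)} :=
  tlift (fun s t =>
    tlift (fun u v => tlift (fun w x => (u *t w) *t (v *t x)) t) s).

Section Curry.
Variables (U V W : lmodType K) (f : {linear U ⊗ V -> W}).
Fact tcurry_linear2 u : linear (fun v => f (u *t v)).
Proof. by move=> k v v'; rewrite tpurePr linearP. Qed.
Fact tcurry_linear1 : linear (fun u => mklin (tcurry_linear2 u)).
Proof. by move=> k u u'; apply: lin_ext => v /=; rewrite tpurePl linearP. Qed.
Definition tcurry : {linear U -> {linear V -> W}} := mklin tcurry_linear1.
End Curry.

Lemma tmapE U U' V V' (f : {linear U -> U'}) (g : {linear V -> V'}) u v :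
  tmap f g (u *t v) = f u *t g v.
Proof.
rewrite tliftE //; split=> [v'|u'] k x y /=.
  by rewrite linearP tpurePl.
by rewrite linearP tpurePr.
Qed.

Lemma tswapE U V (u : U) (v : V) : tswap U V (u *t v) = v *t u.
Proof.
rewrite tliftE //; split=> [v'|u'] k x y /=; first by rewrite tpurePr.
by rewrite tpurePl.
Qed.

Lemma tassocE U V W (u : U) (v : V) (w : W) :
  tassoc U V W (u *t v *t w) = u *t (v *t w).
Proof.
have bi w' : bilin (fun (u : U) (v : V) => u *t (v *t (w' : W))).
  by split=> [v'|u'] k x y /=; rewrite ?tpurePl ?tpurePr.
rewrite tliftE ?tliftE //; split=> [w'|t] k x y /=; first by rewrite linearP.
elim/tens_ind: t => [|s t es et|u' v'].
- by rewrite !linear0 addr0.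
- by rewrite !linearD es et addrACA.
by rewrite !tliftE // !tpurePr.
Qed.

Lemma tlunitE V (k : K^o) (v : V) : tlunit V (k *t v) = k *: v.
Proof.
rewrite tliftE //; split=> [v'|k'] a x y /=.
  by rewrite scalerDl scalerA.
by rewrite scalerDr !scalerA mulrC.
Qed.

Lemma trunitE V (k : K^o) (v : V) : trunit V (v *t k) = k *: v.
Proof.
rewrite tliftE //; split=> [k'|v'] a x y /=.
  by rewrite scalerDr !scalerA mulrC.
by rewrite scalerDl scalerA.
Qed.

Lemma tmiddleE U V W X (u : U) (v : V) (w : W) (x : X) :
  tmiddle U V W X ((u *t v) *t (w *t x)) = (u *t w) *t (v *t x).
Proof.
have bi1 u' v' : bilin (fun (w : W) (x : X) => ((u' : U) *t w) *t ((v' : V) *t x)).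
  by split=> [?|?] k ? ? /=; rewrite !(tpurePl, tpurePr).
have bi2 (t : W ⊗ X) :
  bilin (fun (u : U) (v : V) => tlift (fun w x => (u *t w) *t (v *t x)) t).
  split=> [?|?] k ? ? /=; elim/tens_ind: t => [|s t es et|? ?].
  - by rewrite !linear0 addr0.
  - by rewrite !linearD es et addrACA.
  - by rewrite !tliftE // !(tpurePl, tpurePr).
  - by rewrite !linear0 addr0.
  - by rewrite !linearD es et addrACA.
  - by rewrite !tliftE // !(tpurePl, tpurePr).
rewrite tliftE; last first.
  split=> [t|s] k y z /=; first by rewrite linearP.
  elim/tens_ind: s => [|s t es et|? ?].
  - by rewrite !linear0 addr0.
  - by rewrite !linearD es et addrACA.
  by rewrite !tliftE //= linearP.
by rewrite !tliftE.
Qed.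

End TensorMaps.

Section TensorBilinear.
Variables (K : fieldType) (U V : lmodType K).
Implicit Types (u : U) (v : V).

Lemma tpureDl u u' v : (u + u') *t v = u *t v + u' *t v.
Proof. exact: (raddfD (tpl U v)). Qed.
Lemma tpureDr u v v' : u *t (v + v') = u *t v + u *t v'.
Proof. exact: (raddfD (tpr V u)). Qed.
Lemma tpure0l v : (0 : U) *t v = 0.
Proof. exact: (raddf0 (tpl U v)). Qed.
Lemma tpure0r u : u *t (0 : V) = 0.
Proof. exact: (raddf0 (tpr V u)). Qed.
Lemma tpureZr k u v : u *t (k *: v) = k *: (u *t v).
Proof. exact: (linearZ_LR (tpr V u)). Qed.
End TensorBilinear.

Ltac tens_induction t u v :=
  let ex := fresh "ex" in let ey := fresh "ey" in
  elim/tens_ind: t => [|? ? ex ey|u v];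
    [by rewrite !(tpure0l, tpure0r, linear0)
    |first [by rewrite !(tpureDl, tpureDr, linearD) ex ey
           |by move: ex ey => /= ex ey;
              rewrite !(tpureDl, tpureDr, linearD) /= ex ey]|].

Section Coalgebras.
Variable K : fieldType.

(* Cocommutative coalgebras. *)
Record coalg := Coalg {
  coalg_sort :> lmodType K;
  comul : {linear coalg_sort -> coalg_sort ⊗ coalg_sort};
  counit : {linear coalg_sort -> K^o};
  comulA : forall x, tassoc _ _ _ (tmap comul idfun (comul x))
                     = tmap idfun comul (comul x);
  comul1l : forall x, tlunit _ (tmap counit idfun (comul x)) = x;
  comul1r : forall x, trunit _ (tmap idfun counit (comul x)) = x;
  comulC : forall x, tswap _ _ (comul x) = comul x }.

Record coalgmor (C D : coalg) := Coalgmor {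
  coalgmor_fun :> {linear C -> D};
  coalgmor_comul : forall x,
    comul D (coalgmor_fun x) = tmap coalgmor_fun coalgmor_fun (comul C x);
  coalgmor_counit : forall x, counit D (coalgmor_fun x) = counit C x }.

Definition kcomul : {linear K^o -> K^o ⊗ K^o} := tpl K^o (1 : K^o).

Fact kcomulA x : tassoc _ _ _ (tmap kcomul idfun (kcomul x))
                 = tmap idfun kcomul (kcomul x).
Proof. by rewrite /kcomul /= !tmapE /= tassocE. Qed.
Fact kcomul1l x : tlunit _ (tmap idfun idfun (kcomul x)) = x.
Proof. by rewrite /kcomul /= tmapE tlunitE /= [_ *: _]mulr1. Qed.
Fact kcomul1r x : trunit _ (tmap idfun idfun (kcomul x)) = x.
Proof. by rewrite /kcomul /= tmapE trunitE /= scale1r. Qed.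
Fact kcomulC x : tswap _ _ (kcomul x) = kcomul x.
Proof.
rewrite /kcomul /= tswapE -[in LHS](mulr1 x) -[in RHS](mulr1 x).
by rewrite [in LHS]tpureZr [in RHS]tpureZl.
Qed.
Definition coalgK : coalg := Coalg kcomulA kcomul1l kcomul1r kcomulC.

Section TensorCoalgebra.
Variables C D : coalg.

Definition tens_comul : {linear C ⊗ D -> (C ⊗ D) ⊗ (C ⊗ D)} :=
  tmiddle C C D D \o tmap (comul C) (comul D).
Definition tens_counit : {linear C ⊗ D -> K^o} :=
  tlunit K^o \o tmap (counit C) (counit D).

Lemma tens_comulE c d :
  tens_comul (c *t d) = tmiddle _ _ _ _ (comul C c *t comul D d).
Proof. by rewrite /tens_comul /= tmapE. Qed.
Lemma tens_counitE c d : tens_counit (c *t d) = counit C c * counit D d.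
Proof. by rewrite /tens_counit /= tmapE tlunitE. Qed.

Fact tens_comulA x : tassoc _ _ _ (tmap tens_comul idfun (tens_comul x))
                     = tmap idfun tens_comul (tens_comul x).
Proof.
pose M t := tmap idfun (tmiddle C C D D) (tmiddle C (C ⊗ C) D (D ⊗ D) t).
have e0 a b s t : tassoc _ _ _ (tmiddle _ _ _ _ (s *t t) *t (a *t b))
    = M (tassoc _ _ _ (s *t a) *t tassoc _ _ _ (t *t b)).
  rewrite /M; tens_induction s x1 x2; tens_induction t y1 y2.
  by rewrite !(tmiddleE, tassocE, tmapE).
have e1 s t : tassoc _ _ _ (tmap tens_comul idfun (tmiddle _ _ _ _ (s *t t)))
    = M (tassoc _ _ _ (tmap (comul C) idfun s)
          *t tassoc _ _ _ (tmap (comul D) idfun t)).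
  rewrite /M; tens_induction s x1 x2; tens_induction t y1 y2.
  by rewrite tmiddleE !tmapE tens_comulE /= e0.
have e2 s t : tmap idfun tens_comul (tmiddle _ _ _ _ (s *t t))
    = M (tmap idfun (comul C) s *t tmap idfun (comul D) t).
  rewrite /M; tens_induction s x1 x2; tens_induction t y1 y2.
  by rewrite !(tmiddleE, tmapE) tens_comulE.
tens_induction x c d.
by rewrite tens_comulE e1 e2 !comulA.
Qed.

Fact tens_comul1l x : tlunit _ (tmap tens_counit idfun (tens_comul x)) = x.
Proof.
have e s t : tlunit _ (tmap tens_counit idfun (tmiddle _ _ _ _ (s *t t)))
   = tlunit _ (tmap (counit C) idfun s) *t tlunit _ (tmap (counit D) idfun t).
  tens_induction s x1 x2; tens_induction t y1 y2.
  rewrite !(tmiddleE, tmapE, tlunitE) tens_counitE /=.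
  by rewrite tpureZl tpureZr scalerA.
by tens_induction x c d; rewrite tens_comulE e !comul1l.
Qed.

Fact tens_comul1r x : trunit _ (tmap idfun tens_counit (tens_comul x)) = x.
Proof.
have e s t : trunit _ (tmap idfun tens_counit (tmiddle _ _ _ _ (s *t t)))
   = trunit _ (tmap idfun (counit C) s) *t trunit _ (tmap idfun (counit D) t).
  tens_induction s x1 x2; tens_induction t y1 y2.
  rewrite !(tmiddleE, tmapE, trunitE) tens_counitE /=.
  by rewrite tpureZl tpureZr scalerA.
by tens_induction x c d; rewrite tens_comulE e !comul1r.
Qed.

Fact tens_comulC x : tswap _ _ (tens_comul x) = tens_comul x.
Proof.
have e s t : tswap _ _ (tmiddle _ _ _ _ (s *t t))
   = tmiddle _ _ _ _ (tswap C C s *t tswap D D t).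
  tens_induction s x1 x2; tens_induction t y1 y2.
  by rewrite !(tmiddleE, tswapE).
by tens_induction x c d; rewrite tens_comulE e !comulC.
Qed.

Definition coalg_tens : coalg :=
  Coalg tens_comulA tens_comul1l tens_comul1r tens_comulC.
End TensorCoalgebra.

End Coalgebras.

Section CoalgebraMorphisms.
Variable K : fieldType.
Implicit Types C D E : coalg K.

Lemma tmap_comp (U U' U'' V V' V'' : lmodType K)
  (f : {linear U -> U'}) (f' : {linear U' -> U''})
  (g : {linear V -> V'}) (g' : {linear V' -> V''}) t :
  tmap f' g' (tmap f g t) = tmap (f' \o f) (g' \o g) t.
Proof. by tens_induction t u v; rewrite !tmapE. Qed.

Lemma tmap_id (U V : lmodType K) (t : U ⊗ V) : tmap idfun idfun t = t.
Proof. by tens_induction t u v; rewrite tmapE. Qed.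

Definition coalgmor_id C : coalgmor C C.
Proof. by exists idfun => x //=; rewrite tmap_id. Defined.

Definition coalgmor_comp C D E (g : coalgmor D E) (f : coalgmor C D) :
  coalgmor C E.
Proof.
exists (g \o f) => x /=; last by rewrite !coalgmor_counit.
by rewrite !coalgmor_comul tmap_comp.
Defined.

Lemma tmap_tmiddle (U V W X U' V' W' X' : lmodType K)
  (f : {linear U -> U'}) (g : {linear V -> V'})
  (h : {linear W -> W'}) (i : {linear X -> X'}) s t :
  tmiddle _ _ _ _ (tmap f g s *t tmap h i t) =
  tmap (tmap f h) (tmap g i) (tmiddle _ _ _ _ (s *t t)).
Proof.
tens_induction s u v; tens_induction t w x.
by rewrite !(tmapE, tmiddleE).
Qed.

Definition coalgmor_tens C C' D D' (f : coalgmor C C') (g : coalgmor D D') :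
  coalgmor (coalg_tens C D) (coalg_tens C' D').
Proof.
exists (tmap f g) => x.
  tens_induction x c d.
  by rewrite tmapE !tens_comulE !coalgmor_comul tmap_tmiddle.
tens_induction x c d.
by rewrite tmapE !tens_counitE !coalgmor_counit.
Defined.

Definition coalgmor_assoc C D E :
  coalgmor (coalg_tens (coalg_tens C D) E) (coalg_tens C (coalg_tens D E)).
Proof.
exists (tassoc C D E) => x; last first.
  tens_induction x t e; tens_induction t c d.
  by rewrite tassocE !tens_counitE mulrA.
have h s t r : tmiddle _ _ _ _ (s *t tmiddle _ _ _ _ (t *t r))
  = tmap (tassoc C D E) (tassoc C D E)
      (tmiddle _ _ _ _ (tmiddle _ _ _ _ (s *t t) *t r)).
  tens_induction s x1 x2; tens_induction t y1 y2; tens_induction r z1 z2.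
  by rewrite !(tmiddleE, tmapE, tassocE).
tens_induction x t e; tens_induction t c d.
by rewrite tassocE !tens_comulE h.
Defined.

Definition coalgmor_lunit C : coalgmor (coalg_tens (coalgK K) C) C.
Proof.
exists (tlunit C) => x; last first.
  by tens_induction x k c; rewrite tlunitE tens_counitE linearZ.
have h (k : K^o) (s : C ⊗ C) : k *: s = tmap (tlunit C) (tlunit C)
    (tmiddle _ _ _ _ ((k *t (1 : K^o)) *t s)).
  tens_induction s c d.
  by rewrite tmiddleE tmapE !tlunitE scale1r tpureZl.
by tens_induction x k c; rewrite tlunitE tens_comulE -h linearZ.
Defined.

Definition coalgmor_runit C : coalgmor (coalg_tens C (coalgK K)) C.
Proof.
exists (trunit C) => x; last first.
  by tens_induction x c k; rewrite trunitE tens_counitE linearZ mulrC.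
have h (k : K^o) (s : C ⊗ C) : k *: s = tmap (trunit C) (trunit C)
    (tmiddle _ _ _ _ (s *t (k *t (1 : K^o)))).
  tens_induction s c d.
  by rewrite tmiddleE tmapE !trunitE scale1r tpureZl.
by tens_induction x c k; rewrite trunitE tens_comulE -h linearZ.
Defined.

End CoalgebraMorphisms.

Section EnrichedCategories.
Variable K : fieldType.

(* Categories and functors enriched over cocommutative coalgebras. *)
Record ecat := Ecat {
  eobj :> Type;
  ehom : eobj -> eobj -> coalg K;
  ecomp : forall X Y Z, coalgmor (coalg_tens (ehom X Y) (ehom Y Z)) (ehom X Z);
  eunit : forall X, coalgmor (coalgK K) (ehom X X);
  ecompA : forall X Y Z W (t : ehom X Y ⊗ ehom Y Z ⊗ ehom Z W),
    ecomp X Z W (tmap (ecomp X Y Z) idfun t)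
    = ecomp X Y W (tmap idfun (ecomp Y Z W) (tassoc _ _ _ t));
  ecomp1l : forall X Y (t : K^o ⊗ ehom X Y),
    ecomp X X Y (tmap (eunit X) idfun t) = tlunit _ t;
  ecomp1r : forall X Y (t : ehom X Y ⊗ K^o),
    ecomp X Y Y (tmap idfun (eunit Y) t) = trunit _ t }.

Record efunctor (C D : ecat) (F : C -> D) := Efunctor {
  efun_hom : forall X Y, coalgmor (ehom X Y) (ehom (F X) (F Y));
  efun_comp : forall X Y Z (t : ehom X Y ⊗ ehom Y Z),
    efun_hom X Z (ecomp X Y Z t)
    = ecomp (F X) (F Y) (F Z) (tmap (efun_hom X Y) (efun_hom Y Z) t);
  efun_unit : forall X k, efun_hom X X (eunit X k) = eunit (F X) k }.

End EnrichedCategories.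

Section UniversalMeasurings.
Variable K : fieldType.
Implicit Types U V W : lmodType K.

Definition meas_precomp U V (C D : coalg K)
  (Phi : {linear D -> {linear U -> V}}) (zeta : coalgmor C D) :
  {linear C -> {linear U -> V}} := Phi \o zeta.

Definition meas_comp U V W (C D : coalg K)
  (Phi : {linear C -> {linear U -> V}}) (Phi' : {linear D -> {linear V -> W}}) :
  {linear C ⊗ D -> {linear U -> W}} :=
  tlift (fun x y => (Phi' y \o Phi x : {linear U -> W})).

Fact meas_unit_linear U : linear (fun k : K^o => k *: (idfun : {linear U -> U})).
Proof. by move=> a x y; rewrite scalerDl scalerA. Qed.
Definition meas_unit U : {linear coalgK K -> {linear U -> U}} :=
  mklin (@meas_unit_linear U).

Lemma meas_compE U V W (C D : coalg K) (Phi : {linear C -> {linear U -> V}})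
  (Phi' : {linear D -> {linear V -> W}}) x y u :
  meas_comp Phi Phi' (x *t y) u = Phi' y (Phi x u).
Proof.
rewrite /meas_comp tliftE //; split=> [z|z] k a b; apply: lin_ext => v /=.
  by rewrite [in LHS]linearP /= linearP.
by rewrite [in LHS]linearP /=.
Qed.

Definition meas_class U V := forall C : coalg K, {linear C -> {linear U -> V}} -> Prop.

(* Universal objects among the measurings C -> Hom(U, V) of class P. *)
Record universal U V (P : meas_class U V) := Universal {
  univ_coalg : coalg K;
  univ_map : {linear univ_coalg -> {linear U -> V}};
  univ_mapP : P univ_coalg univ_map;
  univP : forall (C : coalg K) (Phi : {linear C -> {linear U -> V}}), P C Phi ->
    exists zeta : coalgmor C univ_coalg,
      (forall x, univ_map (zeta x) = Phi x) /\
      (forall zeta' : coalgmor C univ_coalg,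
         (forall x, univ_map (zeta' x) = Phi x) -> zeta' =1 zeta) }.

Definition univ_lift U V (P : meas_class U V) (M : universal P)
  (C : coalg K) (Phi : {linear C -> {linear U -> V}}) (hPhi : P C Phi) :
  coalgmor C (univ_coalg M) := projT1 (cid (univP M hPhi)).

Lemma univ_liftE U V (P : meas_class U V) (M : universal P)
  (C : coalg K) (Phi : {linear C -> {linear U -> V}}) (hPhi : P C Phi) x :
  univ_map M (univ_lift M hPhi x) = Phi x.
Proof. by rewrite /univ_lift; case: cid => z [/= ]. Qed.

Section EnrichedCategory.
Variables (O : Type) (R : O -> lmodType K).
Variable P : forall X Y : O, meas_class (R X) (R Y).
Hypothesis P_unit : forall X, P (meas_unit (R X)).
Hypothesis P_comp : forall X Y Z (C D : coalg K)
  (Phi : {linear C -> {linear R X -> R Y}})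
  (Phi' : {linear D -> {linear R Y -> R Z}}),
  P Phi -> P Phi' -> P (C := coalg_tens C D) (meas_comp Phi Phi').
Hypothesis P_precomp : forall X Y (C D : coalg K)
  (Phi : {linear D -> {linear R X -> R Y}}) (zeta : coalgmor C D),
  P Phi -> P (meas_precomp Phi zeta).
Variable M : forall X Y, universal (@P X Y).

Definition meas_hom X Y : coalg K := univ_coalg (M X Y).
Definition meas_ecomp X Y Z :
  coalgmor (coalg_tens (meas_hom X Y) (meas_hom Y Z)) (meas_hom X Z) :=
  univ_lift (M X Z) (P_comp (univ_mapP (M X Y)) (univ_mapP (M Y Z))).
Definition meas_eunit X : coalgmor (coalgK K) (meas_hom X X) :=
  univ_lift (M X X) (P_unit X).

Lemma univ_ext X Y C (f g : coalgmor C (meas_hom X Y)) :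
  (forall x u, univ_map (M X Y) (f x) u = univ_map (M X Y) (g x) u) -> f =1 g.
Proof.
move=> fg x.
have [z [_ zu]] := univP (M X Y) (P_precomp f (univ_mapP (M X Y))).
by rewrite !zu // => y; apply: lin_ext => u /=; rewrite fg.
Qed.

Lemma meas_ecompE X Y Z x y u :
  univ_map (M X Z) (meas_ecomp X Y Z (x *t y)) u
  = univ_map (M Y Z) y (univ_map (M X Y) x u).
Proof. by rewrite univ_liftE meas_compE. Qed.

Lemma meas_eunitE X k u : univ_map (M X X) (meas_eunit X k) u = k *: u.
Proof. by rewrite univ_liftE. Qed.

Fact meas_ecompA X Y Z (W : O) (t : meas_hom X Y ⊗ meas_hom Y Z ⊗ meas_hom Z W) :
  meas_ecomp X Z W (tmap (meas_ecomp X Y Z) idfun t)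
  = meas_ecomp X Y W (tmap idfun (meas_ecomp Y Z W) (tassoc _ _ _ t)).
Proof.
pose f := coalgmor_comp (meas_ecomp X Z W)
  (coalgmor_tens (meas_ecomp X Y Z) (coalgmor_id _)).
pose g := coalgmor_comp (meas_ecomp X Y W) (coalgmor_comp
  (coalgmor_tens (coalgmor_id _) (meas_ecomp Y Z W)) (coalgmor_assoc _ _ _)).
suff: f =1 g by apply.
apply: univ_ext => {}t u; rewrite /f /g /=.
tens_induction t s z; tens_induction s x y.
by rewrite tassocE !tmapE !meas_ecompE.
Qed.

Fact meas_ecomp1l X Y (t : K^o ⊗ meas_hom X Y) :
  meas_ecomp X X Y (tmap (meas_eunit X) idfun t) = tlunit _ t.
Proof.
pose f := coalgmor_comp (meas_ecomp X X Y)
  (coalgmor_tens (meas_eunit X) (coalgmor_id _)).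
suff: f =1 coalgmor_lunit _ by apply.
apply: univ_ext => {}t u; rewrite /f /=.
tens_induction t k x.
by rewrite tmapE tlunitE meas_ecompE meas_eunitE !linearZ.
Qed.

Fact meas_ecomp1r X Y (t : meas_hom X Y ⊗ K^o) :
  meas_ecomp X Y Y (tmap idfun (meas_eunit Y) t) = trunit _ t.
Proof.
pose f := coalgmor_comp (meas_ecomp X Y Y)
  (coalgmor_tens (coalgmor_id _) (meas_eunit Y)).
suff: f =1 coalgmor_runit _ by apply.
apply: univ_ext => {}t u; rewrite /f /=.
tens_induction t x k.
by rewrite tmapE trunitE meas_ecompE meas_eunitE !linearZ.
Qed.

Definition meas_ecat : ecat K := Ecat meas_ecompA meas_ecomp1l meas_ecomp1r.
End EnrichedCategory.
End UniversalMeasurings.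

Section Algebras.
Variable K : fieldType.

(* Possibly non-unital algebras.  Associativity plays no role in the notion of
   measuring and is not part of the structure: with the Koszul signs of the
   formula for star_chain, the product of HCprime below satisfies
   (x y) z = (-1)^(p+1) x (y z) for x in HC_p. *)
Record nualg := Nualg {
  nu_sort :> lmodType K;
  nu_mul : nu_sort -> nu_sort -> nu_sort;
  nu_mulP : bilin nu_mul }.

(* Commutative unital algebras; unlike in comAlgType, 1 = 0 is allowed. *)
Record calg := Calg {
  calg_nualg :> nualg;
  calg1 : calg_nualg;
  calg_mulA : associative (@nu_mul calg_nualg);
  calg_mulC : commutative (@nu_mul calg_nualg);
  calg_mul1 : left_id calg1 (@nu_mul calg_nualg) }.

Fact comalg_bilin (A : comAlgType K) : bilin ( *%R : A -> A -> A).
Proof.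
by split=> [z|z] k x y /=; [rewrite mulrDl scalerAl | rewrite mulrDr scalerAr].
Qed.
Definition calg_of_comAlg (A : comAlgType K) : calg :=
  @Calg (Nualg (@comalg_bilin A)) 1 (@mulrA A) (@mulrC A) (@mul1r A).

Definition measuring (R R' : nualg) : meas_class R R' := fun C Phi =>
  forall x a b, Phi x (nu_mul a b)
    = tlift (fun y z => nu_mul (Phi y a) (Phi z b)) (comul C x).

Definition umeasuring (A A' : calg) : meas_class A A' :=
  fun C Phi => measuring (R := A) (R' := A') Phi /\
    forall x, Phi x (calg1 A) = counit C x *: calg1 A'.

Section MeasuringBilin.
Variables (R R' : nualg) (C : coalg K) (Phi : {linear C -> {linear R -> R'}}).
Lemma measuring_bilin a b : bilin (fun y z => nu_mul (Phi y a) (Phi z b)).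
Proof.
have [ml mr] := nu_mulP R'.
by split=> [z|y] k u v; rewrite linearP /= ?ml ?mr.
Qed.
End MeasuringBilin.

Lemma measuring_unit (R : nualg) : measuring (R := R) (R' := R) (meas_unit R).
Proof.
move=> k a b; rewrite /= tliftE; last first.
  exact: (@measuring_bilin R R (coalgK K) (meas_unit R) a b).
have := (nu_mulP R).1; move=> /(_ (1 *: b) k a 0); rewrite /= !scale1r !addr0.
move=> ->; suff -> : nu_mul 0 b = 0 by rewrite addr0.
have := (nu_mulP R).1 b (-1) 0 0.
by rewrite !scaleN1r oppr0 addr0 addNr.
Qed.

Lemma measuring_precomp (R R' : nualg) (C D : coalg K)
  (Phi : {linear D -> {linear R -> R'}}) (zeta : coalgmor C D) :
  measuring Phi -> measuring (meas_precomp Phi zeta).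
Proof.
move=> mPhi x a b; rewrite /= mPhi coalgmor_comul.
move: (comul C x) => t; tens_induction t y z.
rewrite tmapE !tliftE //; try exact: measuring_bilin.
exact: (@measuring_bilin R R' C (meas_precomp Phi zeta)).
Qed.

Lemma measuring_comp (R R' R'' : nualg) (C D : coalg K)
  (Phi : {linear C -> {linear R -> R'}})
  (Phi' : {linear D -> {linear R' -> R''}}) :
  measuring Phi -> measuring Phi' ->
  measuring (R := R) (R' := R'') (C := coalg_tens C D) (meas_comp Phi Phi').
Proof.
move=> mPhi mPhi' t a b.
set F := tlift _.
have e1 x1 x2 r : tlift (fun y1 y2 => nu_mul (Phi' y1 (Phi x1 a))
    (Phi' y2 (Phi x2 b))) r = F (tmiddle _ _ _ _ ((x1 *t x2) *t r)).
  rewrite /F; tens_induction r y1 y2.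
  rewrite tmiddleE [LHS]tliftE; last first.
    exact: (@measuring_bilin R' R'' D Phi' (Phi x1 a) (Phi x2 b)).
  rewrite tliftE; last first.
    exact: (@measuring_bilin R R'' (coalg_tens C D) (meas_comp Phi Phi') a b).
  by rewrite !meas_compE.
have e2 y s : Phi' y (tlift (fun x1 x2 => nu_mul (Phi x1 a) (Phi x2 b)) s)
    = F (tmiddle _ _ _ _ (s *t comul D y)).
  rewrite /F; tens_induction s x1 x2.
  rewrite tliftE; last exact: measuring_bilin.
  by rewrite mPhi' e1.
rewrite /F; tens_induction t x y.
by rewrite meas_compE mPhi e2 tens_comulE.
Qed.

Lemma umeasuring_unit (A : calg) : umeasuring (meas_unit A).
Proof. by split=> //; exact: (@measuring_unit A). Qed.

Lemma umeasuring_precomp (A A' : calg) (C D : coalg K)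
  (Phi : {linear D -> {linear A -> A'}}) (zeta : coalgmor C D) :
  umeasuring Phi -> umeasuring (meas_precomp Phi zeta).
Proof.
case=> m1 m2; split=> [|x]; last by rewrite /= m2 coalgmor_counit.
exact: (@measuring_precomp A A').
Qed.

Lemma umeasuring_comp (A A' A'' : calg) (C D : coalg K)
  (Phi : {linear C -> {linear A -> A'}})
  (Phi' : {linear D -> {linear A' -> A''}}) :
  umeasuring Phi -> umeasuring Phi' ->
  umeasuring (C := coalg_tens C D) (meas_comp Phi Phi').
Proof.
case=> m1 m2 [m1' m2']; split.
  exact: (@measuring_comp A A' A'').
elim/tens_ind => [|s t es et|x y].
- by rewrite !linear0 /= scale0r.
- by rewrite !linearD /= es et scalerDl.
by rewrite [counit _ _]tens_counitE meas_compE m2 linearZ /= m2' scalerA.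
Qed.

End Algebras.

Section TensorPowers.
Variables (K : fieldType) (V : lmodType K).

Fixpoint tpow (n : nat) : lmodType K :=
  if n is m.+1 then V ⊗ tpow m else K^o.

(* v 0 *t v 1 *t ... *t v n.-1; the other values of v are ignored, here and
   for all the finite sequences (a_0, ..., a_n) below. *)
Fixpoint tpowp (n : nat) (v : nat -> V) : tpow n :=
  match n return tpow n with
  | 0 => (1 : K^o)
  | m.+1 => v 0%N *t tpowp m (fun i => v i.+1)
  end.
End TensorPowers.

Section Hochschild.
Variables (K : fieldType) (A : calg K).

Definition abar : lmodType K := quomod (span (fun a : A => a = calg1 A)).

Definition hoch (n : nat) : lmodType K := A ⊗ tpow abar n.

Definition chain (n : nat) (a : nat -> A) : hoch n :=
  a 0%N *t tpowp n (fun i => qclass _ (a i.+1) : abar).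

Definition face (i : nat) (a : nat -> A) (j : nat) : A :=
  if (j < i)%N then a j else if j == i then nu_mul (a i) (a i.+1) else a j.+1.

Definition last_face (n : nat) (a : nat -> A) (j : nat) : A :=
  if j == 0%N then nu_mul (a n) (a 0%N) else a j.

Definition hoch_b (n : nat) : {linear hoch n.+1 -> hoch n} :=
  induced (chain n.+1) (fun a =>
    \sum_(i < n.+1) (-1) ^+ i *: chain n (face i a)
    + (-1) ^+ n.+1 *: chain n (last_face n.+1 a)).

(* The i-th term is (1, a_i, ..., a_n, a_0, ..., a_(i-1)). *)
Definition connesB (n : nat) : {linear hoch n -> hoch n.+1} :=
  induced (chain n) (fun a =>
    \sum_(i < n.+1) (-1) ^+ (n * i) *:
      chain n.+1 (fun j => if j is k.+1 then a ((i + k) %% n.+1)%N else calg1 A)).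

(* Permutations of {0, ..., p+q-1}, one less than the indices of the entries
   a_1, ..., a_p, b_1, ..., b_q that they permute. *)
Definition is_shuffle (p q : nat) (s : 'S_(p + q)) : bool :=
  [forall i : 'I_(p + q), forall j : 'I_(p + q),
     ((i < j) && ((j < p) || (p <= i)) ==> (s i < s j))%N].

Definition perm_chain (n : nat) (s : 'S_n) (c : nat -> A) (j : nat) : A :=
  if j is k.+1 then
    if insub k is Some i then c ((s^-1)%g i : 'I_n).+1 else 0
  else c 0%N.

Definition join_chain (p : nat) (a b : nat -> A) (j : nat) : A :=
  if j == 0%N then nu_mul (a 0%N) (b 0%N) else if (j <= p)%N then a j else b (j - p)%N.

Definition shuffle (p q : nat) : {linear hoch p ⊗ hoch q -> hoch (p + q)} :=
  induced (fun ab : (nat -> A) * (nat -> A) => chain p ab.1 *t chain q ab.2)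
    (fun ab => \sum_(s : 'S_(p + q) | is_shuffle s)
       (-1) ^+ s *: chain (p + q) (perm_chain s (join_chain p ab.1 ab.2))).

Definition chains : lmodType K := dsum hoch.

(* tot p is the degree p part hoch p + hoch (p - 2) + ... of the total complex,
   and dtot p its differential b + B to degree p - 1. *)
Definition totp (p : nat) (z : chains) : Prop :=
  forall n, ~~ ((n <= p)%N && (odd n == odd p)) -> z n = 0.
Fact totp0 p : totp p 0.
Proof. by []. Qed.
Fact totpP p k x y : totp p x -> totp p y -> totp p (k *: x + y).
Proof. by move=> tx ty n np /=; rewrite tx ?ty //= scaler0 addr0. Qed.
Definition tot (p : nat) : subspace chains := Subspace (@totp0 p) (@totpP p).

Definition connesB_at (z : chains) (n : nat) : hoch n :=
  match n with 0 => 0 | m.+1 => connesB m (z m) end.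

Definition dtot_fun (p : nat) (z : chains) : chains :=
  \sum_(n < p) dinj (V := hoch) (i := n)
    (hoch_b n (z n.+1) + connesB_at z n).
Fact dtot_linear p : linear (dtot_fun p).
Proof.
move=> k x y; rewrite /dtot_fun scaler_sumr -big_split; apply: eq_bigr => n _ /=.
rewrite -linearP; congr dinj; case: n => -[|m] lt_mp; rewrite /connesB_at /=.
  by rewrite !addr0 linearP.
by rewrite !linearP /= scalerDr addrACA.
Qed.
Definition dtot (p : nat) : {linear chains -> chains} := mklin (@dtot_linear p).

Definition cyclep (p : nat) (z : chains) : Prop := tot p z /\ dtot p z = 0.
Fact cyclep0 p : cyclep p 0.
Proof. by split; [exact: subspace0 | exact: linear0]. Qed.
Fact cyclepP p k x y : cyclep p x -> cyclep p y -> cyclep p (k *: x + y).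
Proof.
move=> [tx dx] [ty dy]; split; first exact: subspaceP.
by rewrite linearP dx dy scaler0 addr0.
Qed.
Definition cycle (p : nat) : lmodType K :=
  submod (Subspace (@cyclep0 p) (@cyclepP p)).

Definition boundaryp (p : nat) (z : cycle p) : Prop :=
  exists2 w, tot p.+1 w & dtot p.+1 w = submod_val z.
Fact boundaryp0 p : boundaryp (0 : cycle p).
Proof. by exists 0; [exact: subspace0 | rewrite linear0]. Qed.
Fact boundarypP p k (x y : cycle p) :
  boundaryp x -> boundaryp y -> boundaryp (k *: x + y).
Proof.
move=> [v tv dv] [w tw dw]; exists (k *: v + w); first exact: subspaceP.
by rewrite linearP dv dw.
Qed.
Definition HC (p : nat) : lmodType K :=
  quomod (Subspace (@boundaryp0 p) (@boundarypP p)).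

Definition hclass (p : nat) (z : cycle p) : HC p := qclass _ z.

(* The homology class of a chain, with value 0 on the chains which are not
   cycles of degree p. *)
Definition hclass_of (p : nat) (z : chains) : HC p :=
  if insub z is Some c then hclass c else 0.

(* z = (z_p, z_(p-2), ...), w = (w_q, w_(q-2), ...) |->
   (B z_p × w_q, B z_p × w_(q-2), ...) *)
Definition star_chain (p q : nat) (z w : chains) : chains :=
  \sum_(m < q.+1) dinj (shuffle p.+1 m (connesB p (z p) *t w m)).

Definition star (p q : nat) : {linear HC p ⊗ HC q -> HC (p + q).+1} :=
  induced
    (fun zw : cycle p * cycle q => hclass zw.1 *t hclass zw.2)
    (fun zw => hclass_of (p + q).+1
       (star_chain p q (submod_val zw.1) (submod_val zw.2))).

(* HC'_n = HC_(n-1): the summand HC p sits in degree p + 1. *)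
Definition HCprime_mod : lmodType K := dsum HC.

Definition HCprime_mulmap : {linear HCprime_mod ⊗ HCprime_mod -> HCprime_mod} :=
  induced
    (fun t : {p & HC p} * {q & HC q} => dinj (projT2 t.1) *t dinj (projT2 t.2))
    (fun t => dinj (star _ _ (projT2 t.1 *t projT2 t.2))).

Definition HCprime_mul (x y : HCprime_mod) : HCprime_mod :=
  HCprime_mulmap (x *t y).
Fact HCprime_mulP : bilin HCprime_mul.
Proof.
by split=> [y|x] k u v; rewrite /HCprime_mul ?(tpurePl, tpurePr) linearP.
Qed.
Definition HCprime : nualg K := Nualg HCprime_mulP.

End Hochschild.

Section InducedOnHC.
Variables (K : fieldType) (A A' : calg K) (C : coalg K).
Variable Phi : {linear C -> {linear A -> A'}}.

(* iterated comultiplication x |-> x_(1) *t ... *t x_(n) *t 1 *)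
Fixpoint comuln (n : nat) : {linear C -> tpow C n} :=
  match n return {linear C -> tpow C n} with
  | 0 => counit C
  | m.+1 => tmap idfun (comuln m) \o comul C
  end.

Definition meas_hoch (n : nat) : {linear C ⊗ hoch A n -> hoch A' n} :=
  induced (fun xa : C * (nat -> A) => xa.1 *t chain n xa.2)
    (fun xa =>
       (induced (tpowp n.+1) (fun c : nat -> C => chain n (fun i => Phi (c i) (xa.2 i)))
         : {linear tpow C n.+1 -> hoch A' n})
       (comuln n.+1 xa.1)).

Definition meas_chains : {linear C ⊗ chains A -> chains A'} :=
  induced (fun xc : C * {n & hoch A n} => xc.1 *t dinj (projT2 xc.2))
    (fun xc => dinj (meas_hoch _ (xc.1 *t projT2 xc.2))).

Definition meas_HC (p : nat) : {linear C ⊗ HC A p -> HC A' p} :=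
  induced (fun xz : C * cycle A p => xz.1 *t hclass xz.2)
    (fun xz => hclass_of p (meas_chains (xz.1 *t submod_val xz.2))).

Definition meas_HCprime : {linear C -> {linear HCprime A -> HCprime A'}} :=
  tcurry (induced
    (fun xu : C * {p & HC A p} =>
       xu.1 *t (dinj (projT2 xu.2) : HCprime_mod A))
    (fun xu => dinj (meas_HC _ (xu.1 *t projT2 xu.2)) : HCprime_mod A')).

End InducedOnHC.

Section Categories.
Variable K : fieldType.

Definition cALG (M : forall A A' : calg K, universal (@umeasuring K A A')) :
  ecat K :=
  meas_ecat (@umeasuring_unit K) (@umeasuring_comp K) (@umeasuring_precomp K) M.

Definition cALGt
  (M : forall A A' : calg K, universal (@measuring K (HCprime A) (HCprime A'))) :
  ecat K :=
  meas_ecat (R := @HCprime K) (fun A => @measuring_unit K (HCprime A))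
    (fun A A' A'' C D Phi Phi' => @measuring_comp K _ _ _ C D Phi Phi')
    (fun A A' C D Phi zeta => @measuring_precomp K _ _ C D Phi zeta) M.

(* t is the unique coalgebra map through which the measuring induced by the
   universal one on the algebras HCprime factors. *)
Definition is_tau (A A' : calg K) (M : universal (@umeasuring K A A'))
  (Mt : universal (@measuring K (HCprime A) (HCprime A')))
  (t : coalgmor (univ_coalg M) (univ_coalg Mt)) : Prop :=
  (forall x, univ_map Mt (t x) = meas_HCprime (univ_map M) x) /\
  (forall t' : coalgmor (univ_coalg M) (univ_coalg Mt),
     (forall x, univ_map Mt (t' x) = meas_HCprime (univ_map M) x) -> t' =1 t).
End Categories.

(* Main.v *)
Require Import Defs.
From mathcomp Require Import all_boot all_algebra.
From mathcomp Require Import perm boolp zify.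

(** The functor is forced on Hom objects: a coalgebra map into a universal
measuring coalgebra is the same as a measuring, and two such maps agree as soon
as the measurings do.  So tau exists and is unique once it is known that a
measuring Phi from A to A' induces a measuring of the algebras HCprime, and the
two functor equations reduce to the facts that this construction is compatible
with composition, with units and with precomposition by coalgebra maps.

The work lies in the chain complexes.  A chain is a combination of words
a_0 a_1 ... a_n, and Phi acts on words by letting the n+1 Sweedler components of
x act on the n+1 letters (meas_word).  Three laws govern this action: letters
may be exchanged, since C is cocommutative (ev_meas_word_swap); two adjacent
letters may be multiplied before or after Phi acts, since Phi is a measuring and
C is coassociative (ev_meas_word_mul_head); a letter 1 may be inserted, since
Phi(x)(1) = counit(x) 1 (ev_meas_word_one).  As b, B and the shuffle product are
built from these three moves, Phi commutes with b and B and turns a shuffle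
product into a Sweedler sum of shuffle products.  Hence it acts on HC, and the
product z * w, the class of B z_p × w, is mapped to the Sweedler sum of the
products of the images.

All the maps in question are defined by their values on pure tensors, and are
known to exist only when these values are compatible.  For the product of HC
this means that B z_p × w is a cycle when z and w are, and a boundary when one
of them is.  Both follow from one formula (dtot_chain_shuffle): for the total
differential d and any w in the total complex,
   d (B z_p × w) = b B z_p × w + (-1)^(p+1) B z_p × d w.
It combines two rules.  The first is that b is a derivation for the shuffle
product of a commutative algebra: the faces that merge a letter of one factor
with a letter of the other cancel in pairs (ev_shuffles_word_b).  The second is
B (B x × y) = (-1)^(p+1) B x × B y on normalized chains: up to sign, both sides
are the sum of all shuffles of a rotation of the word of x with a rotation of
the word of y.  For the right hand side this is the definition.  For the left
hand side, that sum is invariant under cyclic rotation, so it is the sum over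
all rotations of its words that begin with the first letter of y
(cyclic_shuffles_rotations).

Words are handled as lists, and combinations of words are compared through the
values of functions on words: shuffles become a recursion on first letters, and
the identities for b and B become exchanges of finite sums. *)

Set Implicit Arguments.
Unset Strict Implicit.
Unset Printing Implicit Defensive.
Import GRing.Theory.
Local Open Scope ring_scope.

Local Notation "u ∙ v" := (nu_mul u v) (at level 40).


(** * Formal combinations of words and signed shuffles *)

Section LinearCombinations.
Variables (K : fieldType) (T : Type).
Implicit Types (W : lmodType K) (l : seq (K * seq T)).

(** A formal linear combination of words, given as a list of terms, is paired
with functions on words: ev l F is the value at l of the linear extension of F.
Two combinations are compared by comparing their values at every F with the
relevant properties, which replaces all quotients of free modules. *)
Definition ev W l (F : seq T -> W) : W := \sum_(p <- l) p.1 *: F p.2.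

Definition lcons (k : K) (u : T) l := [seq (k * p.1, u :: p.2) | p <- l].

Lemma ev_nil W (F : seq T -> W) : ev [::] F = 0.
Proof. by rewrite /ev big_nil. Qed.

Lemma ev1 W (F : seq T -> W) s : ev [:: (1, s)] F = F s.
Proof. by rewrite /ev big_seq1 scale1r. Qed.

Lemma ev_cat W l l' (F : seq T -> W) : ev (l ++ l') F = ev l F + ev l' F.
Proof. by rewrite /ev big_cat. Qed.

Lemma ev_lcons W k u l (F : seq T -> W) :
  ev (lcons k u l) F = k *: ev l (fun z => F (u :: z)).
Proof.
by rewrite /ev big_map scaler_sumr; apply: eq_bigr => p _; rewrite scalerA.
Qed.

Lemma eq_ev W l (F G : seq T -> W) : F =1 G -> ev l F = ev l G.
Proof. by move=> FG; apply: eq_bigr => p _; rewrite FG. Qed.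

Lemma ev_lin W W' (g : {linear W -> W'}) l (F : seq T -> W) :
  g (ev l F) = ev l (fun z => g (F z)).
Proof. by rewrite linear_sum; apply: eq_bigr => p _; rewrite linearZ. Qed.

Lemma evD W l (F G : seq T -> W) :
  ev l (fun z => F z + G z) = ev l F + ev l G.
Proof. by rewrite -big_split; apply: eq_bigr => p _; rewrite scalerDr. Qed.

Lemma evZ W l k (F : seq T -> W) : ev l (fun z => k *: F z) = k *: ev l F.
Proof.
by rewrite scaler_sumr; apply: eq_bigr => p _; rewrite !scalerA mulrC.
Qed.

Lemma evN W l (F : seq T -> W) : ev l (fun z => - F z) = - ev l F.
Proof. by rewrite -scaleN1r -evZ; apply: eq_ev => z; rewrite scaleN1r. Qed.

Lemma ev0 W l : ev l (fun _ => 0 : W) = 0.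
Proof. by rewrite /ev big1 // => p _; rewrite scaler0. Qed.

Lemma ev_sum W l I (r : seq I) (P : pred I) (F : I -> seq T -> W) :
  ev l (fun z => \sum_(i <- r | P i) F i z) = \sum_(i <- r | P i) ev l (F i).
Proof.
rewrite /ev exchange_big /=; apply: eq_bigr => p _; exact: scaler_sumr.
Qed.

End LinearCombinations.

Lemma ev_ev (K : fieldType) (T T' : Type) (W : lmodType K) (l : seq (K * seq T))
  (l' : seq (K * seq T')) (F : seq T -> seq T' -> W) :
  ev l (fun z => ev l' (F z)) = ev l' (fun z' => ev l (fun z => F z z')).
Proof.
rewrite {1}/ev; under eq_bigr => p _ do rewrite scaler_sumr.
rewrite exchange_big; apply: eq_bigr => p' _; rewrite scaler_sumr.
by apply: eq_bigr => p _; rewrite !scalerA mulrC.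
Qed.

Section EndLetters.
Variables (K : fieldType) (T : Type) (W : lmodType K).
Implicit Types (s : seq T) (G : T -> seq T -> W).

(** The value 0 on the empty word lets the recursions on first and last letters
hold without side conditions. *)
Definition fst_letter s G : W := if s is u :: s' then G u s' else 0.
Definition lst_letter s G : W :=
  if s is u :: s' then G (last u s') (belast u s') else 0.

Lemma lst_letter_rcons u s G : lst_letter (rcons s u) G = G u s.
Proof.
by case: s => [|v s] //=; rewrite last_rcons belast_rcons.
Qed.

End EndLetters.

Section Shuffles.
Variables (K : fieldType) (T : Type).
Implicit Types (W : lmodType K) (x y z : seq T).

(** All letters have degree one, so moving the first letter of the second word
in front of a word x costs the sign (-1)^|x|. *)
Fixpoint shuffles x : seq T -> seq (K * seq T) :=
  if x is u :: x' then
    fix shx y := if y is v :: y' then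
      lcons 1 u (shuffles x' y) ++ lcons ((-1) ^+ size x) v (shx y')
    else [:: (1, x)]
  else fun y => [:: (1, y)].

Arguments shuffles : simpl never.

Lemma ev_shuffles0l W y (F : seq T -> W) : ev (shuffles [::] y) F = F y.
Proof. exact: ev1. Qed.

Lemma ev_shuffles0r W x (F : seq T -> W) : ev (shuffles x [::]) F = F x.
Proof. by case: x => *; exact: ev1. Qed.

Lemma ev_shuffles_cons W u v x y (F : seq T -> W) :
  ev (shuffles (u :: x) (v :: y)) F
  = ev (shuffles x (v :: y)) (fun z => F (u :: z))
    + (-1) ^+ (size x).+1 *: ev (shuffles (u :: x) y) (fun z => F (v :: z)).
Proof. by rewrite /shuffles -/shuffles ev_cat !ev_lcons scale1r. Qed.

Lemma ev_shuffles_fst W x y (F : seq T -> W) : (0 < size x + size y)%N ->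
  ev (shuffles x y) F
  = fst_letter x (fun u x' => ev (shuffles x' y) (fun z => F (u :: z)))
    + (-1) ^+ size x
        *: fst_letter y (fun v y' => ev (shuffles x y') (fun z => F (v :: z))).
Proof.
case: x y => [|u x] [|v y] //= _; last exact: ev_shuffles_cons.
- by rewrite !ev_shuffles0l add0r scale1r.
by rewrite !ev1 ev_shuffles0r scaler0 addr0.
Qed.

(** Counting letters is enough to control both the length of a shuffle and the
occurrences of a marked letter in it. *)
Lemma eq_ev_shuffles W x y (F G : seq T -> W) :
  (forall z, (forall a, count a z = count a x + count a y)%N -> F z = G z) ->
  ev (shuffles x y) F = ev (shuffles x y) G.
Proof.
have [n] := ubnP (size x + size y); elim: n => // n IH in x y F G * => lt_n FG.
case: x y lt_n FG => [|u x] [|v y] /= lt_n FG;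
  try by rewrite ?ev1 ?ev_shuffles0l ?ev_shuffles0r; apply: FG => a;
    rewrite /= ?addn0.
rewrite !ev_shuffles_cons; congr (_ + _ *: _); apply: IH => /=.
- by rewrite -ltnS.
- by move=> z cz; apply: FG => a; rewrite /= cz addnA.
- by move: lt_n; rewrite addnS -ltnS.
by move=> z cz; apply: FG => a; rewrite /= cz addnCA.
Qed.

Lemma eq_ev_shuffles_size W x y (F G : seq T -> W) :
  (forall z, size z = (size x + size y)%N -> F z = G z) ->
  ev (shuffles x y) F = ev (shuffles x y) G.
Proof.
move=> FG; apply: eq_ev_shuffles => z cz; apply: FG.
by rewrite -!(count_predT) cz.
Qed.

Lemma ev_shuffles_fst_letter W x y (G : T -> seq T -> W) :
  ev (shuffles x y) (fun z => fst_letter z G)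
  = fst_letter x (fun u x' => ev (shuffles x' y) (G u))
    + (-1) ^+ size x *: fst_letter y (fun v y' => ev (shuffles x y') (G v)).
Proof.
have [|] := posnP (size x + size y); last exact: ev_shuffles_fst.
by case: x y => [|u x] [|v y] //= _; rewrite ev1 /= scaler0 addr0.
Qed.

(** The last letter of a shuffle is the last letter of x, which then has passed
the whole of y, or the last letter of y. *)
Lemma ev_shuffles_lst_letter W x y (G : T -> seq T -> W) :
  ev (shuffles x y) (fun z => lst_letter z G)
  = (-1) ^+ size y *: lst_letter x (fun u x' => ev (shuffles x' y) (G u))
    + lst_letter y (fun v y' => ev (shuffles x y') (G v)).
Proof.
have [n] := ubnP (size x + size y); elim: n => // n IH in x y G * => lt_n.
case: x y lt_n => [|u x] [|v y] lt_n.
- by rewrite ev1 scaler0 addr0.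
- by rewrite ev_shuffles0l scaler0 add0r /= ev_shuffles0l.
- by rewrite ev_shuffles0r scale1r addr0 /= ev_shuffles0r.
(* split each side according to the first letter, u or v, of the shuffle *)
pose Gu w z := G w (u :: z); pose Gv w z := G w (v :: z).
have lst_cons w x1 y1 : (0 < size x1 + size y1)%N ->
    ev (shuffles x1 y1) (fun z => lst_letter (w :: z) G)
    = ev (shuffles x1 y1) (fun z => lst_letter z (fun w' z' => G w' (w :: z'))).
  move=> gt0; apply: eq_ev_shuffles_size => -[|w' z'] //= s0.
  by move: gt0; rewrite -s0.
have -> : lst_letter (u :: x) (fun w x' => ev (shuffles x' (v :: y)) (G w))
  = lst_letter x (fun w x' => ev (shuffles x' (v :: y)) (Gu w))
    + (-1) ^+ size x *: lst_letter (u :: x) (fun w x' =>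
      ev (shuffles x' y) (Gv w)).
  case: x {lt_n} => [|a x]; first by rewrite /= !ev_shuffles0l add0r scale1r.
  by rewrite [LHS]/= ev_shuffles_cons size_belast.
have -> : lst_letter (v :: y) (fun w y' => ev (shuffles (u :: x) y') (G w))
  = lst_letter (v :: y) (fun w y' => ev (shuffles x y') (Gu w))
    + (-1) ^+ (size x).+1
        *: lst_letter y (fun w y' => ev (shuffles (u :: x) y') (Gv w)).
  case: y {lt_n} => [|a y]; first by rewrite /= !ev1 ev_shuffles0r scaler0 addr0.
  by rewrite [LHS]/= ev_shuffles_cons.
rewrite ev_shuffles_cons !lst_cons ?addnS //.
rewrite (IH x (v :: y)) // (IH (u :: x) y); last first.
  by move: lt_n; rewrite /= addnS.
rewrite -/(Gu _ _) !scalerDr !scalerA -!addrA; congr (_ + _).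
rewrite [RHS]addrCA; congr (_ + (_ *: _ + _)).
by rewrite -!exprD addnC !addnS addSn.
Qed.
End Shuffles.

(** * Faces and the Leibniz rule *)

Section InnerFaces.
Variables (K : fieldType) (A : calg K).
Implicit Types (W : lmodType K) (x y z : seq A).

Definition mul_head s : seq A := if s is u :: v :: s' then u ∙ v :: s' else s.

Fixpoint contract i s : seq A :=
  if i is j.+1 then (if s is u :: s' then u :: contract j s' else [::])
  else mul_head s.

(** The face that multiplies the last letter into the first is treated apart,
see word_b: this sum is the differential usually called b'. *)
Definition faces s : seq (K * seq A) :=
  [seq ((-1) ^+ i, contract i s) | i <- iota 0 (size s).-1].

Lemma size_contract i s : (i.+1 < size s)%N -> size (contract i s) = (size s).-1.
Proof.
elim: i s => [|i IH] [|u [|v s]] //= lt_i; rewrite IH //=.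
Qed.

Lemma ev_faces_cons W u y (F : seq A -> W) :
  ev (faces (u :: y)) F
  = fst_letter y (fun v y' => F (u ∙ v :: y')) - ev (faces y) (fun z =>
    F (u :: z)).
Proof.
case: y => [|v y]; first by rewrite /faces /= !ev_nil subrr.
rewrite /faces /= /ev big_cons /= scale1r; congr (_ + _).
rewrite (iotaDl 1 0) !big_map -sumrN; apply: eq_bigr => i _ /=.
by rewrite exprS mulN1r scaleNr.
Qed.

Lemma eq_ev_faces W x (F G : seq A -> W) :
  (forall z, size x = (size z).+1 -> F z = G z) -> ev (faces x) F
    = ev (faces x) G.
Proof.
move=> FG; rewrite /ev !big_map big_seq [RHS]big_seq; apply: eq_bigr => i.
rewrite mem_iota add0n /= => lt_i; rewrite FG // size_contract; last first.
  by case: (size x) lt_i.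
by case: (size x) lt_i.
Qed.

(** The faces that merge two letters of the same word give the two terms on the
right.  A letter u of x and a letter v of y are merged twice, in the words with
u v and in those with v u, which have opposite signs; these terms cancel by
commutativity. *)
Lemma ev_shuffles_faces W x y (F : seq A -> W) :
  ev (shuffles K x y) (fun z => ev (faces z) F)
  = ev (faces x) (fun z => ev (shuffles K z y) F)
    + (-1) ^+ size x *: ev (faces y) (fun z => ev (shuffles K x z) F).
Proof.
have [n] := ubnP (size x + size y); elim: n => // n IH in x y F * => lt_n.
case: x y lt_n => [|u x] [|v y] lt_n.
- by rewrite ev_shuffles0l !ev_nil scaler0 addr0.
- rewrite ev_shuffles0l ev_nil scale1r add0r; apply: eq_ev => z.
  by rewrite ev_shuffles0l.
- rewrite ev_shuffles0r ev_nil scaler0 addr0; apply: eq_ev => z.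
  by rewrite ev_shuffles0r.
pose Fu z := F (u :: z); pose Fv z := F (v :: z).
have eq_x : ev (faces (u :: x)) (fun z => ev (shuffles K z (v :: y)) F)
  = fst_letter x (fun w x' => ev (shuffles K x' (v :: y)) (fun z =>
    F (u ∙ w :: z)))
    - ev (faces x) (fun z => ev (shuffles K z (v :: y)) Fu)
    + (-1) ^+ size x *: ev (faces (u :: x)) (fun z => ev (shuffles K z y) Fv).
  rewrite !ev_faces_cons scalerBr addrACA -opprD; congr (_ - _).
    case: x {lt_n} => [|w x] /=; first by rewrite scaler0 addr0.
    by rewrite ev_shuffles_cons.
  rewrite -evZ -evD; apply: eq_ev_faces => z ->.
  by rewrite ev_shuffles_cons.
have eq_y : ev (faces (v :: y)) (fun z => ev (shuffles K (u :: x) z) F)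
  = ev (faces (v :: y)) (fun z => ev (shuffles K x z) Fu)
    + (-1) ^+ (size x).+1
       *: (fst_letter y (fun w y' => ev (shuffles K (u :: x) y') (fun z =>
         F (v ∙ w :: z)))
           - ev (faces y) (fun z => ev (shuffles K (u :: x) z) Fv)).
  rewrite !ev_faces_cons scalerBr addrACA -opprD; congr (_ - _).
    case: y {lt_n} eq_x => [|w y] _ /=; first by rewrite scaler0 addr0.
    by rewrite ev_shuffles_cons.
  rewrite -evZ -evD; apply: eq_ev_faces => z _.
  by rewrite ev_shuffles_cons.
rewrite eq_x eq_y ev_shuffles_cons.
do 2 rewrite (eq_ev _ (fun z =>
  ev_faces_cons _ z F)) evD evN ev_shuffles_fst_letter.
rewrite !IH //=; last by move: lt_n; rewrite /= addnS.
rewrite (calg_mulC v u) -/Fu -/Fv exprS mulN1r -signr_odd.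
move: (fst_letter x _) (ev (shuffles K x y) _) (ev (faces x) _) => a c b.
move: (ev (faces (v :: y)) _) (ev (faces (u :: x)) _) => e g.
move: (fst_letter y _) (ev (faces y) _) => d h.
rewrite opprD addrACA -scalerBr -[LHS]addrA -[RHS]addrA; congr (_ + _).
move: (_ ^+ _) => s.
have collect (v1 v2 : W) : s *: v1 + - s *: v2 = s *: (v1 - v2).
  by rewrite scaleNr scalerBr.
rewrite !collect; congr (_ *: _); rewrite [in RHS]scalerBr !opprD !opprK.
rewrite -!addrA [- e + (- c + _)]addrCA addNKr.
by rewrite [_ + (g + _)]addrCA [LHS]addrCA.
Qed.
End InnerFaces.

Section Boundary.
Variables (K : fieldType) (A : calg K).
Implicit Types (W : lmodType K) (x y z s : seq A).

(** The Hochschild boundary; it is the empty combination on words of length at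
most one, in accordance with b = 0 in degree 0. *)
Definition word_b s : seq (K * seq A) :=
  faces s ++
  if s is u :: v :: s' then
    [:: ((-1) ^+ (size s').+1, last v s' ∙ u :: belast v s')]
  else [::].

Lemma ev_word_b_cons W a x (F : seq A -> W) :
  ev (word_b (a :: x)) F
  = ev (faces (a :: x)) F
    + (-1) ^+ size x *: lst_letter x (fun u x' => F (u ∙ a :: x')).
Proof.
rewrite ev_cat; congr (_ + _); case: x => [|v x]; first by rewrite ev_nil scaler0.
by rewrite /ev big_seq1.
Qed.

(** The Leibniz rule for b.  The faces that involve the coefficient in degree 0
take away the first or the last letter of the shuffle, and the other ones are
inner faces: the rule is the sum of ev_shuffles_fst_letter, ev_shuffles_faces and
ev_shuffles_lst_letter. *)
Lemma ev_shuffles_word_b W a b x y (F : seq A -> W) :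
  ev (shuffles K x y) (fun z => ev (word_b (a ∙ b :: z)) F)
  = ev (word_b (a :: x))
      (fun s => fst_letter s (fun a' x' => ev (shuffles K x' y) (fun z =>
        F (a' ∙ b :: z))))
    + (-1) ^+ size x *: ev (word_b (b :: y))
      (fun s => fst_letter s (fun b' y' => ev (shuffles K x y') (fun z =>
        F (a ∙ b' :: z)))).
Proof.
under eq_ev => z do rewrite ev_word_b_cons ev_faces_cons.
rewrite !evD evN ev_shuffles_fst_letter ev_shuffles_faces !ev_word_b_cons
  !ev_faces_cons /=.
rewrite (@eq_ev_shuffles_size _ _ _ _ _ _
  (fun z => (-1) ^+ (size x + size y) *: lst_letter z (fun u z' =>
    F (u ∙ (a ∙ b) :: z'))));
  last by move=> z ->.
have sgn : (-1) ^+ (size x + size y) * (-1) ^+ size y = (-1) ^+ size x :> K.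
  by rewrite -exprD -addnA addnn exprD -[_ ^+ _.*2]signr_odd odd_double mulr1.
rewrite evZ ev_shuffles_lst_letter !scalerDr !scalerA sgn -exprD.
have -> : fst_letter x (fun u x' => ev (shuffles K x' y) (fun y' =>
  F (a ∙ b ∙ u :: y')))
   = fst_letter x (fun u x' => ev (shuffles K x' y) (fun y' =>
     F (a ∙ u ∙ b :: y'))).
  by case: x {sgn} => //= u x; rewrite -!calg_mulA (calg_mulC b).
have -> : fst_letter y (fun v y' => ev (shuffles K x y') (fun y'0 =>
  F (a ∙ b ∙ v :: y'0)))
   = fst_letter y (fun u x' => ev (shuffles K x x') (fun y' =>
     F (a ∙ (b ∙ u) :: y'))).
  by case: y {sgn} => //= u y; rewrite -!calg_mulA.
have -> : lst_letter x (fun u x' => ev (shuffles K x' y) (fun z' =>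
  F (u ∙ (a ∙ b) :: z')))
   = lst_letter x (fun u x' => ev (shuffles K x' y) (fun z' =>
     F (u ∙ a ∙ b :: z'))).
  by case: x {sgn} => //= u x; rewrite -!calg_mulA.
have -> : lst_letter y (fun u y' => ev (shuffles K x y') (fun z' =>
  F (u ∙ (a ∙ b) :: z')))
   = lst_letter y (fun u y' => ev (shuffles K x y') (fun z' =>
     F (a ∙ (u ∙ b) :: z'))).
  case: y {sgn} => //= u y; apply: eq_ev => z; congr (F (_ :: _)).
  by rewrite calg_mulC -calg_mulA [b ∙ _]calg_mulC.
by rewrite opprD [X in X + _ = _]addrACA [LHS]addrACA scalerN.
Qed.

(** Together with linearity in each letter, this is what makes a function on
words factor through A tensored with powers of A / K (hoch_lift). *)
Definition normalized W (F : seq A -> W) :=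
  forall a s1 s2, F (a :: s1 ++ calg1 A :: s2) = 0.

Lemma calg_mul1r (u : A) : u ∙ calg1 A = u.
Proof. by rewrite calg_mulC calg_mul1. Qed.

(** The two faces next to the letter 1 cancel, unless 1 is the last letter and
has only one of them. *)
Lemma ev_faces_degenerate W (G : seq A -> W) u s1 s2 :
  (forall s1 s2, G (s1 ++ calg1 A :: s2) = 0) ->
  ev (faces (u :: s1 ++ calg1 A :: s2)) G
  = if s2 is [::] then (-1) ^+ size s1 *: G (u :: s1) else 0.
Proof.
elim: s1 u G => [|v s1 IH] u G G0.
  rewrite ev_faces_cons /= calg_mul1r ev_faces_cons.
  have -> : ev (faces s2) (fun z => G [:: u, calg1 A & z]) = 0.
    by rewrite -[RHS](ev0 _ (faces s2)); apply: eq_ev => z; exact: (G0 [:: u]).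
  case: s2 => [|v s2] /=; first by rewrite !subr0 scale1r.
  by rewrite calg_mul1 subr0 subrr.
rewrite ev_faces_cons /= (G0 (_ :: _)) sub0r IH; last by move=> ? ?;
  exact: (G0 (_ :: _)).
by case: s2 {IH} => [|? ?]; rewrite ?oppr0 // exprS mulN1r scaleNr.
Qed.

(** Once the last face is included, the letter 1 always has two neighbouring
faces of opposite signs. *)
Lemma ev_word_b_degenerate W (F : seq A -> W) : normalized F ->
  normalized (fun s => ev (word_b s) F).
Proof.
move=> F0 a s1 s2; rewrite ev_word_b_cons ev_faces_cons.
have F1 s : F [:: a, calg1 A & s] = 0 by exact: (F0 a [::]).
case: s1 => [|u s1] /=.
  rewrite ev_faces_cons /= calg_mul1r.
  have -> : ev (faces s2) (fun z => F [:: a, calg1 A & z]) = 0.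
    by rewrite -[RHS](ev0 _ (faces s2)); apply: eq_ev => z.
  case/lastP: s2 => [|s2 v] /=;
    first by rewrite !subr0 calg_mul1 expr1 scaleN1r subrr.
  rewrite last_rcons belast_rcons (F0 _ [::]) scaler0 addr0.
  by case: s2 => [|w s2] /=; rewrite calg_mul1 subr0 subrr.
rewrite (F0 _ s1) sub0r ev_faces_degenerate; last by move=> ? ?; exact: F0.
case/lastP: s2 => [|s2 v] /=.
  rewrite cats1 last_rcons belast_rcons calg_mul1 size_rcons !exprS.
  by rewrite !mulN1r opprK addNr.
have -> : (if rcons s2 v is [::] then (-1) ^+ size s1 *: F [:: a, u & s1]
  else 0) = 0 :> W.
  by case: s2.
rewrite oppr0 add0r -rcons_cons -rcons_cat last_rcons belast_rcons.
by rewrite (F0 _ (u :: s1)) scaler0.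
Qed.
End Boundary.

(** * Rotations of words *)

Lemma eq_sign_parity (K : fieldType) (n m : nat) : odd n = odd m ->
  (-1) ^+ n = (-1) ^+ m :> K.
Proof. by move=> nm; rewrite -signr_odd nm signr_odd. Qed.

Section Rotations.
Variables (K : fieldType) (T : Type).
Implicit Types (W : lmodType K) (s : seq T).

(** The norm operator N = 1 + t + ... + t^n of the signed rotation t. *)
Definition rotations s : seq (K * seq T) :=
  [seq ((-1) ^+ ((size s).-1 * i), rot i s) | i <- iota 0 (size s)].

Lemma ev_rotations W s (F : seq T -> W) :
  ev (rotations s) F = \sum_(i < size s) (-1) ^+ ((size s).-1 * i) *: F (rot i s).
Proof.
by rewrite /ev big_map -[X in iota 0 X]subn0 -/(index_iota 0 _) big_mkord.
Qed.

Lemma eq_ev_rotations W s (F G : seq T -> W) :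
  (forall z, size z = size s -> F z = G z) -> ev (rotations s) F
    = ev (rotations s) G.
Proof.
by move=> FG; rewrite !ev_rotations; apply: eq_bigr => i _; rewrite FG ?size_rot.
Qed.

(** For a word of length n + 1, the orbit closes up with the sign
(-1)^(n (n + 1)) = 1. *)
Lemma ev_rotations_rot1 W s (F : seq T -> W) :
  ev (rotations s) (fun z => F (rot 1 z))
    = (-1) ^+ (size s).-1 *: ev (rotations s) F.
Proof.
rewrite !ev_rotations; case sz_s: (size s) => [|n];
  first by rewrite !big_ord0 scaler0.
rewrite big_ord_recr big_ord_recl /= -[rot 1 (rot n s)]rotS
  ?sz_s // -{1}sz_s rot_size.
rewrite scalerDr addrC muln0 scale1r rot0; congr (_ *: _ + _).
  by apply: eq_sign_parity; rewrite oddM andbb.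
rewrite scaler_sumr; apply: eq_bigr => i _; rewrite scalerA -rotS; last first.
  by rewrite sz_s ltnS ltnW.
congr (_ *: _); rewrite -exprD; apply: eq_sign_parity.
by rewrite mulnS addnA addnn oddD odd_double.
Qed.

Lemma ev_rotations_rot W k s (F : seq T -> W) : (k <= size s)%N ->
  ev (rotations s) (fun z => F (rot k z))
    = (-1) ^+ ((size s).-1 * k) *: ev (rotations s) F.
Proof.
elim: k F => [|k IH] F le_k.
  by rewrite muln0 scale1r; apply: eq_ev => z; rewrite rot0.
rewrite mulnSr exprD -scalerA -ev_rotations_rot1 -(IH (fun z =>
  F (rot 1 z))) 1?ltnW //.
by apply: eq_ev_rotations => z sz; rewrite rotS ?sz.
Qed.

Lemma ev_rotations_rotr W k s (F : seq T -> W) : (k <= size s)%N ->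
  ev (rotations s) (fun z => F (rotr k z))
    = (-1) ^+ ((size s).-1 * k) *: ev (rotations s) F.
Proof.
move=> le_k; have := ev_rotations_rot (fun z => F (rotr k z)) le_k.
under eq_ev => z do rewrite rotK.
by move=> ->; rewrite scalerA -exprD addnn -signr_odd odd_double scale1r.
Qed.

Lemma ev_rotations_of_rot W k s (F : seq T -> W) :
  ev (rotations (rot k s)) F = ev (rotations s) (fun z => F (rot k z)).
Proof.
by rewrite !ev_rotations size_rot; apply: eq_bigr => i _; rewrite rot_rot.
Qed.

Lemma ev_rotations_of_rotr W k s (F : seq T -> W) : (k <= size s)%N ->
  ev (rotations (rotr k s)) F = (-1) ^+ ((size s).-1 * k) *: ev (rotations s) F.
Proof.
move=> le_k; rewrite -ev_rotations_rotr // -[in RHS](rotrK k s)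
  ev_rotations_of_rot.
by apply: eq_ev => z; rewrite rotK.
Qed.

(** The orbit may be run through in either direction. *)
Lemma ev_rotationsE_rotr W s (F : seq T -> W) :
  ev (rotations s) F
    = \sum_(i < size s) (-1) ^+ ((size s).-1 * i) *: F (rotr i s).
Proof.
rewrite ev_rotations; case sz_s: (size s) => [|n]; first by rewrite !big_ord0.
rewrite !big_ord_recl rot0 /rotr subn0 rot_size; congr (_ + _).
rewrite (reindex_inj rev_ord_inj); apply: eq_bigr => i _ /=.
rewrite sz_s /bump /= !add1n subnSK // subSS; congr (_ *: _).
apply: eq_sign_parity; rewrite !oddM; have [on|//] := boolP (odd n).
by rewrite /= oddB ?on //= ltnW.
Qed.

End Rotations.

Section RotationsAndFaces.
Variables (K : fieldType) (A : calg K).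
Implicit Types (W : lmodType K) (s : seq A).

(** All inner faces are conjugate under rotations to the product of the first
two letters. *)
Lemma contractE i s : (i.+1 < size s)%N ->
  contract i s = rotr i (mul_head (rot i s)).
Proof.
move=> lt_i; rewrite [rot i s]/rot.
have -> : contract i s = take i s ++ mul_head (drop i s).
  elim: i s lt_i => [|i IH] [|u s] //= lt_i.
  by rewrite IH.
have szt : size (take i s) = i by rewrite size_takel // 1?ltnW // ltnW.
have : (1 < size (drop i s))%N by rewrite size_drop ltn_subRL addn1.
case: (drop i s) => [|u [|v r]] //= _.
by rewrite -cat_cons -{2}szt rotr_size_cat.
Qed.

Lemma ev_faces_rot W s (F : seq A -> W) :
  ev (faces s) F
  = \sum_(i < (size s).-1) (-1) ^+ i *: F (rotr i (mul_head (rot i s))).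
Proof.
rewrite /ev big_map -[X in iota 0 X]subn0 -/(index_iota 0 _) big_mkord.
apply: eq_bigr => i _; rewrite contractE //.
by case: (size s) i => [|n] [i lt_i].
Qed.

Lemma size_mul_head s : (1 < size s)%N -> size (mul_head s) = (size s).-1.
Proof. by case: s => [|u [|v s]]. Qed.

(** The last face is also conjugate to the product of the first two letters, so
that b runs over a full orbit of conjugates while the inner faces miss one. *)
Lemma ev_word_b_rot W s (F : seq A -> W) : (1 < size s)%N ->
  ev (word_b s) F
  = \sum_(i < size s) (-1) ^+ i *: F (rotr i (mul_head (rot i s))).
Proof.
move=> gt1; rewrite ev_cat ev_faces_rot.
case sz_s: s gt1 => [|u [|v r]] // _; rewrite -sz_s.
have -> : size s = (size r).+2 by rewrite sz_s.
rewrite [(size r).+2.-1]/= [RHS]big_ord_recr; congr (_ + _).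
rewrite /ev big_seq1; congr (_ *: F _); rewrite sz_s
  (_ : rot _ _ = rotr 1 [:: u, v & r]); last first.
  by rewrite /rotr /= subn1.
rewrite (lastI v r) -rcons_cons rotr1_rcons /=.
set w := (_ :: belast v r).
have -> : (size r).+1 = size w by rewrite /= size_belast.
by rewrite /rotr subnn rot0.
Qed.

(** The identity b' N = N b.  Both sides are sums, over n conjugating and n + 1
preliminary rotations, of the same words; the signs agree. *)
Lemma ev_rotations_faces W s (F : seq A -> W) :
  ev (rotations K s) (fun z => ev (faces z) F)
    = ev (word_b s) (fun z => ev (rotations K z) F).
Proof.
have [gt1|le1] := ltnP 1 (size s); last first.
  case: s le1 => [|u [|v s]] // _.
    by rewrite !ev_nil.
  by rewrite ev_rotations big_ord1 !ev_nil scaler0.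
rewrite (eq_ev_rotations (G := fun z => \sum_(i < (size s).-1)
   (-1) ^+ i *: F (rotr i (mul_head (rot i z)))))=> [|z <-];
     last exact: ev_faces_rot.
rewrite ev_sum ev_word_b_rot //.
set n := (size s).-1; have sz_s : size s = n.+1 by rewrite prednK // ltnW.
pose term i j := F (rotr i (mul_head (rot j s))).
transitivity (\sum_(i < n) \sum_(j < size s) (-1) ^+
  (i + n * i + n * j) *: term i j).
  apply: eq_bigr => i _;
    rewrite evZ (ev_rotations_rot (fun z => F (rotr i (mul_head z)))).
    rewrite ev_rotations !scaler_sumr; apply: eq_bigr => j _.
    by rewrite !scalerA -!exprD addnA.
  by rewrite sz_s ltnW // ltnS ltnW.
rewrite exchange_big; apply: eq_bigr => j _.
have sz_m : size (mul_head (rot j s)) = n by rewrite size_mul_head size_rot.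
rewrite ev_rotations_of_rotr sz_m; last by rewrite -ltnS -sz_s.
rewrite ev_rotationsE_rotr sz_m !scaler_sumr; apply: eq_bigr => i _.
rewrite !scalerA -!exprD; congr (_ *: _); apply: eq_sign_parity.
case: n {sz_s sz_m} i => [|n] [i lt_i] //=.
by rewrite !oddD !oddM /=; case: (odd n) (odd i) (odd j) => [] [] [].
Qed.
End RotationsAndFaces.

(** * Shuffles of rotations *)

Section CyclicShuffles.
Variables (K : fieldType) (T : Type) (W : lmodType K).
Implicit Types (c b x y z s : seq T) (F : seq T -> W).

Lemma count_rot (a : pred T) k s : count a (rot k s) = count a s.
Proof. by rewrite count_cat addnC -count_cat cat_take_drop. Qed.

Lemma eq_ev_rotations_count s F (G : seq T -> W) :
  (forall z, (forall a, count a z = count a s) -> F z = G z) ->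
  ev (rotations K s) F = ev (rotations K s) G.
Proof.
move=> FG; rewrite !ev_rotations; apply: eq_bigr => i _; congr (_ *: _).
by apply: FG => a; rewrite count_rot.
Qed.

Lemma ev_rotations_fst_letter s (G : T -> seq T -> W) :
  ev (rotations K s) (fun z => fst_letter z G)
  = (-1) ^+ (size s).-1 *: ev (rotations K s) (fun z => lst_letter z G).
Proof.
rewrite -ev_rotations_rot1; apply: eq_ev => -[|u z] //.
by rewrite rot1_cons lst_letter_rcons.
Qed.

(** The combination that represents the shuffle product of B x and B y, up to
the letters 1 in front. *)
Definition cyclic_shuffles c b F :=
  ev (rotations K c) (fun c' => ev (rotations K b) (fun b' =>
    ev (shuffles K c' b') F)).

Lemma eq_cyclic_shuffles c b F (G : seq T -> W) :
  (forall z, (forall a, count a z = count a c + count a b)%N -> F z = G z) ->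
  cyclic_shuffles c b F = cyclic_shuffles c b G.
Proof.
move=> FG; apply: eq_ev_rotations_count => c' cc;
  apply: eq_ev_rotations_count => b' cb.
by apply: eq_ev_shuffles => z cz; apply: FG => a; rewrite cz cc cb.
Qed.

Lemma eq_cyclic_shuffles_size c b F (G : seq T -> W) :
  (forall z, size z = (size c + size b)%N -> F z = G z) ->
  cyclic_shuffles c b F = cyclic_shuffles c b G.
Proof.
by move=> FG; apply: eq_cyclic_shuffles => z cz; apply: FG;
  rewrite -!count_predT cz.
Qed.

(** Removing the first letter of a rotated word and appending it at the end is
a rotation of that word, so the decomposition of shuffles by first letters is
carried to the one by last letters. *)
Lemma cyclic_shuffles_rot1 c b F : (0 < size c)%N -> (0 < size b)%N ->
  cyclic_shuffles c b (fun z => F (rot 1 z))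
  = (-1) ^+ (size c + size b).-1 *: cyclic_shuffles c b F.
Proof.
move=> c0 b0.
pose G u z := F (rcons z u).
rewrite (@eq_cyclic_shuffles_size _ _ _ (fun z => fst_letter z G)); last first.
  by move=> [|u z] //=; [case: (c) c0 | rewrite rot1_cons].
rewrite [cyclic_shuffles _ _ F](@eq_cyclic_shuffles_size _ _ _ (fun z =>
  lst_letter z G)); last first.
  move=> z; case/lastP: z => [|z u]; first by case: (c) c0.
  by rewrite lst_letter_rcons.
rewrite /cyclic_shuffles.
under [LHS]eq_ev => c' do under eq_ev => b' do rewrite ev_shuffles_fst_letter.
under [in RHS]eq_ev => c' do under eq_ev => b' do rewrite ev_shuffles_lst_letter.
under [LHS]eq_ev => c' do rewrite evD.
under [in RHS]eq_ev => c' do rewrite evD.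
rewrite !evD scalerDr; congr (_ + _).
  rewrite ev_ev; under eq_ev => b' do rewrite ev_rotations_fst_letter.
  rewrite evZ ev_ev.
  under [in RHS]eq_ev_rotations => c' sc.
    under eq_ev_rotations => b' -> do over.
    rewrite evZ; over.
  rewrite evZ scalerA; congr (_ *: _).
  rewrite -exprD; apply: eq_sign_parity.
  case: (size c) c0 => //= n _.
  by rewrite -addnA addnn oddD odd_double addbF.
transitivity ((-1) ^+ size c *: ev (rotations K c) (fun c' => ev (rotations K b)
    (fun b' => fst_letter b' (fun v y' => ev (shuffles K c' y') (G v))))).
  by rewrite -evZ; apply: eq_ev_rotations => c' ->; rewrite evZ.
under eq_ev => c' do rewrite ev_rotations_fst_letter.
rewrite evZ scalerA -exprD; congr (_ ^+ _ *: _).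
by case: (size b) b0 => // n _; rewrite addnS.
Qed.

Lemma cyclic_shuffles_rot k c b F : (0 < size c)%N -> (0 < size b)%N ->
  (k <= size c + size b)%N ->
  cyclic_shuffles c b (fun z => F (rot k z))
  = (-1) ^+ ((size c + size b).-1 * k) *: cyclic_shuffles c b F.
Proof.
move=> c0 b0; elim: k F => [|k IH] F le_k.
  by rewrite muln0 scale1r; apply: eq_cyclic_shuffles => z _; rewrite rot0.
rewrite mulnSr exprD -scalerA -cyclic_shuffles_rot1 // -(IH (fun z =>
  F (rot 1 z))) 1?ltnW //.
by apply: eq_cyclic_shuffles_size => z sz; rewrite rotS ?sz.
Qed.

Lemma sum_if_nth (a : pred T) v s (w : W) :
  \sum_(i < size s) (if a (nth v s i) then w else 0) = w *+ count a s.
Proof.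
rewrite -(big_mkord xpredT (fun i => if a (nth v s i) then w else 0)).
rewrite -(big_nth v xpredT (fun u => if a u then w else 0)) -big_mkcond.
by rewrite big_const_seq iter_addr_0.
Qed.

Lemma fst_letter_rot k v s (G : T -> seq T -> W) : (k < size s)%N ->
  fst_letter (rot k s) G = G (nth v s k) (behead (rot k s)).
Proof. by move=> lt_k; rewrite /rot (drop_nth v). Qed.

(** The letter v, recognized by the predicate a, occurs exactly once in each
word of the left hand side.  Sort these words by its position i.  By cyclic
invariance, the part with v in position i is the rotation by i of the part where
v comes first, and a shuffle of a rotation of v y that begins with v is v
followed by a shuffle with y. *)
Lemma cyclic_shuffles_marked (a : pred T) c v y F : (0 < size c)%N ->
  ~~ has a c -> ~~ has a y -> a v ->
  cyclic_shuffles c (v :: y) F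
  = (-1) ^+ size c *: ev (rotations K c) (fun c' =>
       ev (shuffles K c' y) (fun z => ev (rotations K (v :: z)) F)).
Proof.
move=> c0 ac ay av.
(* P G is G on the words that begin with the marked letter, and 0 elsewhere *)
pose P (G : seq T -> W) z := fst_letter z (fun u z' =>
  if a u then G (u :: z') else 0).
pose N := (size c + (size y).+1)%N.
have sz_N : size c + size (v :: y) = N by [].
transitivity (\sum_(i < N)
    cyclic_shuffles c (v :: y) (fun z => P (fun z => F (rotr i z)) (rot i z))).
  rewrite (@eq_cyclic_shuffles _ _ _
    (fun z => \sum_(i < N) P (fun z => F (rotr i z)) (rot i z))).
    rewrite /cyclic_shuffles;
      under eq_ev => c' do under eq_ev => b' do rewrite ev_sum.
    by under eq_ev => c' do rewrite ev_sum; rewrite ev_sum.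
  move=> z cz; have sz_z : size z = N by rewrite -!count_predT cz !count_predT.
  transitivity (\sum_(i < size z) if a (nth v z i) then F z else 0).
    rewrite sum_if_nth cz /= av.
    by move: ac ay; rewrite !has_count -!eqn0Ngt => /eqP-> /eqP->.
  rewrite sz_z; apply: eq_bigr => i _; rewrite /P (fst_letter_rot v) ?sz_z //.
  case: ifP => // _; congr F; rewrite -{1}(rotK i z); congr rotr.
  by rewrite /rot (drop_nth v) ?sz_z.
have fstE G c' : ~~ has a c' ->
  ev (rotations K (v :: y)) (fun b' => ev (shuffles K c' b') (P G))
   = (-1) ^+ size c' *: ev (shuffles K c' y) (fun z => G (v :: z)).
  move=> ac'; rewrite ev_rotations big_ord_recl big1 => [|i _]; last first.
    rewrite ev_shuffles_fst_letter (fst_letter_rot v) // [nth _ _ _]/=.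
    have -> : a (nth v y i) = false.
      by apply: contraNF ay => ai; apply/(has_nthP v); exists i.
    rewrite ev0 scaler0 addr0.
    case: c' ac' => [|w c'] /=; first by rewrite scaler0.
    by rewrite negb_or => /andP[/negPf-> _]; rewrite ev0 scaler0.
  rewrite muln0 scale1r addr0 rot0 ev_shuffles_fst_letter /= av.
  case: c' ac' => [|w c'] /=; first by rewrite add0r.
  by rewrite negb_or => /andP[/negPf-> _]; rewrite ev0 add0r.
transitivity (\sum_(i < N) (-1) ^+ (N.-1 * i) *: ((-1) ^+ size c *:
   ev (rotations K c) (fun c' => ev (shuffles K c' y) (fun z =>
     F (rotr i (v :: z)))))).
  apply: eq_bigr => i _; rewrite (cyclic_shuffles_rot (P _)) //; last exact: ltnW.
  rewrite -/N; congr (_ *: _); rewrite -evZ;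
    apply: eq_ev_rotations_count => c' cc.
  rewrite fstE; last by rewrite has_count cc -has_count.
  by rewrite -!count_predT cc.
under eq_bigr => i _ do rewrite scalerA mulrC -scalerA.
rewrite -scaler_sumr; congr (_ *: _).
under eq_bigr => i _ do rewrite -evZ.
rewrite -ev_sum; apply: eq_ev_rotations => c' sz_c.
under eq_bigr => i _ do rewrite -evZ.
rewrite -ev_sum; apply: eq_ev_shuffles_size => z sz_z.
rewrite ev_rotationsE_rotr; have -> // : size (v :: z) = N.
by rewrite /= sz_z sz_c /N addnS.
Qed.

End CyclicShuffles.

Section Mapping.
Variables (K : fieldType) (T T' : Type) (W : lmodType K) (f : T -> T').
Implicit Types (x y : seq T) (F : seq T' -> W).

Lemma ev_shuffles_map x y F :
  ev (shuffles K (map f x) (map f y)) F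
    = ev (shuffles K x y) (fun z => F (map f z)).
Proof.
have [n] := ubnP (size x + size y); elim: n => // n IH in x y F * => lt_n.
case: x y lt_n => [|u x] [|v y] lt_n; rewrite ?ev_shuffles0l ?ev_shuffles0r //=.
rewrite !ev_shuffles_cons size_map -![f _ :: map f _]/(map f (_ :: _)) !IH //.
by move: lt_n; rewrite /= addnS.
Qed.

Lemma ev_rotations_map x F :
  ev (rotations K (map f x)) F = ev (rotations K x) (fun z => F (map f z)).
Proof.
by rewrite !ev_rotations size_map; apply: eq_bigr => i _; rewrite map_rot.
Qed.
End Mapping.

(** Since v may occur in c or y, each letter is tagged with a boolean that only
marks this occurrence of v; the tags are forgotten in the end. *)
Lemma cyclic_shuffles_rotations (K : fieldType) (T : Type) (W : lmodType K)
    (c y : seq T) v (F : seq T -> W) : (0 < size c)%N ->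
  cyclic_shuffles c (v :: y) F
  = (-1) ^+ size c *: ev (rotations K c) (fun c' =>
       ev (shuffles K c' y) (fun z => ev (rotations K (v :: z)) F)).
Proof.
move=> c0; pose tag (b : bool) (u : T) := (u, b).
have unm (s : seq T) : ~~ has snd (map (tag false) s) by rewrite has_map; elim: s.
have := @cyclic_shuffles_marked K _ W snd (map (tag false) c) (v, true)
  (map (tag false) y) (fun z => F (map fst z)).
rewrite size_map => /(_ c0 (unm _) (unm _) isT).
have untag s : map fst (map (tag false) s) = s by elim: s => //= u s ->.
rewrite /cyclic_shuffles.
under [X in X = _ -> _]eq_ev => c' do under eq_ev =>
  b' do rewrite -ev_shuffles_map.
under [X in X = _ -> _]eq_ev => c' do rewrite -(ev_rotations_map _ _ (fun b' =>
  ev (shuffles K _ b') F)).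
rewrite -(ev_rotations_map _ _ (fun c' => ev (rotations K _) (fun b' =>
  ev (shuffles K c' b') F))).
rewrite /= !untag => ->; congr (_ *: _).
under eq_ev => c' do under eq_ev => z do rewrite -ev_rotations_map /=.
under eq_ev => c' do rewrite -(ev_shuffles_map _ _ _ (fun z =>
  ev (rotations K (v :: z)) F)) untag.
by rewrite -(ev_rotations_map _ _ (fun c' => ev (shuffles K c' y) _)) untag.
Qed.

(** * Shuffles as sums over permutations *)

Section ShufflePermutations.

(** This is is_shuffle for a permutation of any n elements: the induction below
lowers n, and a type 'S_(p + q) would not follow it without casts. *)
Definition block_incr (p n : nat) (s : 'S_n) : bool :=
  [forall i : 'I_n, forall j : 'I_n,
     ((i < j) && ((j < p) || (p <= i)) ==> (s i < s j))%N].

Lemma block_incrP p n (s : 'S_n) : reflect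
  (forall i j : 'I_n, (i < j)%N -> (j < p)%N || (p <= i)%N -> (s i < s j)%N)
  (block_incr p s).
Proof.
apply: (iffP forallP) => [sP i j lt_ij ij_p | sP i].
  by have /forallP/(_ j) := sP i; rewrite lt_ij ij_p.
by apply/forallP => j; apply/implyP => /andP[]; exact: sP.
Qed.

(** The index with image 0 must be the first one of its block. *)
Lemma block_incr_lift p q n (i : 'I_n.+1) (s : 'S_n) :
  (forall j : 'I_n, (lift i j < p)%N = (j < q)%N) ->
  block_incr p (lift_perm i ord0 s)
  = (i \in [pred i : 'I_n.+1 | (i == 0 :> nat) || (i == p :> nat)])
    && block_incr q s.
Proof.
move=> pq.
have qp j : (p <= lift i j)%N = (q <= j)%N by rewrite leqNgt pq -leqNgt.
rewrite inE; apply/block_incrP/andP => [sP | [i0p /block_incrP sP] a b].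
  split; last first.
    apply/block_incrP => a b lt_ab ab_q; have := sP (lift i a) (lift i b).
    rewrite !lift_perm_lift !lift0 ltnS; apply;
      first by rewrite ltnNge leq_bump2 -ltnNge.
    by rewrite pq qp.
  apply/norP => -[/= i0 ip].
  have [lt_ip | le_pi] := ltnP i p.
    by have := sP ord0 i; rewrite lift_perm_id lt_ip lt0n => /(_ i0 isT).
  have lt_pi : (p < i)%N by rewrite ltn_neqAle eq_sym ip.
  have := sP (Ordinal (ltn_trans lt_pi (ltn_ord i))) i.
  by rewrite lift_perm_id /= leqnn orbT => /(_ lt_pi isT).
case: (unliftP i a) => [a'|] ->; case: (unliftP i b) => [b'|] ->.
- rewrite !lift_perm_lift !lift0 ltnS => lt_ab; rewrite pq qp.
  by apply: sP; rewrite ltnNge -(leq_bump2 i) -ltnNge.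
- move=> lt_i le_p; case/orP: i0p => /eqP i0p; first by rewrite i0p in lt_i.
  by move: lt_i le_p; rewrite i0p; lia.
- by rewrite lift_perm_id lift_perm_lift lift0.
by rewrite ltnn.
Qed.

(** The pairs (i, s) embed in the permutations of n.+1 elements, and there are
(n + 1) n! of them. *)
Lemma sum_perm_lift (R : nmodType) n (P : pred 'S_n.+1) (G : 'S_n.+1 -> R) :
  \sum_(s | P s) G s
  = \sum_i \sum_(s | P (lift_perm i ord0 s)) G (lift_perm i ord0 s).
Proof.
pose h (u : 'I_n.+1 * 'S_n) := lift_perm u.1 ord0 u.2.
have h_inj : injective h.
  move=> [i s] [j t]; rewrite /h /= => e.
  have eq_ij : i = j.
    by apply: (@perm_inj _ (lift_perm i ord0 s)); rewrite {2}e !lift_perm_id.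
  rewrite -{}eq_ij in e *; congr (_, _); apply/permP => k;
    apply: (@lift_inj _ ord0).
  by rewrite -!(lift_perm_lift i) e.
have h_bij : bijective h.
  by apply: inj_card_bij h_inj _; rewrite card_prod !card_Sn card_ord.
rewrite (reindex h) /=; last exact: onW_bij.
by rewrite pair_big_dep.
Qed.

Variables (K : fieldType) (T : Type) (W : lmodType K) (d : T).
Implicit Types (x y w : seq T) (F : seq T -> W).

Definition perm_word n (s : 'S_n) w :=
  [seq nth d w ((s^-1)%g i) | i <- enum 'I_n].

Lemma nth_bump x v y k : nth d (x ++ v :: y) (bump (size x) k) = nth d (x ++ y) k.
Proof.
rewrite !nth_cat /bump; have [le_xk|lt_kx] := leqP (size x) k.
  by rewrite ltnNge leqW //= add1n subSn.
by rewrite lt_kx.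
Qed.

Lemma perm_word_lift n (s : 'S_n) (i : 'I_n.+1) x v y : size x = i ->
  perm_word (lift_perm i ord0 s) (x ++ v :: y) = v :: perm_word s (x ++ y).
Proof.
move=> sz_x; rewrite /perm_word enum_ordSl /= lift_permV lift_perm_id.
rewrite nth_cat sz_x ltnn subnn; congr (_ :: _).
rewrite -map_comp; apply: eq_map => k /=.
by rewrite lift_perm_lift /= -sz_x nth_bump.
Qed.

(** A shuffle permutation sends to 0 the first index of the first block, or the
first index p of the second block; removing it changes the sign by (-1)^p in the
second case.  This is the recursion of shuffles. *)
Lemma sum_shuffles n x y F : n = (size x + size y)%N ->
  \sum_(s : 'S_n | block_incr (size x) s) (-1) ^+ s *: F (perm_word s (x ++ y))
  = ev (shuffles K x y) F.
Proof.
elim: n x y F => [|n IH] x y F sz_n.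
  case: x y sz_n => [|//] [|//] _; rewrite ev_shuffles0l (big_pred1 (1%g : 'S_0)).
    by rewrite odd_perm1 scale1r /perm_word enum_ord0.
  move=> s; have -> : s = 1%g by apply/permP => -[].
  by rewrite /= eqxx; apply/block_incrP => -[].
rewrite sum_perm_lift ev_shuffles_fst -?sz_n //
  (bigID (fun i : 'I_n.+1 => (i < size x)%N)) /=.
congr (_ + _).
  case: x sz_n => [|u x] sz_n /=; first by rewrite big_pred0.
  rewrite (bigD1 ord0) //= [X in _ + X]big1 ?addr0 => [|i /andP[lt_i ne_i]];
    last first.
    rewrite big1 // => s; rewrite (@block_incr_lift _ (size x)) => [|j].
      rewrite inE => /andP[/orP[]/eqP e0]; last by rewrite e0 ltnn in lt_i.
      by case/eqP: ne_i; apply: val_inj.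
    rewrite /= /bump; have : (0 < i)%N by rewrite lt0n.
    move: lt_i; lia.
  case: sz_n => sz_n; rewrite -IH //.
  apply: eq_big => s.
    by rewrite (@block_incr_lift _ (size x)).
  by rewrite -signr_odd odd_lift_perm /=
    (@perm_word_lift _ _ _ [::]) // signr_odd.
case: y sz_n => [|v y] sz_n.
  rewrite scaler0 big_pred0 // => i; apply/negbTE; rewrite negbK.
  by move: (ltn_ord i); rewrite {2}sz_n addn0.
have lt_p : (size x < n.+1)%N by rewrite sz_n addnS ltnS leq_addr.
rewrite (bigD1 (Ordinal lt_p)) /= ?ltnn //.
rewrite [X in _ + X]big1 ?addr0 => [|i /andP[le_i ne_i]]; last first.
  have {}ne_i : i != size x :> nat by apply: contraNneq ne_i => e;
    apply/eqP/val_inj.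
  rewrite big1 // => s; rewrite (@block_incr_lift _ (size x)) => [|j].
    rewrite inE (negPf ne_i) orbF => /andP[/eqP e0].
    by move: le_i ne_i; rewrite e0 -leqNgt leqn0 => /eqP->.
  by rewrite /= /bump; move: le_i ne_i; lia.
move: sz_n; rewrite addnS => -[sz_n]; rewrite -IH // scaler_sumr.
apply: eq_big => s.
  rewrite (@block_incr_lift _ (size x)) ?inE ?eqxx ?orbT // => j.
  by rewrite /= /bump; lia.
rewrite odd_lift_perm /= addbF scalerA -[in RHS](signr_odd _
  (size x)) -signr_addb.
by rewrite (@perm_word_lift _ _ _ x).
Qed.

End ShufflePermutations.

(** * Multilinear functions on words and Hochschild chains *)

Lemma mkseq_cons (T : Type) (f : nat -> T) n :
  mkseq f n.+1 = f 0%N :: mkseq (fun i => f i.+1) n.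
Proof.
rewrite /mkseq -[iota 0 n.+1]/(0%N :: iota 1 n) map_cons; congr (_ :: _).
by rewrite (iotaDl 1 0) -map_comp.
Qed.

Section Multilinear.
Variables (K : fieldType) (V W : lmodType K).

(** Words of all lengths are allowed, which dispenses with the arithmetic of
lengths; a function that is only meaningful in one length is extended by 0. *)
Definition multilinear (F : seq V -> W) :=
  forall s1 s2, linear (fun u => F (s1 ++ u :: s2)).

Lemma multilinear_cons F u : multilinear F -> multilinear (fun s => F (u :: s)).
Proof. by move=> Fl s1 s2; exact: (Fl (u :: s1)). Qed.

Lemma multilinear_head F s : multilinear F -> linear (fun u => F (u :: s)).
Proof. by move=> Fl; exact: (Fl [::]). Qed.

End Multilinear.

Section TensorPowerLift.
Variables (K : fieldType) (V : lmodType K).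

Definition scons (u : V) (v : nat -> V) (i : nat) : V :=
  if i is j.+1 then v j else u.

(** Closure under scaling is a separate case because of the power 0, where 1 is
the only pure tensor. *)
Lemma tpow_ind n (P : tpow V n -> Prop) :
  P 0 -> (forall x y, P x -> P y -> P (x + y)) ->
  (forall k x, P x -> P (k *: x)) -> (forall v, P (tpowp n v)) -> forall t, P t.
Proof.
elim: n P => [|n IH] P P0 PD PZ Pt.
  move=> k; have -> : k = (k : K) *: (1 : K^o) by rewrite [RHS]mulr1.
  by apply: PZ; exact: (Pt (fun=> 0)).
elim/tens_ind => [//|x y|u t]; first exact: PD.
elim/IH: t u => [|x y Px Py|k x Px|v] u.
- by rewrite tpure0r.
- by rewrite tpureDr; exact: PD.
- by rewrite tpureZr; exact: PZ.
exact: (Pt (scons u v)).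
Qed.

Lemma tpow_linP n (W : lmodType K) (f g : {linear tpow V n -> W}) :
  (forall v, f (tpowp n v) = g (tpowp n v)) -> f =1 g.
Proof.
move=> fg; elim/tpow_ind => [|x y fx fy|k x fx|//]; first by rewrite !linear0.
  by rewrite !linearD fx fy.
by rewrite !linearZ fx.
Qed.

Lemma tens_family (U X W : lmodType K) (G : U -> {linear X -> W}) : linear G ->
  exists g : {linear U ⊗ X -> W}, forall u x, g (u *t x) = G u x.
Proof.
move=> Gl; exists (tlift (fun u x => G u x)) => u x; rewrite tliftE //.
by split=> [y|v] k a b; rewrite ?Gl // linearP.
Qed.

Lemma tpow_lift n (W : lmodType K) (F : seq V -> W) : multilinear F ->
  exists g : {linear tpow V n -> W}, forall v, g (tpowp n v) = F (mkseq v n).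
Proof.
elim: n F => [|n IH] F Fl.
  have gl : linear (fun k : K^o => k *: F [::]).
    by move=> k x y; rewrite scalerDl scalerA.
  by exists (mklin gl) => v /=; rewrite scale1r.
pose G u := projT1 (cid (IH _ (multilinear_cons u Fl))).
have GE u v : G u (tpowp n v) = F (u :: mkseq v n).
  by rewrite /G; case: cid.
have [|g gE] := @tens_family _ _ _ G.
  move=> k u u'; apply: lin_ext; apply: tpow_linP => v /=.
  by rewrite !GE (multilinear_head _ Fl).
by exists g => v; rewrite mkseq_cons [tpowp _ _]/= gE GE.
Qed.

Lemma eq_tpowp n (v v' : nat -> V) :
  (forall i, (i < n)%N -> v i = v' i) -> tpowp n v = tpowp n v'.
Proof.
elim: n v v' => //= n IH v v' vv'; rewrite vv' //; congr (_ *t _).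
by apply: IH => i lt_i; rewrite vv'.
Qed.

Lemma tpowp_lin n i k (v v1 v2 : nat -> V) : (i < n)%N ->
  v i = k *: v1 i + v2 i -> (forall j, j != i -> v j = v1 j /\ v j = v2 j) ->
  tpowp n v = k *: tpowp n v1 + tpowp n v2.
Proof.
elim: n i v v1 v2 => // n IH [|i] v v1 v2 /= lt_i vi vj.
  rewrite vi tpurePl; congr (_ *: (_ *t _) + _ *t _); apply: eq_tpowp => j _.
    by have [] := vj j.+1 isT.
  by have [] := vj j.+1 isT.
have [<- <-] := vj 0%N isT;
  rewrite (IH i _ (fun j => v1 j.+1) (fun j => v2 j.+1)) //.
  exact: tpurePr.
by move=> j ne_j; apply: vj.
Qed.

Lemma tpowp_zero n i (v : nat -> V) : (i < n)%N -> v i = 0 -> tpowp n v = 0.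
Proof.
elim: n i v => // n IH [|i] v /= lt_i vi; first by rewrite vi tpure0l.
by rewrite (IH i) ?tpure0r.
Qed.

End TensorPowerLift.

Section WordChains.
Variables (K : fieldType) (A : calg K).
Implicit Types (W : lmodType K) (s : seq A).

Lemma eq_chain n (a a' : nat -> A) :
  (forall i, (i <= n)%N -> a i = a' i) -> chain n a = chain n a'.
Proof.
move=> aa'; rewrite /chain aa' //; congr (_ *t _); apply: eq_tpowp => i lt_i.
by rewrite aa'.
Qed.

Lemma chain_lin n i k (v v1 v2 : nat -> A) : (i <= n)%N ->
  v i = k *: v1 i + v2 i -> (forall j, j != i -> v j = v1 j /\ v j = v2 j) ->
  chain n v = k *: chain n v1 + chain n v2.
Proof.
case: i => [|i] le_i vi vj; rewrite /chain.
  rewrite vi tpurePl; congr (_ *: (_ *t _) + _ *t _); apply: eq_tpowp => j _.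
    by have [->] := vj j.+1 isT.
  by have [_ ->] := vj j.+1 isT.
have [<- <-] := vj 0%N isT.
rewrite (@tpowp_lin _ _ n i k _ (fun j => qclass _ (v1 j.+1))
  (fun j => qclass _ (v2 j.+1))) ?vi ?linearP //; first exact: tpurePr.
by move=> j ne_j; have [e1 e2] := vj j.+1 ne_j; rewrite {1}e1 e2.
Qed.

Lemma chain_degenerate n i (v : nat -> A) : (i < n)%N -> v i.+1 = calg1 A ->
  chain n v = 0.
Proof.
move=> lt_i vi; rewrite /chain (tpowp_zero lt_i) ?tpure0r // vi.
rewrite -(linear0 (qclass (Defs.span (fun a : A => a = calg1 A)))).
by apply/qclass_eq; rewrite subr0; apply: mem_span.
Qed.

(** The chain of a word, in the degree given by its length.  Its values lie in
the sum of all degrees, so that words whose lengths are only provably equal can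
be compared without casts. *)
Definition word_chain s : chains A :=
  if s is [::] then 0
  else dinj (V := hoch A) (i := (size s).-1) (chain _ (nth 0 s)).

Arguments word_chain : simpl never.

Lemma word_chainE n s :
  size s = n.+1 -> word_chain s = dinj (V := hoch A) (chain n (nth 0 s)).
Proof. by case: s => //= u s [<-]. Qed.

Lemma dinj_chain n a : dinj (V := hoch A) (chain n a) = word_chain (mkseq a n.+1).
Proof.
rewrite (@word_chainE n) ?size_mkseq //; congr dinj; apply: eq_chain => i le_i.
by rewrite nth_mkseq.
Qed.

Lemma word_chain_multilinear : multilinear word_chain.
Proof.
move=> s1 s2 k u v; pose n := (size s1 + size s2)%N.
have sz w : size (s1 ++ w :: s2) = n.+1 by rewrite size_cat addnS.
rewrite !(word_chainE (sz _)) -linearP; congr dinj.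
apply: (@chain_lin _ (size s1)); first exact: leq_addr.
  by rewrite !nth_cat ltnn subnn.
move=> j; rewrite !nth_cat; case: ltngtP => // lt_j _.
by case: (j - size s1)%N (subn_gt0 (size s1) j) => //; rewrite lt_j.
Qed.

Lemma word_chain_normalized : normalized word_chain.
Proof.
move=> a s1 s2; pose n := (size s1 + (size s2).+1)%N.
rewrite (@word_chainE n) ?(@chain_degenerate n (size s1)) ?linear0 //=.
- by rewrite /n addnS ltnS leq_addr.
- by rewrite nth_cat ltnn subnn.
by rewrite size_cat.
Qed.

Lemma word_chain_at n s :
  word_chain s n = if size s == n.+1 then chain n (nth 0 s) else 0.
Proof.
case: eqP => [/word_chainE-> /=|]; first by rewrite dcast_id.
case: s => [//|u s] /= ne; rewrite dcast_neq //; apply/eqP => e.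
by case: ne; rewrite e.
Qed.

(** The changes of a letter that do not affect F form a subspace, which
contains 1. *)
Lemma normalized_qclass W (F : seq A -> W) s1 s2 x y : multilinear F ->
  (forall s1 s2, F (s1 ++ calg1 A :: s2) = 0) ->
  qclass (Defs.span (fun a : A => a = calg1 A)) x = qclass _ y ->
  F (s1 ++ x :: s2) = F (s1 ++ y :: s2).
Proof.
move=> Fl F0 /qclass_eq sxy; pose f := mklin (Fl s1 s2).
suff : f (x - y) = 0 by rewrite linearB => /eqP; rewrite subr_eq0 => /eqP.
pose S0 z := f z = 0.
have S00 : S0 0 by rewrite /S0 linear0.
have S0P k u v : S0 u -> S0 v -> S0 (k *: u + v).
  by rewrite /S0 linearP => -> ->; rewrite scaler0 addr0.
by apply: (sxy (Subspace S00 S0P)) => e ->; exact: F0.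
Qed.

Lemma abar_lift n W (F : seq A -> W) : multilinear F ->
  (forall s1 s2, F (s1 ++ calg1 A :: s2) = 0) ->
  exists g : {linear tpow (abar A) n -> W},
    forall a, g (tpowp n (fun i => qclass _ (a i))) = F (mkseq a n).
Proof.
move=> Fl F0; pose lft (s : seq (abar A)) := map repr s.
have lftE s1 s2 s :
    F (s1 ++ lft (map (@qclass _ _ _ : A -> abar A) s) ++ s2) = F (s1 ++ s ++ s2).
  elim: s s1 => //= u s IH s1.
  rewrite (normalized_qclass _ _ Fl F0 (qclass_repr _)).
  by rewrite -!cat_rcons IH.
have [|g gE] := @tpow_lift _ (abar A) n _ (fun t => F (lft t)).
  move=> s1 s2 k q r; rewrite /lft !map_cat /=.
  have := Fl (lft s1) (lft s2) k (repr q) (repr r) => <-.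
  apply: (normalized_qclass _ _ Fl F0).
  by rewrite qclassD qclassZ !qclass_repr.
exists g => a; rewrite gE.
have := lftE [::] [::] (mkseq a n); rewrite /= !cats0 => <-.
by congr (F _); rewrite /lft /mkseq -!map_comp.
Qed.

Lemma hoch_ind n (P : hoch A n -> Prop) :
  P 0 -> (forall x y, P x -> P y -> P (x + y)) ->
  (forall a, P (chain n a)) -> forall h, P h.
Proof.
move=> P0 PD Pc; elim/tens_ind => [//|x y|u t]; first exact: PD.
elim/tpow_ind: t u => [|x y Px Py|k x Px|v] u.
- by rewrite tpure0r.
- by rewrite tpureDr; exact: PD.
- by rewrite tpureZr -tpureZl.
have -> : tpowp n v = tpowp n (fun i => qclass _ (repr (v i))).
  by apply: eq_tpowp => i _; rewrite qclass_repr.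
exact: (Pc (scons u (fun i => repr (v i)))).
Qed.

Lemma hoch_linP n W (f g : {linear hoch A n -> W}) :
  (forall a, f (chain n a) = g (chain n a)) -> f =1 g.
Proof.
move=> fg; elim/hoch_ind => [|x y fx fy|//]; first by rewrite !linear0.
by rewrite !linearD fx fy.
Qed.

(** This is how the prescriptions that define the operators on hoch are shown to
be compatible. *)
Lemma hoch_lift n W (F : seq A -> W) : multilinear F -> normalized F ->
  exists g : {linear hoch A n -> W}, forall a, g (chain n a) = F (mkseq a n.+1).
Proof.
move=> Fl F0.
pose G u := projT1 (cid (@abar_lift n _ _ (multilinear_cons u Fl) (F0 u))).
have GE u a : G u (tpowp n (fun i => qclass _ (a i))) = F (u :: mkseq a n).
  by rewrite /G; case: cid.
have [|g gE] := @tens_family _ _ _ _ G.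
  move=> k u u'; apply: lin_ext; apply: tpow_linP => v /=.
  have -> : tpowp n v = tpowp n (fun i => qclass _ (repr (v i))).
    by apply: eq_tpowp => i _; rewrite qclass_repr.
  by rewrite !GE (multilinear_head _ Fl).
by exists g => a; rewrite mkseq_cons /chain gE GE.
Qed.

Lemma chains_ind (P : chains A -> Prop) :
  P 0 -> (forall x y, P x -> P y -> P (x + y)) ->
  (forall a s, P (word_chain (a :: s))) -> forall z, P z.
Proof.
move=> P0 PD Pc; elim/dsum_ind => [//|x y|n h]; first exact: PD.
elim/hoch_ind: h => [|x y Px Py|a]; first by rewrite linear0.
  by rewrite linearD; exact: PD.
by rewrite dinj_chain; exact: Pc.
Qed.

End WordChains.
Arguments word_chain : simpl never.

(** * Operators that preserve multilinear functions *)

(** A rotation moves a letter to a place that depends on lengths only. *)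
Lemma rot_letter (T : Type) k (s1 s2 : seq T) :
  exists t1 t2, forall u, rot k (s1 ++ u :: s2) = t1 ++ u :: t2.
Proof.
have [le_k|lt_k] := leqP k (size s1).
  exists (drop k s1), (s2 ++ take k s1) => u; rewrite /rot drop_cat take_cat.
  move: le_k; rewrite leq_eqVlt => /orP[/eqP->|->]; last by rewrite -catA.
  by rewrite ltnn subnn drop0 take0 drop_size take_size cats0.
exists (drop (k - size s1).-1 s2 ++ s1), (take (k - size s1).-1 s2) => u.
rewrite /rot drop_cat take_cat ltnNge (ltnW lt_k) /=.
by case: (k - size s1)%N (subn_gt0 (size s1) k) => [|m]; rewrite ?lt_k //= -catA.
Qed.

Section Slots.
Variables (K : fieldType) (V W : lmodType K) (P : (V -> W) -> Prop).
Hypothesis P0 : P (fun=> 0).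
Hypothesis PD : forall k f g, P f -> P g -> P (fun u => k *: f u + g u).

(** Linearity in a letter and vanishing at the letter 1 are both preserved by
shuffles, and for the same reason: each is a property P of functions of one
letter that is stable under linear combinations. *)
Definition slotwise (F : seq V -> W) :=
  forall s1 s2, P (fun u => F (s1 ++ u :: s2)).

Lemma slot_sum I (r : seq I) (c : I -> K) (f : I -> V -> W) :
  (forall i, P (f i)) -> P (fun u => \sum_(i <- r) c i *: f i u).
Proof.
move=> Pf; elim: r => [|i r IH].
  suff -> : (fun u => \sum_(i <- [::]) c i *: f i u) = (fun=> 0) by [].
  by apply: functional_extensionality_dep => u; rewrite big_nil.
suff -> : (fun u => \sum_(j <- i :: r) c j *: f j u) =
          (fun u => c i *: f i u + \sum_(i <- r) c i *: f i u) by apply: PD.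
by apply: functional_extensionality_dep => u; rewrite big_cons.
Qed.

Lemma slot_ev (T : Type) (l : seq (K * seq T)) (f : V -> seq T -> W) :
  (forall z, P (fun u => f u z)) -> P (fun u => ev l (f u)).
Proof. by move=> Pf; exact: (slot_sum l (fun p => p.1) (fun p => Pf p.2)). Qed.

Lemma slotP2 k f g h : P f -> P g -> (forall u, h u = f u + k *: g u) -> P h.
Proof.
move=> Pf Pg hE; suff -> : h = (fun u => k *: g u + f u) by apply: PD.
by apply: functional_extensionality_dep => u; rewrite hE addrC.
Qed.

Lemma slot_shuffles_l F y :
  slotwise F -> slotwise (fun x => ev (shuffles K x y) F).
Proof.
move=> PF s1 s2; have [n] := ubnP (size s1 + size s2 + size y).
elim: n => // n IH in F PF s1 s2 y * => lt_n.
have PF' w : slotwise (fun z => F (w :: z)).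
  by move=> t1 t2; exact: (PF (w :: t1)).
case: y lt_n => [|v y] lt_n.
  suff -> : (fun u => ev (shuffles K (s1 ++ u :: s2) [::]) F)
    = (fun u => F (s1 ++ u :: s2)).
    exact: PF.
  by apply: functional_extensionality_dep => u; rewrite ev_shuffles0r.
case: s1 lt_n => [|w s1] lt_n.
  apply: (@slotP2 ((-1) ^+ (size s2).+1)
    (fun u => ev (shuffles K s2 (v :: y)) (fun z => F (u :: z)))
    (fun u => ev (shuffles K (u :: s2) y) (fun z => F (v :: z)))) => [||u].
  - by apply: slot_ev => z; exact: (PF [::]).
  - by apply: (IH _ (PF' v) [::]); move: lt_n; rewrite /=; lia.
  exact: ev_shuffles_cons.
apply: (@slotP2 ((-1) ^+ (size s1 + (size s2).+1).+1)
  (fun u => ev (shuffles K (s1 ++ u :: s2) (v :: y)) (fun z => F (w :: z)))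
  (fun u => ev (shuffles K ((w :: s1) ++ u :: s2) y) (fun z => F (v :: z)))) =>
    [||u].
- by apply: (IH _ (PF' w)); move: lt_n; rewrite /=; lia.
- by apply: (IH _ (PF' v)); move: lt_n; rewrite /=; lia.
by rewrite ev_shuffles_cons size_cat.
Qed.

Lemma slot_shuffles_r F x :
  slotwise F -> slotwise (fun y => ev (shuffles K x y) F).
Proof.
move=> PF s1 s2; have [n] := ubnP (size s1 + size s2 + size x).
elim: n => // n IH in F PF s1 s2 x * => lt_n.
have PF' w : slotwise (fun z => F (w :: z)).
  by move=> t1 t2; exact: (PF (w :: t1)).
case: x lt_n => [|v x] lt_n.
  suff -> : (fun u => ev (shuffles K [::] (s1 ++ u :: s2)) F)
    = (fun u => F (s1 ++ u :: s2)).
    exact: PF.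
  by apply: functional_extensionality_dep => u; rewrite ev_shuffles0l.
case: s1 lt_n => [|w s1] lt_n.
  apply: (@slotP2 ((-1) ^+ (size x).+1)
    (fun u => ev (shuffles K x (u :: s2)) (fun z => F (v :: z)))
    (fun u => ev (shuffles K (v :: x) s2) (fun z => F (u :: z)))) => [||u].
  - by apply: (IH _ (PF' v) [::]); move: lt_n; rewrite /=; lia.
  - by apply: slot_ev => z; exact: (PF [::]).
  exact: ev_shuffles_cons.
apply: (@slotP2 ((-1) ^+ (size x).+1)
  (fun u => ev (shuffles K x ((w :: s1) ++ u :: s2)) (fun z => F (v :: z)))
  (fun u => ev (shuffles K (v :: x) (s1 ++ u :: s2)) (fun z => F (w :: z)))) =>
    [||u].
- by apply: (IH _ (PF' v)); move: lt_n; rewrite /=; lia.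
- by apply: (IH _ (PF' w)); move: lt_n; rewrite /=; lia.
exact: ev_shuffles_cons.
Qed.

End Slots.

Section Operators.
Variables (K : fieldType) (A : calg K) (W : lmodType K).
Implicit Types (F : seq A -> W).

Lemma linear_0fun : linear (fun _ : A => 0 : W).
Proof. by move=> k u v; rewrite scaler0 addr0. Qed.

Lemma linear_combfun k (f g : A -> W) : linear f -> linear g ->
  linear (fun u => k *: f u + g u).
Proof.
move=> fl gl c u v; rewrite fl gl !scalerDr !scalerA [k * c]mulrC.
by rewrite -!addrA; congr (_ + _); rewrite addrCA.
Qed.

Lemma kill_combfun (a : A) k (f g : A -> W) : f a = 0 -> g a = 0 ->
  k *: f a + g a = 0.
Proof. by move=> -> ->; rewrite scaler0 addr0. Qed.

Lemma multilinear_rot k F : multilinear F -> multilinear (fun s => F (rot k s)).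
Proof.
move=> Fl s1 s2 c u v; have [t1 [t2 tE]] := rot_letter k s1 s2.
by rewrite !tE Fl.
Qed.

Lemma multilinear_rotr k F : multilinear F -> multilinear (fun s => F (rotr k s)).
Proof.
move=> Fl s1 s2 c u v; rewrite /rotr !size_cat /=.
exact: (multilinear_rot _ Fl).
Qed.

(** On words of length at most one, mul_head is the identity: a constant value
would not be linear in the letter. *)
Lemma multilinear_mul_head F :
  multilinear F -> multilinear (fun s => F (mul_head s)).
Proof.
move=> Fl [|w [|w' s1]] s2 c u v /=; have [ml mr] := nu_mulP A.
- case: s2 => [|w s2] /=; first exact: (Fl [::]).
  by rewrite (ml w); exact: (Fl [::]).
- by rewrite (mr w); exact: (Fl [::]).
exact: (Fl (_ :: s1)).
Qed.

Lemma multilinear_sum I (r : seq I) (c : I -> K) (F : I -> seq A -> W) :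
  (forall i, multilinear (F i)) ->
    multilinear (fun s => \sum_(i <- r) c i *: F i s).
Proof.
move=> Fl s1 s2.
apply: (slot_sum linear_0fun linear_combfun r c (f := fun i u =>
  F i (s1 ++ u :: s2))).
by move=> i; exact: Fl.
Qed.

Lemma multilinear_word_b F :
  multilinear F -> multilinear (fun s => ev (word_b s) F).
Proof.
move=> Fl s1 s2 c u v.
have [gt1|le1] := ltnP 1 (size s1 + (size s2).+1); last first.
  case: s1 s2 le1 => [|? [|? ?]] [|? ?] //= _.
  by rewrite !ev_nil scaler0 addr0.
have sz w : size (s1 ++ w :: s2) = (size s1 + (size s2).+1)%N by rewrite size_cat.
rewrite !ev_word_b_rot ?sz // -!(big_mkord xpredT (fun i =>
  (-1) ^+ i *: F (rotr i (mul_head (rot i _))))).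
apply: (@multilinear_sum _ _ (fun i : nat => (-1) ^+ i)
  (fun i s => F (rotr i (mul_head (rot i s))))) => i.
by apply: (multilinear_rot i (F := fun s => F (rotr i (mul_head s))));
   apply: (multilinear_mul_head (F := fun s => F (rotr i s)));
     apply: multilinear_rotr.
Qed.

Lemma multilinear_rotations F :
  multilinear F -> multilinear (fun s => ev (rotations K s) F).
Proof.
move=> Fl s1 s2 c u v.
have sz w : size (s1 ++ w :: s2) = (size s1 + (size s2).+1)%N by rewrite size_cat.
rewrite !ev_rotations !sz.
apply: (@multilinear_sum _ _ (fun i : 'I__ => (-1) ^+ (_ * i))
  (fun i s => F (rot i s))) => i.
exact: multilinear_rot.
Qed.

(** The letter 1 in front makes any other letter 1 degenerate, even when it
was first before the rotation. *)
Lemma rotations_normalized F : normalized F ->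
  forall s1 s2, ev (rotations K (s1 ++ calg1 A :: s2)) (fun z =>
    F (calg1 A :: z)) = 0.
Proof.
move=> F0 s1 s2; rewrite ev_rotations big1 // => i _.
have [t1 [t2 ->]] := rot_letter i s1 s2.
by rewrite F0 scaler0.
Qed.

(** The shuffle product of words whose first letters are coefficients. *)
Definition word_shuffle (x y : seq A) : seq (K * seq A) :=
  if x is a :: x' then
    if y is b :: y' then lcons 1 (a ∙ b) (shuffles K x' y') else [::]
  else [::].

Lemma ev_word_shuffle a b x y F :
  ev (word_shuffle (a :: x) (b :: y)) F
    = ev (shuffles K x y) (fun z => F (a ∙ b :: z)).
Proof. by rewrite ev_lcons scale1r. Qed.

Lemma multilinear_word_shuffle_l y F :
  multilinear F -> multilinear (fun x => ev (word_shuffle x y) F).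
Proof.
move=> Fl; case: y => [|b y] s1 s2.
  by move=> k u v; case: s1 => [|? ?]; rewrite !ev_nil scaler0 addr0.
case: s1 => [|a s1].
  move=> k u v; rewrite /= !ev_word_shuffle -evZ -evD; apply: eq_ev => z.
  by rewrite (nu_mulP A).1; exact: (Fl [::]).
move=> k u v; rewrite /= !ev_word_shuffle.
apply: (slot_shuffles_l linear_0fun linear_combfun (F := fun z =>
  F (a ∙ b :: z))).
exact: multilinear_cons.
Qed.

Lemma multilinear_word_shuffle_r x F :
  multilinear F -> multilinear (fun y => ev (word_shuffle x y) F).
Proof.
move=> Fl; case: x => [|a x] s1 s2.
  by move=> k u v; rewrite !ev_nil scaler0 addr0.
case: s1 => [|b s1].
  move=> k u v; rewrite /= !ev_word_shuffle -evZ -evD; apply: eq_ev => z.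
  by rewrite (nu_mulP A).2; exact: (Fl [::]).
move=> k u v; rewrite /= !ev_word_shuffle.
apply: (slot_shuffles_r linear_0fun linear_combfun (F := fun z =>
  F (a ∙ b :: z))).
exact: multilinear_cons.
Qed.

Lemma normalized_word_shuffle_l y F :
  normalized F -> normalized (fun x => ev (word_shuffle x y) F).
Proof.
move=> F0 a s1 s2; case: y => [|b y]; first by rewrite ev_nil.
rewrite ev_word_shuffle.
by apply: (slot_shuffles_l (P := fun f => f (calg1 A) = 0) _
  (kill_combfun (a := calg1 A))
  (F := fun z => F (a ∙ b :: z))) => // t1 t2; exact: F0.
Qed.

Lemma normalized_word_shuffle_r x F :
  normalized F -> normalized (fun y => ev (word_shuffle x y) F).
Proof.
move=> F0 b s1 s2; case: x => [|a x]; first by rewrite ev_nil.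
rewrite ev_word_shuffle.
by apply: (slot_shuffles_r (P := fun f => f (calg1 A) = 0) _
  (kill_combfun (a := calg1 A))
  (F := fun z => F (a ∙ b :: z))) => // t1 t2; exact: F0.
Qed.

End Operators.

(** * Boundary, Connes operator and shuffle product on words *)

Lemma nth_rot (T : Type) (d : T) i s j : (i <= size s)%N -> (j < size s)%N ->
  nth d (rot i s) j = nth d s ((i + j) %% size s).
Proof.
move=> le_i lt_j; rewrite /rot nth_cat size_drop nth_drop.
have [lt_js|le_sj] := ltnP j (size s - i)%N.
  by rewrite modn_small // -ltn_subRL.
have le_s : (size s <= i + j)%N by rewrite -leq_subLR.
rewrite nth_take; last by rewrite ltn_subLR // subnK.
congr (nth d s _); rewrite -[X in (X %% _)%N](subnK le_s) modnDr modn_small.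
  by rewrite subnBA // addnC.
by rewrite ltn_subLR // -addnS leq_add.
Qed.

Section OperatorsOnWords.
Variables (K : fieldType) (A : calg K).
Implicit Types (W : lmodType K) (s : seq A).

Lemma multilinear_at n : multilinear (fun s => word_chain s n : hoch A n).
Proof.
move=> s1 s2 k u v.
exact: (congr1 (fun z : chains A => z n) (word_chain_multilinear s1 s2 k u v)).
Qed.

Lemma normalized_at n : normalized (fun s => word_chain s n : hoch A n).
Proof. by move=> a s1 s2; rewrite word_chain_normalized. Qed.

Lemma dinj_word_chain n s : size s = n.+1 ->
  dinj (word_chain s n : hoch A n) = word_chain s.
Proof. by move=> sz; rewrite word_chain_at sz eqxx -word_chainE. Qed.

Lemma word_chain_eq n s (a : nat -> A) : size s = n.+1 ->
  (forall i, (i <= n)%N -> nth 0 s i = a i) ->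
  word_chain s n = chain n a :> hoch A n.
Proof. by move=> sz sa; rewrite word_chain_at sz eqxx; apply: eq_chain. Qed.

Lemma nth_contract i s j :
  (i.+1 < size s)%N -> nth 0 (contract i s) j = face i (nth 0 s) j.
Proof.
elim: i s j => [|i IH] [|u [|v s]] j //= lt_i; first by case: j.
case: j => [|j] //=; rewrite IH // /face ltnS eqSS.
Qed.

(** The defining prescription is compatible since word_b preserves the functions
on words that are multilinear and normalized. *)
Lemma hoch_bE n (a : nat -> A) :
  hoch_b A n (chain n.+1 a)
    = ev (word_b (mkseq a n.+2)) (fun z => word_chain z n : hoch A n).
Proof.
set s := mkseq a n.+2; have sz_s : size s = n.+2 by rewrite size_mkseq.
have nth_s i : (i <= n.+1)%N -> nth 0 s i = a i by move=> le_i; rewrite nth_mkseq.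
have [g gE] := @hoch_lift _ A n.+1 _ _
  (multilinear_word_b (@multilinear_at n)) (ev_word_b_degenerate
    (@normalized_at n)).
have formula b : \sum_(i < n.+1) (-1) ^+ i *: chain n (face i b)
     + (-1) ^+ n.+1 *: chain n (last_face n.+1 b)
   = ev (word_b (mkseq b n.+2)) (fun z => word_chain z n : hoch A n).
  have nth_t i : (i <= n.+1)%N -> nth 0 (mkseq b n.+2) i = b i.
    by move=> le_i; rewrite nth_mkseq.
  move: (mkseq _ _) (size_mkseq b n.+2) nth_t => t sz_t nth_t.
  rewrite ev_cat; congr (_ + _).
    rewrite /ev big_map sz_t -[X in iota 0 X]subn0 -/(index_iota 0 _) big_mkord.
    apply: eq_bigr => i _; have lt_i : (i.+1 < size t)%N by rewrite sz_t ltnS.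
    rewrite (word_chain_eq (n := n)
      (a := face i b)) ?size_contract ?lt_i ?sz_t // => j le_j.
    rewrite nth_contract // /face; have := ltn_ord i; rewrite ltnS => le_i.
    by case: ifP => _; [|case: ifP => _]; rewrite !nth_t // ltnW.
  case: t sz_t nth_t => [|u [|v t]] //= [sz_t] nth_t.
  rewrite /ev big_seq1 [_.1]/= [_.2]/= sz_t; congr (_ *: _); symmetry;
    apply: word_chain_eq.
    by rewrite /= size_belast sz_t.
  move=> [|j] le_j; rewrite /last_face /=.
    rewrite -(nth_t 0%N) // -(nth_t n.+1) //; congr (_ ∙ _).
    by rewrite (last_nth 0) sz_t.
  rewrite -nth_t; last by rewrite ltnW.
  rewrite [RHS]/= lastI nth_rcons size_belast sz_t.
  by rewrite le_j.
rewrite /hoch_b inducedE ?formula //.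
by exists g => b; rewrite gE formula.
Qed.

Lemma connesBE n (a : nat -> A) :
  connesB A n (chain n a)
  = ev (rotations K (mkseq a n.+1)) (fun z => word_chain (calg1 A :: z) n.+1 :
    hoch A n.+1).
Proof.
have [g gE] := @hoch_lift _ A n _ _
  (multilinear_rotations (multilinear_cons (calg1 A) (@multilinear_at n.+1)))
  (fun a s1 s2 => rotations_normalized (@normalized_at n.+1) (a :: s1) s2).
have formula b : \sum_(i < n.+1) (-1) ^+ (n * i) *:
    chain n.+1 (fun j => if j is k.+1 then b ((i + k) %% n.+1)%N else calg1 A)
  = ev (rotations K (mkseq b n.+1)) (fun z => word_chain (calg1 A :: z) n.+1 :
    hoch A n.+1).
  rewrite ev_rotations size_mkseq; apply: eq_bigr => i _; congr (_ *: _).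
  symmetry; apply: word_chain_eq => [|[|j] le_j //=];
    first by rewrite /= size_rot size_mkseq.
  rewrite nth_rot size_mkseq // 1?ltnW //.
  by rewrite nth_mkseq // ltn_mod.
rewrite /connesB inducedE ?formula //.
by exists g => b; rewrite gE formula.
Qed.

Lemma hoch_lift2 p q W (F : seq A -> seq A -> W) :
  (forall y, multilinear (F^~ y)) -> (forall y, normalized (F^~ y)) ->
  (forall x, multilinear (F x)) -> (forall x, normalized (F x)) ->
  exists g : {linear hoch A p ⊗ hoch A q -> W},
    forall a b, g (chain p a *t chain q b) = F (mkseq a p.+1) (mkseq b q.+1).
Proof.
move=> ll ln rl rn.
pose G x := projT1 (cid (@hoch_lift _ A q _ _ (rl x) (rn x))).
have GE x b : G x (chain q b) = F x (mkseq b q.+1) by rewrite /G; case: cid.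
have [||h hE] := @hoch_lift _ A p _ G.
- move=> s1 s2 k u v; apply: lin_ext; apply: hoch_linP => b /=.
  by rewrite !GE ll.
- by move=> a s1 s2; apply: lin_ext; apply: hoch_linP => b /=; rewrite !GE ln.
have [|g gE] := @tens_family _ _ _ _ h; first by move=> k u v; rewrite linearP.
by exists g => a b; rewrite gE hE GE.
Qed.

(** The sum over shuffle permutations is rewritten by sum_shuffles; then the
prescription is compatible in each of the two arguments. *)
Lemma shuffleE p q (a b : nat -> A) :
  shuffle A p q (chain p a *t chain q b)
  = ev (word_shuffle (mkseq a p.+1) (mkseq b q.+1)) (fun z =>
    word_chain z (p + q)%N : hoch A (p + q)).
Proof.
have [|||| g gE] := @hoch_lift2 p q _
  (fun x y => ev (word_shuffle x y) (fun z => word_chain z (p + q)%N :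
    hoch A (p + q))).
- by move=> y; apply: multilinear_word_shuffle_l; exact: multilinear_at.
- by move=> y; apply: normalized_word_shuffle_l; exact: normalized_at.
- by move=> y; apply: multilinear_word_shuffle_r; exact: multilinear_at.
- by move=> y; apply: normalized_word_shuffle_r; exact: normalized_at.
have formula (c d : nat -> A) : \sum_(s : 'S_(p + q) | is_shuffle s)
       (-1) ^+ s *: chain (p + q) (perm_chain s (join_chain p c d))
  = ev (word_shuffle (mkseq c p.+1) (mkseq d q.+1)) (fun z =>
    word_chain z (p + q)%N : hoch A (p + q)).
  rewrite !mkseq_cons ev_word_shuffle.
  set x := mkseq _ p; set y := mkseq _ q.
  have sz_x : size x = p by rewrite size_mkseq.
  have sz_y : size y = q by rewrite size_mkseq.
  rewrite -(@sum_shuffles K _ _ 0 (p + q)%N) ?sz_x ?sz_y //.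
  apply: eq_bigr => s _; congr (_ *: _); symmetry;
    apply: word_chain_eq => [|[|j] le_j //=].
    by rewrite /= size_map size_enum_ord.
  rewrite insubT (nth_map (Ordinal le_j)) ?size_enum_ord //=.
  rewrite (_ : nth _ _ _ = Ordinal le_j); last first.
    by apply: val_inj; rewrite /= nth_enum_ord.
  rewrite nth_cat sz_x /join_chain /=.
  set i := (s^-1)%g _; case: ifP => lt_i; first by rewrite nth_mkseq.
  rewrite subSn 1?leqNgt ?lt_i // nth_mkseq //.
  by have := ltn_ord i; move: lt_i; lia.
rewrite /shuffle; set gen := fun ab : _ * _ => _.
rewrite (@inducedE _ _ _ _ gen _ _ (a, b)) /= ?formula //.
by exists g => -[c d]; rewrite /gen gE /= formula.
Qed.

End OperatorsOnWords.

(** * The identities of the mixed complex *)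

Section Lifts.
Variable K : fieldType.

Lemma dsum_linP (I : eqType) (V : I -> lmodType K) (W : lmodType K)
  (f g : {linear dsum V -> W}) :
  (forall i v, f (dinj (i := i) v) = g (dinj v)) -> f =1 g.
Proof.
move=> fg; elim/dsum_ind => [|x y fx fy|//]; first by rewrite !linear0.
by rewrite !linearD fx fy.
Qed.

Lemma dsum_lift2 (I J : eqType) (V : I -> lmodType K) (U : J -> lmodType K)
  (W : lmodType K) (f : forall i j, {linear V i -> {linear U j -> W}}) :
  exists g : {linear dsum V -> {linear dsum U -> W}},
    forall i j v u, g (dinj (i := i) v) (dinj (i := j) u) = f i j v u.
Proof.
pose h i v := projT1 (cid (dsum_lift (fun j => f i j v))).
have hE i v j u : h i v (dinj (i := j) u) = f i j v u by rewrite /h; case: cid.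
have hl i : linear (h i).
  move=> k v v'; apply: lin_ext; apply: dsum_linP => j u /=.
  by rewrite !hE linearP.
have [g gE] := dsum_lift (fun i => mklin (hl i)).
by exists g => i j v u; rewrite gE hE.
Qed.

Lemma quo_tens_lift (V U W : lmodType K) (S : subspace V) (T : subspace U)
  (f : V -> U -> W) : bilin f ->
  (forall v u, S v -> f v u = 0) -> (forall v u, T u -> f v u = 0) ->
  exists g : {linear quomod S ⊗ quomod T -> W},
    forall v u, g (qclass S v *t qclass T u) = f v u.
Proof.
move=> [fl fr] fS fT.
have frep v u : f (repr (qclass S v)) (repr (qclass T u)) = f v u.
  have -> : repr (qclass S v)
    = v + (repr (qclass S v) - v) by rewrite addrC subrK.
  have -> : repr (qclass T u)
    = u + (repr (qclass T u) - u) by rewrite addrC subrK.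
  set dv := _ - v; set du := _ - u.
  have Sdv : S dv by apply/qclass_eq; rewrite qclass_repr.
  have Tdu : T du by apply/qclass_eq; rewrite qclass_repr.
  have := fl (u + du) 1 v dv; have := fr v 1 u du; rewrite !scale1r => -> ->.
  by rewrite (fS dv) // (fT v du) // !addr0.
exists (tlift (fun (q : quomod S) (r : quomod T) => f (repr q) (repr r))) => v u.
rewrite tliftE ?frep //; split=> [r|q] k x y /=.
  rewrite -[x]qclass_repr -[y]qclass_repr -[r]qclass_repr.
  by rewrite -linearP /= !frep fl.
rewrite -[x]qclass_repr -[y]qclass_repr -[q]qclass_repr.
by rewrite -linearP /= !frep fr.
Qed.

End Lifts.

Lemma evalat_linear (K : fieldType) (U V : lmodType K) (u : U) :
  linear (fun f : {linear U -> V} => f u).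
Proof. by []. Qed.

(** Evaluation at u is linear. *)
Lemma ev_fun (K : fieldType) (T : Type) (U V : lmodType K) (l : seq (K * seq T))
  (F : seq T -> {linear U -> V}) u : ev l F u = ev l (fun z => F z u).
Proof. exact: (ev_lin (mklin (@evalat_linear K U V u)) l F). Qed.

Section ChainOperators.
Variables (K : fieldType) (A : calg K).
Implicit Types (W : lmodType K) (s : seq A).
Local Notation dinj := (dinj (V := hoch A)).

Definition chain_b_at n : {linear hoch A n -> chains A} :=
  match n with 0 => 0 | m.+1 => @Defs.dinj _ _ (hoch A) m \o hoch_b A m end.

(** b, B and the shuffle product on the sum of all degrees: on words they need
no casts between degrees. *)
Definition chain_b : {linear chains A -> chains A} :=
  projT1 (cid (dsum_lift chain_b_at)).

Definition chain_B : {linear chains A -> chains A} :=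
  projT1 (cid (dsum_lift
    (fun n => @Defs.dinj _ _ (hoch A) n.+1 \o connesB A n :
      {linear hoch A n -> chains A}))).

Definition chain_shuffle : {linear chains A -> {linear chains A -> chains A}} :=
  projT1 (cid (dsum_lift2 (fun p q =>
    tcurry (@Defs.dinj _ _ (hoch A) (p + q)%N \o shuffle A p q)))).

Lemma chain_b0 (h : hoch A 0) : chain_b (dinj h) = 0.
Proof. by rewrite /chain_b; case: cid => f /= ->. Qed.

Lemma chain_bS n (h : hoch A n.+1) : chain_b (dinj h) = dinj (hoch_b A n h).
Proof. by rewrite /chain_b; case: cid => f /= ->. Qed.

Lemma chain_BE n (h : hoch A n) : chain_B (dinj h) = dinj (connesB A n h).
Proof. by rewrite /chain_B; case: cid => f /= ->. Qed.

Lemma chain_shuffleE p q (h : hoch A p) (k : hoch A q) :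
  chain_shuffle (dinj h) (dinj k) = dinj (shuffle A p q (h *t k)).
Proof. by rewrite /chain_shuffle; case: cid => f /= ->. Qed.

Lemma mkseq_nth_size n s : size s = n -> mkseq (nth 0 s) n = s.
Proof. by move=> <-; exact: mkseq_nth. Qed.

Lemma eq_ev_word_b W s (F G : seq A -> W) :
  (forall z, size s = (size z).+1 -> F z = G z) -> ev (word_b s) F
    = ev (word_b s) G.
Proof.
move=> FG; case: s FG => [|a x] FG; first by rewrite !ev_nil.
rewrite !ev_word_b_cons; congr (_ + _ *: _); first exact: eq_ev_faces.
by case: x FG => //= v x FG; apply: FG; rewrite /= size_belast.
Qed.

Lemma chain_b_word s : chain_b (word_chain s) = ev (word_b s) (@word_chain _ _).
Proof.
case: s => [|a [|b s]]; first by rewrite linear0 ev_nil.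
  by rewrite (@word_chainE _ _ 0) // chain_b0 ev_nil.
rewrite (@word_chainE _ _ (size s).+1) //
  chain_bS hoch_bE mkseq_nth_size // ev_lin.
by apply: eq_ev_word_b => z [sz]; exact: dinj_word_chain.
Qed.

Lemma chain_B_word s :
  chain_B (word_chain s)
  = ev (rotations K s) (fun z => word_chain (calg1 A :: z)).
Proof.
case: s => [|a s]; first by rewrite linear0 ev_nil.
rewrite (@word_chainE _ _ (size s)) // chain_BE connesBE mkseq_nth_size // ev_lin.
by apply: eq_ev_rotations => z sz; apply: dinj_word_chain; rewrite /= sz.
Qed.

Lemma chain_shuffle_word x y :
  chain_shuffle (word_chain x) (word_chain y)
  = ev (word_shuffle x y) (@word_chain _ _).
Proof.
case: x y => [|a x] [|b y]; try by rewrite ?linear0 ?ev_nil //.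
rewrite (@word_chainE _ _ (size x)) // (@word_chainE _ _ (size y)) //.
rewrite chain_shuffleE shuffleE.
rewrite !mkseq_nth_size // ev_lin !ev_word_shuffle.
by apply: eq_ev_shuffles_size => z sz; apply: dinj_word_chain; rewrite /= sz.
Qed.

(** B puts a letter 1 in front; a second B moves it inside. *)
Lemma chain_B_chain_B z : chain_B (chain_B z) = 0.
Proof.
elim/chains_ind: z => [|x y|a s]; first by rewrite !linear0.
  by rewrite !linearD => -> ->; rewrite addr0.
rewrite chain_B_word ev_lin -[RHS](ev0 _ (rotations K (a :: s)));
  apply: eq_ev => z /=.
rewrite chain_B_word;
  apply: (rotations_normalized (F := @word_chain K A) _ [::] z).
exact: word_chain_normalized.
Qed.

(** In b (1 c), the first face gives c and the last one a rotation of c; over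
the whole orbit these cancel.  The inner faces remain, and b' N = N b. *)
Lemma chain_b_chain_B z : chain_b (chain_B z) = - chain_B (chain_b z).
Proof.
elim/chains_ind: z => [|x y|a s]; first by rewrite !linear0.
  by rewrite !linearD => -> ->; rewrite -opprD.
rewrite chain_B_word chain_b_word !ev_lin /=.
under eq_ev => z do rewrite chain_b_word ev_word_b_cons ev_faces_cons.
under [in RHS]eq_ev => z do rewrite chain_B_word.
rewrite !evD !evN ev_rotations_faces -addrA addrC -[RHS]addr0 -addrA;
  congr (_ + _).
have -> : ev (rotations K (a :: s)) (fun z => fst_letter z (fun v y' =>
  word_chain (calg1 A ∙ v :: y')))
  = ev (rotations K (a :: s)) (@word_chain _ _).
  by apply: eq_ev_rotations => -[|v z] //=; rewrite calg_mul1.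
rewrite addrC.
transitivity (ev (rotations K (a :: s)) (@word_chain _ _) + (-1) ^+ (size s).+1 *:
   ev (rotations K (a :: s)) (fun z => word_chain (rotr 1 z))); last first.
  rewrite ev_rotations_rotr // muln1 scalerA -exprD addSn addnn exprS.
  by rewrite -signr_odd odd_double mulr1 scaleN1r subrr.
congr (_ + _); rewrite -evZ; apply: eq_ev_rotations => z ->; congr (_ *: _).
case/lastP: z => [|z v] //; rewrite lst_letter_rcons rotr1_rcons.
by rewrite calg_mul1r.
Qed.

Lemma chain_b_chain_shuffle p (h : hoch A p) y :
  chain_b (chain_shuffle (dinj h) y)
    = chain_shuffle (chain_b (dinj h)) y + (-1) ^+ p *: chain_shuffle (dinj h)
    (chain_b y).
Proof.
elim/hoch_ind: h => [|h h'|a].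
- by rewrite !linear0 /= addr0.
- by rewrite !linearD /= ?linearD /= => -> ->; rewrite addrACA.
elim/chains_ind: y => [|y y'|b y].
- by rewrite !linear0 addr0.
- by rewrite !linearD /= => -> ->; rewrite addrACA.
rewrite dinj_chain mkseq_cons; set a0 := a 0%N; set x := mkseq _ p.
have sz_x : size x = p by rewrite size_mkseq.
rewrite chain_shuffle_word !chain_b_word !ev_lin !ev_word_shuffle /=.
under eq_ev => z do rewrite chain_b_word.
rewrite ev_shuffles_word_b sz_x ev_fun evZ; congr (_ + _ *: _);
  apply: eq_ev => -[|c z].
- by rewrite linear0.
- by rewrite chain_shuffle_word ev_word_shuffle.
- by rewrite linear0.
by rewrite chain_shuffle_word ev_word_shuffle.
Qed.

(** Both sides are sums of words with a letter 1 in front: on the right, over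
the shuffles of rotations of the two words; on the left, over the rotations of
the shuffles in which the first letter of y comes first. *)
Lemma chain_B_chain_shuffle p (h : hoch A p) y :
  chain_B (chain_shuffle (chain_B (dinj h)) y)
    = (-1) ^+ p.+1 *: chain_shuffle (chain_B (dinj h)) (chain_B y).
Proof.
elim/hoch_ind: h => [|h h'|a].
- by rewrite !linear0.
- by rewrite !linearD /= ?linearD /= => -> ->.
elim/chains_ind: y => [|y y'|b y].
- by rewrite !linear0.
- by rewrite !linearD /= => -> ->.
rewrite dinj_chain; set x := mkseq a p.+1.
have sz_x : size x = p.+1 by rewrite size_mkseq.
rewrite !chain_B_word !ev_lin !ev_fun /= ev_lin.
transitivity (ev (rotations K x) (fun c => ev (shuffles K c y)
  (fun z => ev (rotations K (b :: z)) (fun w => word_chain (calg1 A :: w))))).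
  apply: eq_ev => c /=; rewrite chain_shuffle_word ev_word_shuffle ev_lin;
    apply: eq_ev => z /=.
  by rewrite chain_B_word calg_mul1.
transitivity ((-1) ^+ p.+1 *: cyclic_shuffles x (b :: y) (fun w =>
  word_chain (calg1 A :: w))).
  rewrite cyclic_shuffles_rotations sz_x // scalerA -exprD addnn
    -[_ ^+ _.*2]signr_odd odd_double.
  by rewrite scale1r.
rewrite evZ /cyclic_shuffles ev_ev; congr (_ *: _); apply: eq_ev => b' /=.
rewrite ev_fun; apply: eq_ev => c' /=; rewrite chain_shuffle_word ev_word_shuffle.
by apply: eq_ev => z; rewrite calg_mul1.
Qed.

End ChainOperators.

(** * The product on cyclic homology *)

Section TotalComplex.
Variables (K : fieldType) (A : calg K).
Implicit Types (z w : chains A).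
Local Notation dinj := (dinj (V := hoch A)).

Lemma chain_b_coord z n : chain_b A z n = hoch_b A n (z n.+1).
Proof.
elim/dsum_ind: z => [|x y|m h]; first by rewrite !linear0.
  by rewrite linearD /= linearD => -> ->.
case: m h => [|m] h; first by rewrite chain_b0 /= dcast_neq // linear0.
rewrite chain_bS /=; have [e|ne] := eqVneq m n.
  by case: n / e; rewrite !dcast_id.
by rewrite !dcast_neq ?linear0 // eqSS.
Qed.

Lemma chain_B_coord z n : chain_B A z n = connesB_at z n.
Proof.
elim/dsum_ind: z => [|x y|m h].
- by rewrite !linear0; case: n => //= n; rewrite linear0.
- by rewrite linearD /= => -> ->; case: n => [|n] /=; rewrite ?addr0 ?linearD.
rewrite chain_BE /=; case: n => [|n] /=; first by rewrite dcast_neq.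
have [e|ne] := eqVneq m n; first by case: n / e; rewrite !dcast_id.
by rewrite !dcast_neq ?linear0 // eqSS.
Qed.

Definition top_part p : {linear chains A -> chains A} :=
  @Defs.dinj _ _ (hoch A) p \o @dproj _ _ (hoch A) p.

Lemma top_partE p z : top_part p z = dinj (z p).
Proof. by []. Qed.

(** The total differential in degree p only has components below p; what it
leaves out is B of the component of degree p. *)
Lemma dtotE p z : tot A p z ->
  dtot A p z = chain_b A z + chain_B A (z - top_part p z).
Proof.
move=> tz; apply: dsum_ext => j.
rewrite (_ : dtot A p z j
  = \sum_(n < p) dinj (hoch_b A n (z n.+1) + connesB_at z n) j); last first.
  exact: (raddf_sum (@dproj _ _ (hoch A) j)).
have -> : (chain_b A z + chain_B A (z - top_part p z)) j = hoch_b A j (z j.+1)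
    + connesB_at (z - top_part p z) j.
  by rewrite -chain_b_coord -chain_B_coord.
have [lt_j|le_p] := ltnP j p.
  rewrite (bigD1 (Ordinal lt_j)) //= dcast_id big1 ?addr0 => [|i ne_i].
    congr (_ + _); case: j lt_j => //= j lt_j.
    by rewrite dcast_neq ?scaler0 ?addr0 // gtn_eqF // ltnW.
  rewrite dcast_neq //; apply: contraNneq ne_i => e; apply/eqP/val_inj; exact: e.
rewrite big1 => [|i _]; last first.
  by rewrite /= dcast_neq // ltn_eqF // (leq_trans (ltn_ord i)).
rewrite tz ?linear0 ?add0r; last by rewrite negb_and -ltnNge ltnS le_p.
case: j le_p => [|j] //= le_p.
have [->|ne_j] := eqVneq j p; first by rewrite dcast_id scaleN1r subrr linear0.
rewrite dcast_neq 1?eq_sym // scaler0 addr0 tz ?linear0 // negb_and.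
have [lt_pj|le_jp] := ltnP p j; first by [].
have -> : p = j.+1 by apply/eqP; rewrite eqn_leq le_p ltn_neqAle ne_j.
by rewrite /= eq_sym; case: (odd j).
Qed.

Lemma tot_sum q w : tot A q w -> w = \sum_(m < q.+1) dinj (w m).
Proof.
move=> tw; rewrite -(big_mkord xpredT (fun m => dinj (w m))).
apply: dsum_decomp; first exact: iota_uniq.
move=> m; rewrite mem_index_iota /= -leqNgt => lt_m; apply: tw.
by rewrite negb_and -ltnNge lt_m.
Qed.

Lemma tot_dinj p n (h : hoch A n) :
  (n <= p)%N -> odd n = odd p -> tot A p (dinj h).
Proof.
move=> le_n odd_n m; apply: contraNeq => /= hm.
by case: (eqVneq n m) hm => [<-|ne];
  [rewrite le_n odd_n eqxx | rewrite dcast_neq ?eqxx].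
Qed.

Lemma tot_chain_shuffle p q (h : hoch A p) w :
  tot A q w -> tot A (p + q) (chain_shuffle A (dinj h) w).
Proof.
move=> tw; rewrite (tot_sum tw) linear_sum.
apply: (big_ind (tot A (p + q))) => [|x y tx ty|m _].
- exact: subspace0.
- by rewrite -[x]scale1r; exact: subspaceP.
have [/= odd_m|odd_m] := boolP (odd m == odd q); last first.
  by rewrite tw ?linear0 //= ?negb_and ?odd_m ?orbT //; exact: subspace0.
rewrite chain_shuffleE; apply: tot_dinj; first by rewrite leq_add2l -ltnS.
by rewrite !oddD (eqP odd_m).
Qed.

Lemma star_chainE p q z w : tot A q w ->
  star_chain p q z w = chain_shuffle A (chain_B A (dinj (z p))) w.
Proof.
move=> tw; rewrite [in RHS](tot_sum tw) linear_sum chain_BE.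
by apply: eq_bigr => m _; rewrite chain_shuffleE.
Qed.

Lemma top_part_chain_shuffle p q (h : hoch A p) w :
  top_part (p + q) (chain_shuffle A (dinj h) w)
    = chain_shuffle A (dinj h) (top_part q w).
Proof.
elim/dsum_ind: w => [|x y|m k]; first by rewrite !linear0.
  by rewrite !linearD => -> ->.
rewrite chain_shuffleE !top_partE /=; have [<-|ne] := eqVneq m q.
  by rewrite !dcast_id chain_shuffleE.
by rewrite !dcast_neq ?eqn_add2l // !linear0.
Qed.

(** As no assumption is made on the total chain w, this formula shows at once
that star_chain preserves cycles and, in each argument, boundaries. *)
Lemma dtot_chain_shuffle p q (h : hoch A p) w : tot A q w ->
  dtot A (p.+1 + q) (chain_shuffle A (chain_B A (dinj h)) w)
  = chain_shuffle A (chain_b A (chain_B A (dinj h))) w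
    + (-1) ^+ p.+1 *: chain_shuffle A (chain_B A (dinj h)) (dtot A q w).
Proof.
move=> tw; rewrite dtotE; last by rewrite chain_BE; exact: tot_chain_shuffle.
have -> : top_part (p.+1 + q) (chain_shuffle A (chain_B A (dinj h)) w)
    = chain_shuffle A (chain_B A (dinj h)) (top_part q w).
  by rewrite chain_BE top_part_chain_shuffle.
have -> : chain_shuffle A (chain_B A (dinj h)) w - chain_shuffle A (chain_B A
  (dinj h)) (top_part q w)
    = chain_shuffle A (chain_B A (dinj h)) (w - top_part q w) by rewrite linearB.
rewrite chain_B_chain_shuffle dtotE //; move: (chain_B A (w - _)) => t.
rewrite linearD scalerDr addrA; congr (_ + _).
by rewrite chain_BE chain_b_chain_shuffle.
Qed.

(** The operator b B preserves degrees. *)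
Lemma chain_b_chain_B_top p z :
  chain_b A (chain_B A (dinj (z p))) = top_part p (chain_b A (chain_B A z)).
Proof.
rewrite chain_BE chain_bS top_partE; congr dinj.
by rewrite chain_b_coord chain_B_coord.
Qed.

(** Applying B to d z = 0 leaves B b z = 0, since B B = 0. *)
Lemma cycle_chain_b_chain_B p z : tot A p z -> dtot A p z = 0 ->
  chain_b A (chain_B A (dinj (z p))) = 0.
Proof.
move=> tz; rewrite dtotE // => dz; rewrite chain_b_chain_B_top chain_b_chain_B.
have : chain_B A (chain_b A z) = 0.
  by rewrite -[LHS]addr0 -[X in _ + X](chain_B_chain_B
    (z - top_part p z)) -linearD dz linear0.
by move=> ->; rewrite !linear0.
Qed.

(** Here B d w = B b w = - b B w, since B B = 0. *)
Lemma boundary_chain_B p w : tot A p.+1 w ->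
  chain_B A (dinj (dtot A p.+1 w p)) = - chain_b A (chain_B A (dinj (w p.+1))).
Proof.
move=> tw; rewrite chain_b_chain_B_top chain_b_chain_B linearN opprK.
have -> : chain_B A (chain_b A w) = chain_B A (dtot A p.+1 w).
  by rewrite dtotE // linearD chain_B_chain_B addr0.
by rewrite chain_BE top_partE chain_B_coord.
Qed.

End TotalComplex.

Section Star.
Variables (K : fieldType) (A : calg K).
Local Notation dinj := (dinj (V := hoch A)).
Implicit Types (z w : chains A).

Lemma hclass_ofE p z (cz : cyclep p z) :
  hclass_of p z = hclass (Submod (S := Subspace (@cyclep0 K A p)
    (@cyclepP K A p)) (asboolT cz)).
Proof.
rewrite /hclass_of insubT; first exact/asboolP.
by move=> cz'; congr hclass; apply: val_inj.
Qed.

Lemma hclass_of_linear p k z w : cyclep p z -> cyclep p w ->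
  hclass_of p (k *: z + w) = k *: hclass_of p z + hclass_of p w.
Proof.
move=> cz cw; have czw := cyclepP k cz cw.
rewrite (hclass_ofE cz) (hclass_ofE cw) (hclass_ofE czw) /hclass -linearP.
by congr qclass; apply: val_inj.
Qed.

Lemma hclass_of0 p : hclass_of p (0 : chains A) = 0.
Proof.
rewrite (hclass_ofE (cyclep0 A p)) /hclass -(linear0 (qclass _)).
by congr qclass; apply: val_inj.
Qed.

Lemma hclass_of_boundary p z w : tot A p z -> dtot A p z = 0 ->
  tot A p.+1 w -> dtot A p.+1 w = z -> hclass_of p z = 0.
Proof.
move=> tz dz tw dw; rewrite (hclass_ofE (conj tz dz)) /hclass.
rewrite -(linear0 (qclass _)); apply/qclass_eq; rewrite subr0.
by exists w.
Qed.

Lemma hclass_of_val p (z : Defs.cycle A p) :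
  hclass_of p (submod_val z) = hclass z.
Proof. by rewrite /hclass_of [submod_val z]/(val z) valK. Qed.

Lemma cycleP p (z : Defs.cycle A p) : cyclep p (submod_val z).
Proof. by have /asboolP := submodP z. Qed.

Lemma star_chain_cycle p q z w : cyclep p z -> cyclep q w ->
  cyclep (p + q).+1 (star_chain p q z w).
Proof.
move=> [tz dz] [tw dw].
rewrite star_chainE //; split.
  by rewrite chain_BE; exact: (@tot_chain_shuffle _ _ p.+1).
by rewrite (@dtot_chain_shuffle _ _ p) // cycle_chain_b_chain_B // dw !linear0
  /= addr0.
Qed.

(** If z = d v, then B z_p = - b B v_(p+1), so the product is the boundary of
- B v_(p+1) × w; if w = d v, it is the boundary of B z_p × v up to sign. *)
Lemma star_well_defined p q : exists g :
  {linear HC A p ⊗ HC A q -> HC A (p + q).+1},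
  forall (z : Defs.cycle A p) (w : Defs.cycle A q), g (hclass z *t hclass w)
    = hclass_of (p + q).+1 (star_chain p q (submod_val z) (submod_val w)).
Proof.
have valP k (x y : Defs.cycle A _) :
  submod_val (k *: x + y) = k *: submod_val x + submod_val y.
  by [].
apply: quo_tens_lift.
- split=> [w|z] k x y; rewrite -hclass_of_linear;
  try exact: (star_chain_cycle (cycleP _) (cycleP _));
    congr hclass_of.
    rewrite !star_chainE; try exact: (cycleP _).1.
    by rewrite valP !linearP.
  rewrite !star_chainE; try exact: (cycleP _).1.
  by rewrite valP linearP.
- move=> z w [v tv dv]; have [tw dw] := cycleP w.
  have [tc dc] := star_chain_cycle (cycleP z) (cycleP w).
  apply: (hclass_of_boundary tc dc
    (w := - chain_shuffle A (chain_B A (dinj (v p.+1))) (submod_val w))).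
    rewrite -[- _]addr0 -scaleN1r; apply: subspaceP; last exact: subspace0.
    by rewrite chain_BE; exact: (@tot_chain_shuffle _ _ p.+2).
  rewrite linearN (@dtot_chain_shuffle _ _ p.+1) // dw !linear0 addr0
    star_chainE //.
  by rewrite -dv boundary_chain_B // linearN.
move=> z w [v tv dv]; have [tw dw] := cycleP w; have [tz dz] := cycleP z.
have [tc dc] := star_chain_cycle (cycleP z) (cycleP w).
apply: (hclass_of_boundary tc dc
  (w := (-1) ^+ p.+1 *: chain_shuffle A (chain_B A (dinj (submod_val z p))) v)).
  rewrite -[_ *: _]addr0; apply: subspaceP; last exact: subspace0.
  by rewrite -addnS chain_BE; exact: (@tot_chain_shuffle _ _ p.+1).
rewrite linearZ_LR (_ : (p + q).+2 = (p.+1 + q.+1)%N); last by rewrite addnS.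
rewrite (@dtot_chain_shuffle _ _ p) // cycle_chain_b_chain_B // linear0 add0r.
rewrite scalerA -exprD addnn -signr_odd odd_double scale1r star_chainE //.
by rewrite dv.
Qed.

Lemma starE p q z w : cyclep p z -> cyclep q w ->
  star A p q (hclass_of p z *t hclass_of q w)
    = hclass_of (p + q).+1 (star_chain p q z w).
Proof.
move=> cz cw; rewrite (hclass_ofE cz) (hclass_ofE cw).
have [g gE] := star_well_defined p q; rewrite /star; set gen := fun zw : _ * _ => _.
set z' := Submod _; set w' := Submod _.
rewrite (@inducedE _ _ _ _ gen _ _ (z', w')) //.
by exists g => -[u v]; exact: gE.
Qed.

Lemma HCprime_mulE p q (u : HC A p) (v : HC A q) :
  HCprime_mul (Defs.dinj u) (Defs.dinj v)
    = Defs.dinj (star A p q (u *t v)) :> HCprime_mod A.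
Proof.
have [g gE] := dsum_lift2 (fun p q =>
  tcurry (@Defs.dinj _ _ (HC A) (p + q).+1 \o star A p q)).
have [h hE] := @tens_family _ _ _ _ g (fun k x y => linearP g k x y).
rewrite /HCprime_mul /HCprime_mulmap.
set gen := fun t : {p & HC A p} * {q & HC A q} => _.
rewrite (@inducedE _ _ _ _ gen _ _ (Tagged (HC A) u, Tagged (HC A) v)) //.
by exists h => -[[p' u'] [q' v']]; rewrite /gen hE gE.
Qed.
End Star.

(** * Measurings on words *)

Section Sweedler.
Variable K : fieldType.

Lemma tens_repr (U V : lmodType K) (t : U ⊗ V) :
  exists r : seq (U * V), t = \sum_(p <- r) p.1 *t p.2.
Proof.
elim/tens_ind: t => [|s t [r ->] [r' ->]|u v].
- by exists [::]; rewrite big_nil.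
- by exists (r ++ r'); rewrite big_cat.
by exists [:: (u, v)]; rewrite big_seq1.
Qed.

(** With a decomposition of the coproduct chosen once and for all, Sweedler sums
are finite sums, which commute with all linear operations; for a bilinear
summand they do not depend on the choice (sweedler_sum_tlift). *)
Definition sweedler_terms (C : coalg K) (x : C) : seq (C * C) :=
  projT1 (cid (tens_repr (comul C x))).

Definition sweedler_sum (C : coalg K) (W : lmodType K) (x : C)
  (f : C -> C -> W) : W :=
  \sum_(p <- sweedler_terms x) f p.1 p.2.

Lemma sweedler_sum_lin (C : coalg K) (W W' : lmodType K)
    (g : {linear W -> W'}) (x : C) (f : C -> C -> W) :
  g (sweedler_sum x f) = sweedler_sum x (fun y z => g (f y z)).
Proof. exact: linear_sum. Qed.

Variables (C : coalg K) (W : lmodType K).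
Implicit Types (x y z : C) (f : C -> C -> W).

Lemma comul_sweedler_sum x : comul C x = sweedler_sum x (fun y z => y *t z).
Proof. by rewrite /sweedler_sum /sweedler_terms; case: cid. Qed.

Lemma eq_sweedler_sum x f f' :
  (forall y z, f y z = f' y z) -> sweedler_sum x f = sweedler_sum x f'.
Proof. by move=> ff'; apply: eq_bigr => p _; exact: ff'. Qed.

Lemma ev_sweedler_sum (T : Type) (l : seq (K * seq T)) x
    (F : C -> C -> seq T -> W) :
  ev l (fun s => sweedler_sum x (fun y z => F y z s))
    = sweedler_sum x (fun y z => ev l (F y z)).
Proof. exact: ev_sum. Qed.

Lemma sweedler_sumZ x k f :
  sweedler_sum x (fun y z => k *: f y z) = k *: sweedler_sum x f.
Proof. by rewrite /sweedler_sum scaler_sumr. Qed.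

Lemma sweedler_sumD x f g :
  sweedler_sum x (fun y z => f y z + g y z) = sweedler_sum x f + sweedler_sum x g.
Proof. exact: big_split. Qed.

Lemma sweedler_sum_tlift x f : bilin f -> sweedler_sum x f = tlift f (comul C x).
Proof.
by move=> fb; rewrite comul_sweedler_sum linear_sum; apply: eq_bigr => p _;
  rewrite tliftE.
Qed.

Lemma sweedler_sum_linear f : bilin f -> linear (fun x => sweedler_sum x f).
Proof. by move=> fb k x y; rewrite !sweedler_sum_tlift // !linearP. Qed.

Lemma sweedler_sumC x f :
  bilin f -> sweedler_sum x f = sweedler_sum x (fun y z => f z y).
Proof.
move=> fb; rewrite [LHS]sweedler_sum_tlift // -comulC comul_sweedler_sum
  !linear_sum.
by apply: eq_bigr => p _; rewrite tswapE tliftE.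
Qed.

Lemma sweedler_sum1l x (g : C -> W) :
  linear g -> sweedler_sum x (fun y z => counit C y *: g z) = g x.
Proof.
move=> gl; rewrite -[in RHS](comul1l x) comul_sweedler_sum !linear_sum /=.
rewrite -[g]/(mklin gl : C -> W) linear_sum; apply: eq_bigr => p _.
by rewrite tmapE tlunitE linearZ.
Qed.

Definition trilin (f : C -> C -> C -> W) :=
  [/\ forall y z, linear (fun x => f x y z), forall x z, linear (fun y => f x y z)
    & forall x y, linear (f x y)].

Lemma sweedler_sumA x (f : C -> C -> C -> W) : trilin f ->
  sweedler_sum x (fun y z => sweedler_sum z (f y))
    = sweedler_sum x (fun y z => sweedler_sum y (fun y1 y2 => f y1 y2 z)).
Proof.
move=> [f1 f2 f3].
have fb y : bilin (f y) by split=> [z|z]; [exact: f2 | exact: f3].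
have [|g gE] := @tens_family K C (C ⊗ C) W (fun y => tlift (f y)).
  move=> k y y'; apply: lin_ext; apply: tens_linP => u v /=.
  by rewrite !tliftE // f1.
have {}gE y1 y2 z : g (y1 *t (y2 *t z)) = f y1 y2 z by rewrite gE tliftE.
transitivity (g (tmap idfun (comul C) (comul C x))).
  rewrite [X in g (tmap _ _ X)]comul_sweedler_sum !linear_sum;
    apply: eq_bigr => p _.
  rewrite tmapE comul_sweedler_sum; apply/esym.
  apply: (etrans (sweedler_sum_lin (g \o tpr _ p.1) p.2 (fun y z => y *t z))).
  by apply: eq_sweedler_sum => y z; rewrite -gE.
rewrite -comulA [X in tmap _ _ X]comul_sweedler_sum !linear_sum;
  apply: eq_bigr => p _.
rewrite tmapE comul_sweedler_sum.
apply: (etrans (sweedler_sum_lin (g \o (tassoc _ _ _ \o tpl _ p.2)) p.1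
  (fun y z => y *t z))).
by apply: eq_sweedler_sum => y z; rewrite -gE /= tassocE.
Qed.

(** Exchange of the first two components of the iterated coproduct. *)
Lemma sweedler_sumAC x (f : C -> C -> C -> W) : trilin f ->
  sweedler_sum x (fun y z => sweedler_sum z (f y))
    = sweedler_sum x (fun y z => sweedler_sum z (fun z1 z2 => f z1 y z2)).
Proof.
move=> ft; have [f1 f2 f3] := ft; rewrite sweedler_sumA // sweedler_sumA;
  last by split.
by apply: eq_sweedler_sum => y z; rewrite sweedler_sumC //.
Qed.

End Sweedler.

Section Letterwise.
Variable K : fieldType.

(** Permutations of letters are generated by this one, applied behind a prefix;
insert_head is the composite that carries the first letter to place p. *)
Definition swap_head (T : Type) (c : seq T) :=
  if c is u :: v :: c' then v :: u :: c' else c.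

Definition insert_head (T : Type) p (c : seq T) :=
  if c is u :: c' then take p c' ++ u :: drop p c' else c.

(** The letters are moved to places that depend on lengths only, so that
multilinearity is preserved. *)
Definition letterwise (T : Type) (op : seq T -> seq T) :=
  forall s1 s2, exists t1 t2, forall u, op (s1 ++ u :: s2) = t1 ++ u :: t2.

Lemma multilinear_letterwise (V W : lmodType K) (op : seq V -> seq V)
    (F : seq V -> W) :
  letterwise op -> multilinear F -> multilinear (fun s => F (op s)).
Proof.
by move=> opl Fl s1 s2 k u v; have [t1 [t2 tE]] := opl s1 s2; rewrite !tE Fl.
Qed.

Lemma take_drop_letter (T : Type) p (s1 s2 : seq T) :
  (exists t1 t2, forall u, take p (s1 ++ u :: s2)
    = t1 ++ u :: t2 /\ drop p (s1 ++ u :: s2) = drop (p - (size s1).+1) s2) \/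
  (exists t1 t2, forall u, take p (s1 ++ u :: s2)
    = take p s1 /\ drop p (s1 ++ u :: s2) = t1 ++ u :: t2).
Proof.
have [lt_s|le_p] := ltnP (size s1) p.
  left; exists s1, (take (p - (size s1).+1) s2) => u.
  rewrite take_cat drop_cat ltnNge (ltnW lt_s) /= subnS.
  by case: (p - size s1)%N (subn_gt0 (size s1) p) => [|m] //; rewrite lt_s.
right; exists (drop p s1), s2 => u; rewrite take_cat drop_cat.
move: le_p; rewrite leq_eqVlt => /orP[/eqP->|->] //.
by rewrite ltnn subnn take0 drop0 take_size drop_size cats0.
Qed.

Lemma insert_head_letterwise (T : Type) p : letterwise (@insert_head T p).
Proof.
move=> [|w s1] s2; first by exists (take p s2), (drop p s2).
have [[t1 [t2 tE]]|[t1 [t2 tE]]] := take_drop_letter p s1 s2.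
  exists t1, (t2 ++ w :: drop (p - (size s1).+1) s2) => u /=.
  by have [-> ->] := tE u; rewrite -catA.
exists (take p s1 ++ w :: t1), t2 => u /=.
by have [-> ->] := tE u; rewrite -catA.
Qed.

Lemma keep_head_letterwise (T : Type) (op : seq T -> seq T) : letterwise op ->
  letterwise (fun c => if c is u :: c' then u :: op c' else c).
Proof.
move=> opl [|w s1] s2; first by exists [::], (op s2).
by have [t1 [t2 tE]] := opl s1 s2; exists (w :: t1), t2 => u /=; rewrite tE.
Qed.

Lemma multilinear_split (V W : lmodType K) p (Q : seq V -> seq V -> W) :
  (forall d, multilinear (Q^~ d)) -> (forall c, multilinear (Q c)) ->
  multilinear (fun c => Q (take p c) (drop p c)).
Proof.
move=> Ql Qr s1 s2 k u v.
have [[t1 [t2 tE]]|[t1 [t2 tE]]] := take_drop_letter p s1 s2;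
  have [-> ->] := tE (k *: u + v); have [-> ->] := tE u; have [-> ->] := tE v.
  exact: Ql.
exact: Qr.
Qed.

End Letterwise.

Section MeasuringWords.
Variables (K : fieldType) (A A' : calg K) (C : coalg K).
Variable Phi : {linear C -> {linear A -> A'}}.
Implicit Types (W : lmodType K) (s t : seq A) (x y z : C).

(** The combination of the words Phi(x_(1))(a_0) ... Phi(x_(n+1))(a_n). *)
Fixpoint meas_word s : C -> seq (K * seq A') :=
  if s is u :: s' then
    fun x => flatten
      [seq lcons 1 (Phi p.1 u) (meas_word s' p.2) | p <- sweedler_terms x]
  else fun x => [:: (counit C x : K, [::])].

Lemma ev_meas_word_nil W x (F : seq A' -> W) :
  ev (meas_word [::] x) F = (counit C x : K) *: F [::].
Proof. by rewrite /ev big_seq1. Qed.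

Lemma ev_meas_word_cons W u s x (F : seq A' -> W) :
  ev (meas_word (u :: s) x) F
    = sweedler_sum x (fun y z => ev (meas_word s z) (fun c => F (Phi y u :: c))).
Proof.
rewrite /sweedler_sum /=; elim: (sweedler_terms x) => [|p r IH];
  first by rewrite ev_nil big_nil.
by rewrite /= ev_cat IH big_cons ev_lcons scale1r.
Qed.

Arguments meas_word : simpl never.

Lemma eq_ev_meas_word W s x (F G : seq A' -> W) :
  (forall c, size c = size s -> F c = G c) -> ev (meas_word s x) F
    = ev (meas_word s x) G.
Proof.
elim: s x F G => [|u s IH] x F G FG; first by rewrite !ev_meas_word_nil FG.
by rewrite !ev_meas_word_cons; apply: eq_sweedler_sum => y z;
  apply: IH => c sz; rewrite FG //= sz.
Qed.

Lemma ev_meas_word_linear W s (F : seq A' -> W) : multilinear F ->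
  linear (fun x => ev (meas_word s x) F).
Proof.
elim: s F => [|u s IH] F Fl k x y.
  by rewrite !ev_meas_word_nil linearP scalerDl scalerA.
rewrite !ev_meas_word_cons;
  apply: (sweedler_sum_linear (f := fun y z => ev (meas_word s z) _)).
split=> [z|z] {}k {}x {}y; last by apply: IH; exact: multilinear_cons.
by rewrite -evZ -evD; apply: eq_ev => c; rewrite linearP;
  exact: (multilinear_head _ Fl).
Qed.

Lemma ev_meas_word_multilinear W x (F : seq A' -> W) : multilinear F ->
  multilinear (fun s => ev (meas_word s x) F).
Proof.
move=> Fl s1 s2; elim: s1 x F Fl => [|w s1 IH] x F Fl k u v.
  rewrite !ev_meas_word_cons -sweedler_sumZ -sweedler_sumD;
    apply: eq_sweedler_sum => y z; rewrite -evZ -evD.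
  by apply: eq_ev => c; rewrite linearP; exact: (multilinear_head _ Fl).
rewrite !ev_meas_word_cons -sweedler_sumZ -sweedler_sumD;
  apply: eq_sweedler_sum => y z; apply: IH.
exact: multilinear_cons.
Qed.

Lemma bilin_ev_meas_word W s u (F : seq A' -> W) : multilinear F ->
  bilin (fun y z => ev (meas_word s z) (fun c => F (Phi y u :: c))).
Proof.
move=> Fl; split=> [z|y] k a b; last by apply: ev_meas_word_linear;
  exact: multilinear_cons.
by rewrite -evZ -evD; apply: eq_ev => c; rewrite linearP;
  exact: (multilinear_head _ Fl).
Qed.

Lemma trilin_ev_meas_word W s u v (F : seq A' -> W) : multilinear F ->
  trilin (fun x y z => ev (meas_word s z) (fun c => F [:: Phi x u, Phi y v & c])).
Proof.
move=> Fl; split=> [y z|x z|x y].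
- move=> k a b; rewrite -evZ -evD; apply: eq_ev => c; rewrite linearP.
  exact: (Fl [::]).
- move=> k a b; rewrite -evZ -evD; apply: eq_ev => c; rewrite linearP.
  exact: (Fl [:: _]).
apply: (ev_meas_word_linear s (F := fun c => F [:: Phi x u, Phi y v & c])).
exact: (multilinear_cons (Phi y v) (multilinear_cons (Phi x u) Fl)).
Qed.

(** Cocommutativity: the components acting on the two letters are exchanged. *)
Lemma ev_meas_word_swap W u v s x (F : seq A' -> W) : multilinear F ->
  ev (meas_word [:: u, v & s] x) F
    = ev (meas_word [:: v, u & s] x) (fun c => F (swap_head c)).
Proof.
move=> Fl; rewrite !ev_meas_word_cons.
under eq_sweedler_sum => y z do rewrite ev_meas_word_cons.
rewrite sweedler_sumAC; last exact: trilin_ev_meas_word.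
by apply: eq_sweedler_sum => y z; rewrite ev_meas_word_cons.
Qed.

Lemma ev_meas_word_insert W v s t x (F : seq A' -> W) : multilinear F ->
  ev (meas_word (s ++ v :: t) x) F
  = ev (meas_word (v :: s ++ t) x) (fun c => F (insert_head (size s) c)).
Proof.
elim: s x F => [|u s IH] x F Fl.
  by apply: eq_ev_meas_word => -[|c0 c] //=; rewrite take0 drop0.
pose H := fun c : seq A' =>
  F (if c is u :: c' then u :: insert_head (size s) c' else c).
have Hl : multilinear H.
  apply: (multilinear_letterwise _ Fl); apply: keep_head_letterwise.
  exact: insert_head_letterwise.
transitivity (ev (meas_word [:: u, v & s ++ t] x) H).
  rewrite cat_cons !ev_meas_word_cons; apply: eq_sweedler_sum => y z;
    rewrite IH //.
  exact: multilinear_cons.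
rewrite ev_meas_word_swap //; apply: eq_ev_meas_word => -[|a [|b c]] //= _.
Qed.

Lemma ev_meas_word_rot1 W s x (F : seq A' -> W) : multilinear F ->
  ev (meas_word (rot 1 s) x) F = ev (meas_word s x) (fun c => F (rot 1 c)).
Proof.
case: s => [|u s] Fl; first by rewrite !ev_meas_word_nil.
rewrite rot1_cons -cats1 ev_meas_word_insert // cats0.
apply: eq_ev_meas_word => -[|a c] //= [sz]; congr F.
by rewrite -sz take_size drop_size /rot /= drop0 take0.
Qed.

Lemma ev_meas_word_rot W k s x (F : seq A' -> W) :
  multilinear F -> (k <= size s)%N ->
  ev (meas_word (rot k s) x) F = ev (meas_word s x) (fun c => F (rot k c)).
Proof.
elim: k F => [|k IH] F Fl le_k.
  by rewrite rot0; apply: eq_ev => c; rewrite rot0.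
rewrite rotS // ev_meas_word_rot1 // IH 1?ltnW //; last exact: multilinear_rot.
by apply: eq_ev_meas_word => c sz; rewrite [in RHS]rotS ?sz.
Qed.

Lemma ev_meas_word_rotr W k s x (F : seq A' -> W) : multilinear F ->
  ev (meas_word (rotr k s) x) F = ev (meas_word s x) (fun c => F (rotr k c)).
Proof.
move=> Fl; rewrite /rotr ev_meas_word_rot ?leq_subr //.
by apply: eq_ev_meas_word => c ->.
Qed.

Hypothesis hPhi : umeasuring Phi.

(** Phi(x)(u v) is the Sweedler sum of Phi(x_(1))(u) Phi(x_(2))(v), and the two
ways of splitting x further agree by coassociativity. *)
Lemma ev_meas_word_mul_head W s x (F : seq A' -> W) : multilinear F ->
  ev (meas_word (mul_head s) x) F = ev (meas_word s x) (fun c => F (mul_head c)).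
Proof.
case: s => [|u [|v s]] Fl; first by apply: eq_ev_meas_word => -[|a [|b c]].
  by apply: eq_ev_meas_word => -[|a [|b c]].
rewrite [mul_head _]/=; have [mul_Phi _] := hPhi.
rewrite [LHS]ev_meas_word_cons [RHS]ev_meas_word_cons.
under [RHS]eq_sweedler_sum => y z do rewrite ev_meas_word_cons.
rewrite sweedler_sumA; last first.
  apply: (trilin_ev_meas_word s u v (F := fun c => F (mul_head c))).
  exact: multilinear_mul_head.
apply: eq_sweedler_sum => y z; rewrite -ev_sweedler_sum; apply: eq_ev => c /=.
rewrite mul_Phi -sweedler_sum_tlift; last exact: (@measuring_bilin _ A A').
exact: (sweedler_sum_lin (mklin (multilinear_head c Fl))).
Qed.

(** Phi(x_(1))(1) = counit(x_(1)) 1, and the counit law removes x_(1). *)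
Lemma ev_meas_word_one W s x (F : seq A' -> W) : multilinear F ->
  ev (meas_word (calg1 A :: s) x) F
    = ev (meas_word s x) (fun c => F (calg1 A' :: c)).
Proof.
move=> Fl; have [_ one_Phi] := hPhi; rewrite ev_meas_word_cons.
rewrite -(@sweedler_sum1l K C W x (fun z => ev (meas_word s z) (fun c =>
  F (calg1 A' :: c)))).
  apply: eq_sweedler_sum => y z; rewrite -evZ; apply: eq_ev => c; rewrite one_Phi.
  exact: (linearZ_LR (mklin (multilinear_head c Fl))).
by apply: ev_meas_word_linear; exact: multilinear_cons.
Qed.

Lemma ev_meas_word_degenerate W s1 s2 x (F : seq A' -> W) : multilinear F ->
  (forall c d, F (c ++ calg1 A' :: d) = 0) ->
  ev (meas_word (s1 ++ calg1 A :: s2) x) F = 0.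
Proof.
move=> Fl F0; rewrite ev_meas_word_insert // ev_meas_word_one; last first.
  exact: (multilinear_letterwise (@insert_head_letterwise _ _)).
by rewrite -[RHS](ev0 _ (meas_word (s1 ++ s2) x)); apply: eq_ev => c; exact: F0.
Qed.

Lemma ev_meas_word_normalized W x (F : seq A' -> W) :
  multilinear F -> normalized F ->
  normalized (fun s => ev (meas_word s x) F).
Proof.
move=> Fl F0 a s1 s2; rewrite ev_meas_word_cons /sweedler_sum big1 // => p _.
by apply: ev_meas_word_degenerate;
  [exact: multilinear_cons | move=> *; exact: F0].
Qed.

Lemma ev_meas_word_cat W s t x (F : seq A' -> W) : multilinear F ->
  ev (meas_word (s ++ t) x) F
  = sweedler_sum x (fun y z => ev (meas_word s y) (fun c =>
    ev (meas_word t z) (fun d => F (c ++ d)))).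
Proof.
elim: s x F => [|u s IH] x F Fl.
  rewrite -(@sweedler_sum1l K C W x (fun z => ev (meas_word t z) F));
    last exact: ev_meas_word_linear.
  by apply: eq_sweedler_sum => y z; rewrite ev_meas_word_nil.
rewrite ev_meas_word_cons.
under eq_sweedler_sum => y z do rewrite (IH _ _ (multilinear_cons _ Fl)).
under [RHS]eq_sweedler_sum => y z do rewrite ev_meas_word_cons.
apply: sweedler_sumA; split=> [y z|w z|w y] k a b.
- rewrite -evZ -evD; apply: eq_ev => c; rewrite -evZ -evD; apply: eq_ev => d.
  by rewrite linearP; exact: (Fl [::]).
- apply: (ev_meas_word_linear s (F := fun c => ev (meas_word t z) (fun d =>
  F (Phi w u :: (c ++ d))))).
  move=> s1 s2 l a' b'; rewrite -evZ -evD; apply: eq_ev => d; rewrite -!catA.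
  exact: (Fl (_ :: _)).
rewrite -evZ -evD; apply: eq_ev => c; apply: ev_meas_word_linear => s1 s2 l a' b'.
rewrite !catA; exact: (Fl (_ :: c ++ s1)).
Qed.

End MeasuringWords.

Arguments meas_word : simpl never.

(** * Measurings and the operators of the mixed complex *)

Section MeasuringOperators.
Variables (K : fieldType) (A A' : calg K) (C : coalg K).
Variable Phi : {linear C -> {linear A -> A'}}.
Implicit Types (W : lmodType K) (s t : seq A) (x y : C).
Local Notation meas_word := (meas_word Phi).
Hypothesis hPhi : umeasuring Phi.

(** B consists of rotations and of the insertion of a letter 1. *)
Lemma ev_meas_word_rotations W s x (F : seq A' -> W) : multilinear F ->
  ev (rotations K s) (fun z => ev (meas_word (calg1 A :: z) x) F)
  = ev (meas_word s x) (fun c => ev (rotations K c) (fun d => F (calg1 A' :: d))).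
Proof.
move=> Fl; transitivity (\sum_(i < size s) ev (meas_word s x)
   (fun c => (-1) ^+ ((size s).-1 * i) *: F (calg1 A' :: rot i c))).
  rewrite ev_rotations; apply: eq_bigr => i _; rewrite evZ ev_meas_word_one //.
  rewrite (ev_meas_word_rot Phi x (multilinear_cons _ Fl)) //; exact: ltnW.
by rewrite -ev_sum; apply: eq_ev_meas_word => c sz; rewrite ev_rotations sz.
Qed.

(** By ev_word_b_rot, b consists of rotations and of products of the first two
letters. *)
Lemma ev_meas_word_word_b W s x (F : seq A' -> W) : multilinear F ->
  ev (word_b s) (fun z => ev (meas_word z x) F)
    = ev (meas_word s x) (fun c => ev (word_b c) F).
Proof.
move=> Fl; have [gt1|le1] := ltnP 1 (size s); last first.
  rewrite (@eq_ev_meas_word _ _ _ _ Phi _ s x _ (fun=> 0)) ?ev0 => [|c sz].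
    by case: s le1 => [|? []] // _; rewrite ev_nil.
  by rewrite -sz in le1; case: c le1 {sz} => [|? []] // _; rewrite ev_nil.
transitivity (\sum_(i < size s) ev (meas_word s x)
   (fun c => (-1) ^+ i *: F (rotr i (mul_head (rot i c))))).
  rewrite ev_word_b_rot //; apply: eq_bigr => i _; rewrite evZ; congr (_ *: _).
  have Fl1 := multilinear_rotr i Fl.
  have Fl2 := multilinear_mul_head Fl1.
  by rewrite ev_meas_word_rotr // ev_meas_word_mul_head //
    (ev_meas_word_rot Phi x Fl2) // ltnW.
by rewrite -ev_sum; apply: eq_ev_meas_word => c sz; rewrite ev_word_b_rot ?sz.
Qed.

(** Each step of the recursion of shuffles takes the next letter from the front
of s, or from the front of t, which lies behind s; in the second case the letter
is first carried across s. *)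
Lemma ev_meas_word_shuffles W s t x (F : seq A' -> W) : multilinear F ->
  ev (shuffles K s t) (fun z => ev (meas_word z x) F)
  = ev (meas_word (s ++ t) x)
      (fun c => ev (shuffles K (take (size s) c) (drop (size s) c)) F).
Proof.
have [n] := ubnP (size s + size t); elim: n => // n IH in s t x F * => lt_n Fl.
case: s t lt_n => [|u s] t lt_n.
  by rewrite ev_shuffles0l; apply: eq_ev => c; rewrite take0 drop0 ev_shuffles0l.
case: t lt_n => [|v t] lt_n.
  rewrite ev_shuffles0r cats0; apply: eq_ev_meas_word => c <-.
  by rewrite take_size drop_size ev_shuffles0r.
set us := u :: s; set p := size us.
have under_head (w : A) r s' t' : (size s' + size t' < n)%N -> r = s' ++ t' ->
    ev (shuffles K s' t') (fun z => ev (meas_word (w :: z) x) F)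
    = ev (meas_word (w :: r) x) (fun c => fst_letter c (fun a c' =>
        ev (shuffles K (take (size s') c') (drop (size s') c')) (fun z =>
          F (a :: z)))).
  move=> lt_xy ->; rewrite ev_meas_word_cons;
    under eq_ev => z do rewrite ev_meas_word_cons.
  by rewrite ev_sweedler_sum; apply: eq_sweedler_sum => y z; rewrite IH //;
    exact: multilinear_cons.
(* H is the part of the shuffles of the two halves of c that begin with a letter
   of the second half *)
pose H (c : seq A') := fst_letter (drop p c) (fun b d =>
  ev (shuffles K (take p c) d) (fun z => F (b :: z))).
have Hl : multilinear H.
  apply: (multilinear_split p (Q := fun c d => fst_letter d (fun b d' =>
    ev (shuffles K c d') (fun z => F (b :: z))))) => [d|c].
    case: d => [|b d] s1 s2 /=; first by move=> k a a'; rewrite scaler0 addr0.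
    apply: (slot_shuffles_l (@linear_0fun _ _ _) (@linear_combfun _ _ _)
      (F := fun z => F (b :: z))).
    exact: multilinear_cons.
  case=> [|b s1] s2 /=.
    by move=> k a a'; rewrite -evZ -evD; apply: eq_ev => z; exact: (Fl [::]).
  apply: (slot_shuffles_r (@linear_0fun _ _ _) (@linear_combfun _ _ _)
    (F := fun z => F (b :: z))).
  exact: multilinear_cons.
rewrite ev_shuffles_cons (under_head u (s ++ v :: t)) //.
rewrite (under_head v (us ++ t)) //; last by move: lt_n; rewrite /= addnS.
transitivity (ev (meas_word (us ++ v :: t) x) (fun c => fst_letter c (fun a c' =>
     ev (shuffles K (take (size s) c') (drop (size s) c')) (fun z => F (a :: z)))
   + (-1) ^+ p *: H c)).
  rewrite evD evZ (ev_meas_word_insert Phi _ _ _ _ Hl); congr (_ + _ *: _).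
  apply: eq_ev_meas_word => -[|a c] //= [sz]; rewrite /H /=.
  have sz_p : size (take p c) = p by rewrite size_takel // sz size_cat leq_addr.
  by rewrite drop_cat take_cat sz_p ltnn subnn take0 cats0.
apply: eq_ev_meas_word => c sz; have lt_p : (p < size c)%N.
  by rewrite sz size_cat -addn1 leq_add2l.
rewrite /H ev_shuffles_fst ?size_drop ?addn_gt0 ?subn_gt0 ?lt_p ?orbT //.
rewrite size_takel 1?ltnW //; congr (_ + _).
by case: c lt_p {sz}.
Qed.

(** The coefficients a and b are in front of their words; b is carried across the
first word to be multiplied with a, and the two remaining words are shuffled. *)
Lemma ev_meas_word_word_shuffle W s t x (F : seq A' -> W) : multilinear F ->
  (0 < size s)%N -> (0 < size t)%N ->
  ev (word_shuffle s t) (fun z => ev (meas_word z x) F)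
  = sweedler_sum x (fun y z => ev (meas_word s y) (fun c =>
    ev (meas_word t z) (fun d => ev (word_shuffle c d) F))).
Proof.
case: s t => [|a s] [|b t] // Fl _ _; rewrite ev_word_shuffle.
pose G (c : seq A') :=
  ev (word_shuffle (take (size s).+1 c) (drop (size s).+1 c)) F.
have Gl : multilinear G.
  apply: (multilinear_split (size s).+1 (Q := fun c d =>
    ev (word_shuffle c d) F)) => [d|c].
    exact: multilinear_word_shuffle_l.
  exact: multilinear_word_shuffle_r.
transitivity (ev (meas_word ((a :: s) ++ b :: t) x) G); last first.
  rewrite ev_meas_word_cat //; apply: eq_sweedler_sum => y z;
    apply: eq_ev_meas_word => c sz.
  by apply: eq_ev => d;
    rewrite /G -[(size s).+1]sz take_size_cat // drop_size_cat.
rewrite (ev_meas_word_insert Phi _ _ _ _ Gl) cat_cons ev_meas_word_swap;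
  last first.
  exact: (multilinear_letterwise (@insert_head_letterwise _ _)).
transitivity (ev (shuffles K s t) (fun z =>
  ev (meas_word [:: a, b & z] x) (fun c => F (mul_head c)))).
  apply: eq_ev => z; rewrite -ev_meas_word_mul_head //.
pose F2 a0 b0 c := F (nu_mul (a0 : A') b0 :: c).
have F2l a0 b0 : multilinear (F2 a0 b0) by exact: multilinear_cons.
under eq_ev => z do rewrite ev_meas_word_cons.
rewrite ev_sweedler_sum ev_meas_word_cons; apply: eq_sweedler_sum => y z.
under eq_ev => w do rewrite ev_meas_word_cons.
rewrite ev_sweedler_sum ev_meas_word_cons; apply: eq_sweedler_sum => y' z'.
rewrite (ev_meas_word_shuffles _ _ _ (F2l _ _)); apply: eq_ev_meas_word => c sz.
have sz_p : size (take (size s) c) = size s.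
  by rewrite size_takel // sz size_cat leq_addr.
by rewrite /G /= take_cat drop_cat sz_p ltnn subnn take0 drop0 cats0 ev_lcons
  scale1r.
Qed.

End MeasuringOperators.

(** * Induced maps on cyclic homology *)

Lemma lin0E (K : fieldType) (U V : lmodType K) (u : U) :
  (0 : {linear U -> V}) u = 0.
Proof. by []. Qed.

Lemma linDE (K : fieldType) (U V : lmodType K) (f g : {linear U -> V}) (u : U) :
  (f + g) u = f u + g u.
Proof. by []. Qed.

Section TensorFamilies.
Variable K : fieldType.

Lemma tens_dsum_lift (I : eqType) (C : lmodType K) (V : I -> lmodType K)
  (W : lmodType K)  (f : forall i, {linear C ⊗ V i -> W}) :
  exists g : {linear C ⊗ dsum V -> W},
    forall x i v, g (x *t dinj (i := i) v) = f i (x *t v).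
Proof.
pose h x := projT1 (cid (dsum_lift (fun i => tcurry (f i) x))).
have hE x i v : h x (dinj (i := i) v)
  = f i (x *t v) by rewrite /h; case: cid => g ->.
have [|g gE] := @tens_family _ _ _ _ h; last by exists g => x i v; rewrite gE hE.
move=> k x y; apply: lin_ext; apply: dsum_linP => i v /=.
by rewrite !hE tpurePl linearP.
Qed.

Lemma tens_quo_lift (C V W : lmodType K) (T : subspace V) (f : C -> V -> W) :
  bilin f -> (forall x v, T v -> f x v = 0) ->
  exists g : {linear C ⊗ quomod T -> W}, forall x v, g (x *t qclass T v) = f x v.
Proof.
move=> [fl fr] fT.
pose h x := projT1 (cid (quo_lift (f := mklin (fr x)) (fT x))).
have hE x v : h x (qclass T v) = f x v by rewrite /h; case: cid => g ->.
have [|g gE] := @tens_family _ _ _ _ h; last by exists g => x v; rewrite gE hE.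
move=> k x y; apply: lin_ext => q /=; rewrite -[q]qclass_repr.
by rewrite !hE fl.
Qed.

End TensorFamilies.

Section MeasuringOnHC.
Variables (K : fieldType) (A A' : calg K) (C : coalg K).
Variable Phi : {linear C -> {linear A -> A'}}.
Implicit Types (W : lmodType K) (s t : seq A) (x y : C).
Local Notation meas_word := (meas_word Phi).

(** The iterated coproduct on tensor powers follows the same recursion on the
number of factors as meas_word. *)
Lemma comulnE W n x (b : nat -> A) (F : seq A' -> W)
    (g : {linear tpow C n -> W}) :
  (forall c, g (tpowp n c) = F (mkseq (fun i => Phi (c i) (b i)) n)) ->
  g (comuln C n x) = ev (meas_word (mkseq b n) x) F.
Proof.
elim: n x b F g => [|n IH] x b F g gE.
  rewrite ev_meas_word_nil -[F _](gE (fun=> 0)) -linearZ; congr (g _).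
  by rewrite [RHS]mulr1.
rewrite mkseq_cons ev_meas_word_cons -[comuln C n.+1 x]/(tmap idfun
  (comuln C n) (comul C x)).
rewrite comul_sweedler_sum !linear_sum; apply: eq_bigr => p _.
rewrite tmapE -(IH p.2 _ _ (g \o tpr _ p.1)) // => c.
by rewrite [LHS](gE (scons p.1 c)) mkseq_cons.
Qed.

(** The length of the result is that of r whatever the sequence b, so that the
dependence on r is multilinear in all lengths. *)
Fixpoint apply_letters (b : nat -> A) (r : seq C) : seq A' :=
  if r is c :: r' then Phi c (b 0%N) :: apply_letters (fun i => b i.+1) r'
  else [::].

Lemma apply_letters_mkseq b (c : nat -> C) n :
  apply_letters b (mkseq c n) = mkseq (fun i => Phi (c i) (b i)) n.
Proof. by elim: n b c => [//|n IH] b c; rewrite !mkseq_cons /= IH. Qed.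

Lemma multilinear_apply_letters W b (F : seq A' -> W) : multilinear F ->
  multilinear (fun r => F (apply_letters b r)).
Proof.
move=> Fl r1 r2; elim: r1 b F Fl => [|c r1 IH] b F Fl k u v /=.
  by rewrite linearP; exact: (Fl [::]).
exact: (IH _ _ (multilinear_cons (Phi c (b 0%N)) Fl)).
Qed.

Hypothesis hPhi : umeasuring Phi.

Lemma meas_hochE n x (a : nat -> A) :
  meas_hoch Phi n (x *t chain n a)
  = ev (meas_word (mkseq a n.+1) x) (fun c => word_chain c n : hoch A' n).
Proof.
have Fl := @multilinear_at _ A' n.
pose G s := mklin (ev_meas_word_linear Phi s Fl).
have [||h hE] := @hoch_lift _ A n _ G.
- by move=> s1 s2 k u v; apply: lin_ext => y; exact: ev_meas_word_multilinear.
- move=> u s1 s2; apply: lin_ext => y;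
  apply: (ev_meas_word_normalized hPhi) => //.
  exact: normalized_at.
have fb : bilin (fun y (e : hoch A n) => h e y).
  by split=> [e|y] k z w; rewrite linearP.
have formula y b : (induced (tpowp n.+1)
  (fun c : nat -> C => chain n (fun i => Phi (c i) (b i)))
         : {linear tpow C n.+1 -> hoch A' n}) (comuln C n.+1 y)
   = ev (meas_word (mkseq b n.+1) y) (fun c => word_chain c n : hoch A' n).
  apply: comulnE => c.
  have chainE (d : nat -> C) : chain n (fun i => Phi (d i) (b i))
     = word_chain (mkseq (fun i => Phi (d i) (b i)) n.+1) n.
    symmetry; apply: word_chain_eq => [|i le_i]; first by rewrite size_mkseq.
    by rewrite nth_mkseq.
  rewrite inducedE ?chainE //.
  have [g gE] := tpow_lift n.+1 (multilinear_apply_letters b Fl).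
  by exists g => d; rewrite gE chainE apply_letters_mkseq.
rewrite /meas_hoch; set gen := fun xa : C * (nat -> A) => _.
rewrite (@inducedE _ _ _ _ gen _ _ (x, a)) /= ?formula //.
exists (tlift (fun y (e : hoch A n) => h e y)) => -[y b].
rewrite /gen /= tliftE //.
by rewrite hE /= formula.
Qed.

Lemma meas_chainsE x n (h : hoch A n) :
  meas_chains Phi (x *t dinj h) = dinj (meas_hoch Phi n (x *t h)).
Proof.
have [g gE] := tens_dsum_lift (fun n => @dinj _ _ (hoch A') n \o meas_hoch Phi n).
rewrite /meas_chains; set gen := fun xc : C * {n & hoch A n} => _.
rewrite (@inducedE _ _ _ _ gen _ _ (x, Tagged (hoch A) h)) //.
by exists g => -[y [m k]]; rewrite /gen gE.
Qed.

Definition meas_chain x :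
  {linear chains A -> chains A'} := tcurry (meas_chains Phi) x.

Lemma meas_chain_dinj x n (h : hoch A n) :
  meas_chain x (dinj h) = dinj (meas_hoch Phi n (x *t h)).
Proof. exact: meas_chainsE. Qed.

Lemma meas_chain_word x s :
  meas_chain x (word_chain s) = ev (meas_word s x) (@word_chain _ A').
Proof.
case: s => [|a s]; first by rewrite linear0 ev_meas_word_nil scaler0.
rewrite (@word_chainE _ _ (size s)) //
  meas_chain_dinj meas_hochE mkseq_nth_size // ev_lin.
by apply: eq_ev_meas_word => c sz; apply: dinj_word_chain.
Qed.

Lemma meas_chain_coord x (z : chains A) n :
  meas_chain x z n = meas_hoch Phi n (x *t z n).
Proof.
elim/dsum_ind: z => [|z w|m h].
- by rewrite linear0 tpure0r linear0.
- by rewrite linearD /= => -> ->; rewrite tpureDr linearD.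
rewrite meas_chain_dinj /=; have [e|ne] := eqVneq m n.
  by case: n / e; rewrite !dcast_id.
by rewrite !dcast_neq // tpure0r linear0.
Qed.

Lemma meas_chain_tot x p (z : chains A) : tot A p z -> tot A' p (meas_chain x z).
Proof. by move=> tz n np; rewrite meas_chain_coord tz // tpure0r linear0. Qed.

Lemma meas_chain_top_part x p (z : chains A) :
  meas_chain x (top_part A p z) = top_part A' p (meas_chain x z).
Proof. by rewrite !top_partE meas_chain_dinj meas_chain_coord. Qed.

Lemma meas_chain_chain_B x (z : chains A) :
  meas_chain x (chain_B A z) = chain_B A' (meas_chain x z).
Proof.
elim/chains_ind: z => [|z w|a s]; first by rewrite !linear0.
  by rewrite !linearD => -> ->.
rewrite chain_B_word meas_chain_word !ev_lin.
under eq_ev => z do rewrite meas_chain_word.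
rewrite (ev_meas_word_rotations hPhi); last exact: word_chain_multilinear.
by apply: eq_ev => c; rewrite chain_B_word.
Qed.

Lemma meas_chain_chain_b x (z : chains A) :
  meas_chain x (chain_b A z) = chain_b A' (meas_chain x z).
Proof.
elim/chains_ind: z => [|z w|a s]; first by rewrite !linear0.
  by rewrite !linearD => -> ->.
rewrite chain_b_word meas_chain_word !ev_lin.
under eq_ev => z do rewrite meas_chain_word.
rewrite (ev_meas_word_word_b hPhi); last exact: word_chain_multilinear.
by apply: eq_ev => c; rewrite chain_b_word.
Qed.

Lemma meas_chain_chain_shuffle x (z w : chains A) :
  meas_chain x (chain_shuffle A z w)
    = sweedler_sum x (fun y y' =>
    chain_shuffle A' (meas_chain y z) (meas_chain y' w)).
Proof.
elim/chains_ind: z => [|z z'|a s].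
- by rewrite !(linear0, lin0E) /sweedler_sum big1 // => p _;
  rewrite !(linear0, lin0E).
- rewrite !(linearD, linDE) => -> ->; rewrite -sweedler_sumD.
  by apply: eq_sweedler_sum => y y'; rewrite !(linearD, linDE).
elim/chains_ind: w => [|w w'|b t].
- by rewrite !linear0 /sweedler_sum big1 // => p _; rewrite !linear0.
- rewrite !linearD => -> ->; rewrite -sweedler_sumD.
  by apply: eq_sweedler_sum => y y'; rewrite !linearD.
rewrite chain_shuffle_word ev_lin; under eq_ev => z do rewrite meas_chain_word.
rewrite (ev_meas_word_word_shuffle hPhi) //; last exact: word_chain_multilinear.
apply: eq_sweedler_sum => y y';
  rewrite !meas_chain_word [chain_shuffle _ (ev _ _)]ev_lin ev_fun;
  apply: eq_ev => c.
by rewrite ev_lin; apply: eq_ev => d; rewrite chain_shuffle_word.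
Qed.

Lemma meas_chain_dtot x p (z : chains A) : tot A p z ->
  meas_chain x (dtot A p z) = dtot A' p (meas_chain x z).
Proof.
move=> tz; rewrite !dtotE //; last exact: meas_chain_tot.
by rewrite linearD meas_chain_chain_b meas_chain_chain_B linearB
  meas_chain_top_part.
Qed.

Lemma meas_chain_cycle x p (z : chains A) :
  cyclep p z -> cyclep p (meas_chain x z).
Proof.
by move=> [tz dz]; split;
  [exact: meas_chain_tot | rewrite -meas_chain_dtot // dz linear0].
Qed.

Lemma meas_HCE p x (z : Defs.cycle A p) :
  meas_HC Phi p (x *t hclass z) = hclass_of p (meas_chain x (submod_val z)).
Proof.
have fb : bilin (fun x (z : Defs.cycle A p) =>
  hclass_of p (meas_chain x (submod_val z))).
  split=> [w|y] k u v; rewrite -hclass_of_linear;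
    try exact/meas_chain_cycle/cycleP;
    congr hclass_of.
    exact: (congr1 (fun g : {linear _ -> _} => g (submod_val w))
      (linearP (tcurry (meas_chains Phi)) k u v)).
  exact: (linearP (meas_chain y)).
have f0 y (c : Defs.cycle A p) :
  boundaryp c -> hclass_of p (meas_chain y (submod_val c)) = 0.
  move=> [v tv dv]; have [tc dc] := meas_chain_cycle y (cycleP c).
  apply: (hclass_of_boundary tc dc (w := meas_chain y v));
    first exact: meas_chain_tot.
  by rewrite -meas_chain_dtot // dv.
have [g gE] := tens_quo_lift
  (T := Subspace (@boundaryp0 K A p) (@boundarypP K A p)) fb f0.
rewrite /meas_HC; set gen := fun xz : C * Defs.cycle A p => _.
rewrite (@inducedE _ _ _ _ gen _ _ (x, z)) //.
by exists g => -[y w]; exact: gE.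
Qed.

Lemma meas_HC_class p x (z : chains A) : cyclep p z ->
  meas_HC Phi p (x *t hclass_of p z) = hclass_of p (meas_chain x z).
Proof. by move=> cz; rewrite (hclass_ofE cz) meas_HCE. Qed.

Lemma meas_HCprimeE x p (u : HC A p) :
  meas_HCprime Phi x (dinj u) = dinj (meas_HC Phi p (x *t u)) :> HCprime_mod A'.
Proof.
have [g gE] := tens_dsum_lift (fun n => @dinj _ _ (HC A') n \o meas_HC Phi n).
rewrite /meas_HCprime /=; set gen := fun xu : C * {p & HC A p} => _.
rewrite (@inducedE _ _ _ _ gen _ _ (x, Tagged (HC A) u)) //.
by exists g => -[y [m k]]; rewrite /gen gE.
Qed.

(** Classes of cycles, rather than elements of the quotient, are the arguments
on which all the maps on HC are computed. *)
Lemma HC_ind p (P : HC A p -> Prop) :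
  (forall z, cyclep p z -> P (hclass_of p z)) ->
  forall u, P u.
Proof.
move=> Pz u; rewrite -[u]qclass_repr -[qclass _ _]/(hclass (repr u))
  -hclass_of_val.
exact/Pz/cycleP.
Qed.

Lemma HCprime_ind (P : HCprime_mod A -> Prop) :
  P 0 -> (forall u v, P u -> P v -> P (u + v)) ->
  (forall p z, cyclep p z -> P (dinj (hclass_of p z))) -> forall u, P u.
Proof.
move=> P0 PD Pz; elim/dsum_ind => [//|u v|p u]; first exact: PD.
by elim/HC_ind: u => z; exact: Pz.
Qed.

End MeasuringOnHC.

(** * The induced measuring *)

Section MeasuringHCprime.
Variables (K : fieldType) (A A' : calg K) (C : coalg K).
Variable Phi : {linear C -> {linear A -> A'}}.
Hypothesis hPhi : umeasuring Phi.

Lemma hclass_of_sum p (I : Type) (r : seq I) (z : I -> chains A') :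
  (forall i, cyclep p (z i)) ->
  hclass_of p (\sum_(i <- r) z i) = \sum_(i <- r) hclass_of p (z i).
Proof.
move=> cz.
suff : cyclep p (\sum_(i <- r) z i)
    /\ hclass_of p (\sum_(i <- r) z i) = \sum_(i <- r) hclass_of p (z i) by case.
elim: r => [|i r [cr IH]]; first by rewrite !big_nil hclass_of0; split=> //;
  exact: cyclep0.
rewrite !big_cons -IH -[z i in X in cyclep _ X]scale1r; split;
  first exact: cyclepP.
by rewrite -[z i in LHS]scale1r hclass_of_linear // scale1r.
Qed.

Lemma meas_chain_star_chain x p q (z w : chains A) : tot A q w ->
  meas_chain Phi x (star_chain p q z w)
  = sweedler_sum x (fun y y' =>
    star_chain p q (meas_chain Phi y z) (meas_chain Phi y' w)).
Proof.
move=> tw; rewrite star_chainE // (meas_chain_chain_shuffle hPhi);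
  apply: eq_sweedler_sum => y y'.
rewrite star_chainE; last exact: meas_chain_tot.
by rewrite (meas_chain_chain_B hPhi) meas_chain_top_part.
Qed.

Lemma HCprime_bilin_ext (W : lmodType K)
    (f g : HCprime_mod A -> HCprime_mod A -> W) :
  bilin f -> bilin g ->
  (forall p q z w, cyclep p z -> cyclep q w ->
     f (dinj (hclass_of p z)) (dinj (hclass_of q w))
     = g (dinj (hclass_of p z)) (dinj (hclass_of q w))) ->
  forall a b, f a b = g a b.
Proof.
move=> [fl fr] [gl gr] fg a b.
elim/HCprime_ind: a => [|u v fgu fgv|p z cz].
- exact: (etrans (linear0 (mklin (fl b))) (esym (linear0 (mklin (gl b))))).
- have := linearD (mklin (fl b)) u v;
  have := linearD (mklin (gl b)) u v => /= -> ->.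
  by rewrite fgu fgv.
elim/HCprime_ind: b => [|u v fgu fgv|q w cw]; last exact: fg.
  exact: (etrans (linear0 (mklin (fr _))) (esym (linear0 (mklin (gr _))))).
set c := dinj _.
have := linearD (mklin (fr c)) u v; have := linearD (mklin (gr c)) u v =>
  /= -> ->.
by rewrite fgu fgv.
Qed.

(** The product of the classes of z and w is the class of B z_p × w.  The action of
x commutes with B and with z |-> z_p, and distributes over the shuffle product. *)
Lemma measuring_HCprime :
  measuring (R := HCprime A) (R' := HCprime A') (meas_HCprime Phi).
Proof.
move=> x a b; rewrite -sweedler_sum_tlift; last first.
  exact: (@measuring_bilin _ (HCprime A) (HCprime A') C (meas_HCprime Phi)).
have [ml mr] := nu_mulP (HCprime A); have [ml' mr'] := nu_mulP (HCprime A').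
pose f (a b : HCprime_mod A) : HCprime_mod A' :=
  meas_HCprime Phi x (nu_mul (a : HCprime A) b).
pose g (a b : HCprime_mod A) : HCprime_mod A' := sweedler_sum x (fun y y' =>
  nu_mul (meas_HCprime Phi y a) (meas_HCprime Phi y' b)).
suff : forall a b, f a b = g a b by apply.
apply: HCprime_bilin_ext => [||p q z w cz cw].
- split=> [v|u] k c d; rewrite /f.
    by rewrite (ml v k c d) linearP.
  by rewrite (mr u k c d) linearP.
- split=> [v|u] k c d.
    transitivity (sweedler_sum x (fun y y' =>
        k *: nu_mul (meas_HCprime Phi y c) (meas_HCprime Phi y' v)
        + nu_mul (meas_HCprime Phi y d) (meas_HCprime Phi y' v))).
      by apply: eq_sweedler_sum => y y'; rewrite linearP; exact: ml'.
    by rewrite sweedler_sumD sweedler_sumZ.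
  transitivity (sweedler_sum x (fun y y' =>
      k *: nu_mul (meas_HCprime Phi y u) (meas_HCprime Phi y' c)
      + nu_mul (meas_HCprime Phi y u) (meas_HCprime Phi y' d))).
    by apply: eq_sweedler_sum => y y'; rewrite linearP; exact: mr'.
  by rewrite sweedler_sumD sweedler_sumZ.
rewrite /f /g.
have mEz (y : C) : meas_HCprime Phi y (dinj (hclass_of p z))
    = dinj (hclass_of p (meas_chain Phi y z)) :> HCprime_mod A'.
  by rewrite meas_HCprimeE meas_HC_class.
have mEw (y : C) : meas_HCprime Phi y (dinj (hclass_of q w))
    = dinj (hclass_of q (meas_chain Phi y w)) :> HCprime_mod A'.
  by rewrite meas_HCprimeE meas_HC_class.
under [RHS]eq_sweedler_sum => y y'.
  rewrite mEz mEw [nu_mul _ _](HCprime_mulE (hclass_of p (meas_chain Phi y z))).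
  rewrite starE; try exact: meas_chain_cycle.
  over.
rewrite [nu_mul _ _](HCprime_mulE (hclass_of p z)) starE // meas_HCprimeE.
rewrite (meas_HC_class hPhi); last exact: star_chain_cycle.
rewrite meas_chain_star_chain; last by case: cw.
rewrite /sweedler_sum hclass_of_sum ?linear_sum // => r.
by apply: star_chain_cycle; exact: meas_chain_cycle.
Qed.
End MeasuringHCprime.

(** * Functoriality *)

Section Functoriality.
Variable K : fieldType.

Lemma sweedler_sum_precomp (C D : coalg K) (W : lmodType K)
    (zeta : coalgmor C D) (x : C) (f : D -> D -> W) : bilin f ->
  sweedler_sum (zeta x) f = sweedler_sum x (fun y z => f (zeta y) (zeta z)).
Proof.
move=> fb; rewrite [LHS]sweedler_sum_tlift // coalgmor_comul comul_sweedler_sum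
  !linear_sum.
by apply: eq_bigr => p _; rewrite tmapE tliftE.
Qed.

Lemma sweedler_sum_tens (C D : coalg K) (W : lmodType K) (x : C) (y : D)
    (f : coalg_tens C D -> coalg_tens C D -> W) : bilin f ->
  sweedler_sum (x *t y : coalg_tens C D) f
  = sweedler_sum x (fun x1 x2 => sweedler_sum y (fun y1 y2 =>
    f (x1 *t y1) (x2 *t y2))).
Proof.
move=> fb; rewrite [LHS]sweedler_sum_tlift // [comul _ _]tens_comulE.
pose g (s : C ⊗ C) (t : D ⊗ D) := tlift f (tmiddle _ _ _ _ (s *t t)).
have gl t : linear (g^~ t) by move=> k s s'; rewrite /g tpurePl !linearP.
have gr s : linear (g s) by move=> k t t'; rewrite /g tpurePr !linearP.
rewrite -[LHS]/(g (comul C x) (comul D y)) comul_sweedler_sum.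
apply: (etrans (sweedler_sum_lin (mklin (gl _)) x (fun y z => y *t z)));
  apply: eq_sweedler_sum => x1 x2.
rewrite [mklin _ _]/= comul_sweedler_sum.
apply: (etrans (sweedler_sum_lin (mklin (gr _)) y (fun y z => y *t z)));
  apply: eq_sweedler_sum => y1 y2.
by rewrite /= /g tmiddleE tliftE.
Qed.

Lemma ev_meas_word_precomp (A A' : calg K) (C D : coalg K)
    (Phi : {linear D -> {linear A -> A'}}) (zeta : coalgmor C D)
    (W : lmodType K) s x (F : seq A' -> W) : multilinear F ->
  ev (meas_word (meas_precomp Phi zeta) s x) F = ev (meas_word Phi s (zeta x)) F.
Proof.
elim: s x F => [|u s IH] x F Fl;
  first by rewrite !ev_meas_word_nil coalgmor_counit.
rewrite !ev_meas_word_cons sweedler_sum_precomp; last exact: bilin_ev_meas_word.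
by apply: eq_sweedler_sum => y z; rewrite IH //; exact: multilinear_cons.
Qed.

(** The coproduct of x *t y is computed in both factors at once, so the letters
of a word can be treated one after the other. *)
Lemma ev_meas_word_comp (A A' A'' : calg K) (C D : coalg K)
    (Phi : {linear C -> {linear A -> A'}})
    (Phi' : {linear D -> {linear A' -> A''}})
    (W : lmodType K) s x y (F : seq A'' -> W) : multilinear F ->
  ev (meas_word (C := coalg_tens C D) (meas_comp Phi Phi') s (x *t y)) F
  = ev (meas_word Phi s x) (fun c => ev (meas_word Phi' c y) F).
Proof.
elim: s x y F => [|u s IH] x y F Fl.
  by rewrite !ev_meas_word_nil [counit _ _]tens_counitE -scalerA.
rewrite !ev_meas_word_cons sweedler_sum_tens; last first.
  exact: (bilin_ev_meas_word (C := coalg_tens C D) (meas_comp Phi Phi') s u Fl).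
apply: eq_sweedler_sum => x1 x2;
  under [RHS]eq_ev => c do rewrite ev_meas_word_cons.
rewrite ev_sweedler_sum; apply: eq_sweedler_sum => y1 y2;
  rewrite meas_compE IH //.
exact: multilinear_cons.
Qed.

Lemma ev_meas_word_unit (A : calg K) (W : lmodType K) s (k : K^o)
    (F : seq A -> W) :
  multilinear F ->
  ev (meas_word (C := coalgK K) (meas_unit A) s k) F = (k : K) *: F s.
Proof.
elim: s k F => [|u s IH] k F Fl; first by rewrite ev_meas_word_nil.
rewrite ev_meas_word_cons sweedler_sum_tlift; last exact: bilin_ev_meas_word.
rewrite -[comul _ _]/(k *t (1 : K^o)) tliftE; last exact: bilin_ev_meas_word.
rewrite IH; last exact: multilinear_cons.
by rewrite scale1r; exact: (linearZ_LR (mklin (multilinear_head s Fl))).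
Qed.

Lemma meas_HCprime_ext (A A' : calg K) (f g : {linear HCprime A -> HCprime A'}) :
  (forall p z, cyclep p z -> f (dinj (hclass_of p z) : HCprime_mod A)
     = g (dinj (hclass_of p z) : HCprime_mod A)) -> f = g.
Proof.
move=> fg; apply: lin_ext; elim/HCprime_ind => [|u v fgu fgv|p z]; last exact: fg.
  by rewrite !linear0.
by rewrite !linearD fgu fgv.
Qed.

Lemma meas_HCprime_class (A A' : calg K) (C : coalg K)
    (Phi : {linear C -> {linear A -> A'}}) x p z : umeasuring Phi -> cyclep p z ->
  meas_HCprime Phi x (dinj (hclass_of p z))
    = dinj (hclass_of p (meas_chain Phi x z)) :> HCprime_mod A'.
Proof. by move=> hPhi cz; rewrite meas_HCprimeE meas_HC_class. Qed.

Lemma meas_chain_precomp (A A' : calg K) (C D : coalg K)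
    (Phi : {linear D -> {linear A -> A'}}) (zeta : coalgmor C D) x z :
  umeasuring Phi -> meas_chain (meas_precomp Phi zeta) x z
    = meas_chain Phi (zeta x) z.
Proof.
move=> hPhi; have hPz := umeasuring_precomp zeta hPhi.
elim/chains_ind: z => [|z w|a s]; first by rewrite !linear0.
  by rewrite !linearD => -> ->.
rewrite (meas_chain_word hPz) (meas_chain_word hPhi) ev_meas_word_precomp //.
exact: word_chain_multilinear.
Qed.

Lemma meas_chain_comp (A A' A'' : calg K) (C D : coalg K)
    (Phi : {linear C -> {linear A -> A'}}) (Phi' :
      {linear D -> {linear A' -> A''}}) x y z :
  umeasuring Phi -> umeasuring Phi' ->
  meas_chain (C := coalg_tens C D) (meas_comp Phi Phi') (x *t y) z
    = meas_chain Phi' y (meas_chain Phi x z).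
Proof.
move=> hPhi hPhi'; have hPP := umeasuring_comp hPhi hPhi'.
elim/chains_ind: z => [|z w ez ew|a s]; first by rewrite !linear0.
  by rewrite [LHS]linearD ez ew [meas_chain Phi x (z + w)]linearD [RHS]linearD.
rewrite (meas_chain_word hPP) (meas_chain_word hPhi) ev_meas_word_comp;
  last exact: word_chain_multilinear.
by rewrite ev_lin; apply: eq_ev => c; rewrite (meas_chain_word hPhi').
Qed.

Lemma meas_chain_unit (A : calg K) (k : K^o) (z : chains A) :
  meas_chain (C := coalgK K) (meas_unit A) k z = (k : K) *: z.
Proof.
have hu := umeasuring_unit A.
elim/chains_ind: z => [|z w|a s]; first by rewrite linear0 scaler0.
  by rewrite linearD => -> ->; rewrite scalerDr.
by rewrite (meas_chain_word hu) ev_meas_word_unit //;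
  exact: word_chain_multilinear.
Qed.

Lemma meas_HCprime_precomp (A A' : calg K) (C D : coalg K)
    (Phi : {linear D -> {linear A -> A'}}) (zeta : coalgmor C D) x :
  umeasuring Phi -> meas_HCprime (meas_precomp Phi zeta) x
    = meas_HCprime Phi (zeta x).
Proof.
move=> hPhi; have hPz := umeasuring_precomp zeta hPhi.
apply: meas_HCprime_ext => p z cz.
by rewrite (meas_HCprime_class _ hPz) //
  (meas_HCprime_class _ hPhi) // meas_chain_precomp.
Qed.

Lemma meas_HCprime_comp (A A' A'' : calg K) (C D : coalg K)
    (Phi : {linear C -> {linear A -> A'}}) (Phi' :
      {linear D -> {linear A' -> A''}}) x y u :
  umeasuring Phi -> umeasuring Phi' ->
  meas_HCprime (C := coalg_tens C D) (meas_comp Phi Phi') (x *t y) u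
  = meas_HCprime Phi' y (meas_HCprime Phi x u).
Proof.
move=> hPhi hPhi'; have hPP := umeasuring_comp hPhi hPhi'.
pose f : {linear HCprime A -> HCprime A''} :=
  meas_HCprime Phi' y \o meas_HCprime Phi x.
suff -> :
  meas_HCprime (C := coalg_tens C D) (meas_comp Phi Phi') (x *t y) = f by [].
apply: meas_HCprime_ext => p z cz.
apply: (etrans (meas_HCprime_class (x *t y : coalg_tens C D) hPP cz)).
rewrite meas_chain_comp // -(meas_HCprime_class y hPhi'
  (meas_chain_cycle hPhi x cz)).
by rewrite -(meas_HCprime_class x hPhi cz).
Qed.

Lemma meas_HCprime_unit (A : calg K) (k : K^o) u :
  meas_HCprime (C := coalgK K) (meas_unit A) k u = (k : K) *: u.
Proof.
have hu := umeasuring_unit A.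
pose f : {linear HCprime A -> HCprime A} :=
  (k : K) *: (idfun : {linear HCprime A -> HCprime A}).
suff -> : meas_HCprime (C := coalgK K) (meas_unit A) k = f by [].
apply: meas_HCprime_ext => p z cz.
apply: (etrans (meas_HCprime_class (k : coalgK K) hu cz)).
transitivity (dinj ((k : K) *: hclass_of p z) : HCprime_mod A); last first.
  exact: (linearZ_LR (@dinj _ _ (HC A) p)).
rewrite meas_chain_unit; congr dinj.
rewrite -[_ *: z]addr0 hclass_of_linear //; last exact: cyclep0.
by rewrite hclass_of0 addr0.
Qed.

End Functoriality.

Theorem theorem3p7 (K : fieldType) (charK : [pchar K] =i pred0)
  (Mc : forall A A' : calg K, universal (@umeasuring K A A'))
  (Mt : forall A A' : calg K,
     universal (@measuring K (HCprime A) (HCprime A'))) :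
  exists F : efunctor (C := cALG Mc) (D := cALGt Mt) (fun A : calg K => A),
    forall A A' : calg K, is_tau (M := Mc A A') (Mt := Mt A A') (efun_hom F A A').
Proof.
pose tau A A' := univ_lift (Mt A A') (measuring_HCprime (univ_mapP (Mc A A'))).
have tauE A A' x : univ_map (Mt A A') (tau A A' x)
  = meas_HCprime (univ_map (Mc A A')) x.
  exact: univ_liftE.
have tau_comp A A' A'' (t :
  ehom (e := cALG Mc) A A' ⊗ ehom (e := cALG Mc) A' A'') :
    tau A A'' (ecomp (e := cALG Mc) A A' A'' t)
    = ecomp (e := cALGt Mt) A A' A'' (tmap (tau A A') (tau A' A'') t).
  pose f := coalgmor_comp (tau A A'') (ecomp (e := cALG Mc) A A' A'').
  pose g := coalgmor_comp (ecomp (e := cALGt Mt) A A' A'')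
    (coalgmor_tens (tau A A') (tau A' A'')).
  suff : f =1 g by apply.
  apply: (univ_ext (fun A A' C D Phi zeta =>
    @measuring_precomp K _ _ C D Phi zeta)).
  move=> {}t u; rewrite /f /g /=; tens_induction t x y.
  (* by definition of the composition, the universal measuring restricts along
     it to the composite measuring *)
  have pre : meas_precomp (univ_map (Mc A A'')) (ecomp (e := cALG Mc) A A' A'')
      = meas_comp (univ_map (Mc A A')) (univ_map (Mc A' A'')).
    by apply: lin_ext => w; exact: univ_liftE.
  rewrite tmapE.
  apply: (etrans (congr1 (fun h : {linear _ -> _} => h u)
    (tauE A A'' (ecomp (e := cALG Mc) A A' A'' (x *t y))))).
  apply: (etrans (congr1 (fun h : {linear _ -> _} => h u) (esym
    (meas_HCprime_precomp (ecomp (e := cALG Mc) A A' A'') (x *t y)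
      (univ_mapP (Mc A A'')))))).
  rewrite pre.
  apply: (etrans (meas_HCprime_comp x y u (univ_mapP _) (univ_mapP _))).
  apply/esym; apply: (etrans (meas_ecompE (R := @HCprime K)
    (P := fun X Y => @measuring K (HCprime X) (HCprime Y))
    (fun X Y Z C D Phi Phi' => @measuring_comp K _ _ _ C D Phi Phi')
    (M := Mt) (tau A A' x) (tau A' A'' y) u)).
  apply: (etrans (congr1 (fun h : {linear _ -> _} =>
    univ_map (Mt A' A'') (tau A' A'' y) (h u)) (tauE A A' x))).
  exact: (congr1 (fun h : {linear _ -> _} => h _) (tauE A' A'' y)).
have tau_unit A k :
    tau A A (eunit (e := cALG Mc) A k) = eunit (e := cALGt Mt) A k.
  pose f := coalgmor_comp (tau A A) (eunit (e := cALG Mc) A).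
  suff : f =1 eunit (e := cALGt Mt) A by apply.
  apply: (univ_ext (fun A A' C D Phi zeta =>
    @measuring_precomp K _ _ C D Phi zeta)).
  move=> {}k u; rewrite /f /=.
  have pre : meas_precomp (univ_map (Mc A A)) (eunit (e := cALG Mc) A)
    = meas_unit A.
    by apply: lin_ext => w; exact: univ_liftE.
  apply: (etrans (congr1 (fun h : {linear _ -> _} => h u)
    (tauE A A (eunit (e := cALG Mc) A k)))).
  apply: (etrans (congr1 (fun h : {linear _ -> _} => h u) (esym
    (meas_HCprime_precomp (eunit (e := cALG Mc) A) k (univ_mapP (Mc A A)))))).
  rewrite pre; apply: (etrans (meas_HCprime_unit k u)).
  by apply/esym; exact: (meas_eunitE (R := @HCprime K)
    (P := fun X Y => @measuring K (HCprime X) (HCprime Y))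
    (fun X => @measuring_unit K (HCprime X)) Mt k u).
exists (Efunctor (F := fun A : cALG Mc => A : cALGt Mt) tau_comp tau_unit).
move=> A A'; split=> [x|t' t'E x]; first exact: tauE.
have [zeta [_ zeta_uniq]] := univP (Mt A A') (measuring_HCprime (univ_mapP
  (Mc A A'))).
by rewrite (zeta_uniq _ t'E) -(zeta_uniq (tau A A') (tauE A A')).
Qed.
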